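(* For every $(x,i)\in\mathcal{O}=\mathbb{R}_+\times\mathcal{M}$ there exists a unique (up to indistinguishability) control $\varphi^\star=\xi^\star-\eta^\star\in\mathcal{A}(x,i)$ that is optimal for the problem $$V(x,i)=\inf_{\varphi\in\mathcal{A}(x,i)}\mathcal{J}_{x,i}(\varphi),$$ i.e. such that $\mathcal{J}_{x,i}(\varphi^\star)=V(x,i)$.
   Context: **Probabilistic setting.** $\mathbb{R}_+=[0,\infty)$, $N\ge 2$, $\mathcal{M}=\{1,\dots,N\}$, $\mathcal{O}=\mathbb{R}_+\times\mathcal{M}$. $(\Omega,\mathcal{F},\mathsf{P})$ is a complete probability space carrying a one-dimensional Brownian motion $W$ and an independent continuous-time Markov chain $Y$ on $\mathcal{M}$ with irreducible generator $Q=(q_{ij})$, $q_{ij}\ge0$ for $j\ne i$, $q_{ii}=-\sum_{j\ne i}q_{ij}<0$. $\mathbb{F}=(\mathcal{F}_t)_{t\ge0}$ is the filtration jointly generated by $W$ and $Y$, augmented by $\mathsf{P}$-null sets. $Y^i$ denotes $Y$ started from $i$. **Parameters.** $r>0$, $g\in\mathbb{R}$, $\sigma>0$, real numbers $\lambda_1\ge\lambda_2\ge\dots\ge\lambda_N$, discount rates $\rho_1,\dots,\rho_N\in[\underline\rho,\overline\rho]$ with $0<\underline\rho\le\overline\rho$, and $c_1,c_2>0$. **State process.** $X^{1,i,0}_t=\exp\{(r-g-\tfrac12\sigma^2)t+\int_0^t\lambda_{Y^i_s}ds+\sigma W_t\}$. $\mathcal{V}$ is the set of $\mathbb{F}$-adapted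 real processes $\varphi$ that are a.s. left-continuous, (locally) of bounded variation, with $\varphi_0=0$; each is written in its minimal decomposition $\varphi=\xi-\eta$, with $\xi,\eta$ nondecreasing, left-continuous, adapted, $\xi_0=\eta_0=0$, and $d\xi,d\eta$ having disjoint supports. For $\varphi\in\mathcal{V}$, $$X^{x,i,\varphi}_t=X^{1,i,0}_t\Big[x+\int_{[0,t)}\frac{d\xi_s}{X^{1,i,0}_s}-\int_{[0,t)}\frac{d\eta_s}{X^{1,i,0}_s}\Big],\quad t\ge0,$$ the unique strong solution of $dX_t=(r+\lambda_{Y_t}-g)X_tdt+\sigma X_tdW_t+d\xi_t-d\eta_t$, $X_0=x$, $Y_0=i$. Integrals $\int_0^t(\cdot)d\xi_s$, $\int_0^t(\cdot)d\eta_s$ are over $[0,t)$, $t\in[0,\infty]$. $\mathsf{E}_{(x,i)}$ is expectation given $X_0=x,Y_0=i$. **Control problem.** $\mathcal{A}(x,i)$ is the set of $\varphi\in\mathcal{V}$ with $\mathsf{E}_{(x,i)}[\int_0^\infty e^{-\int_0^t\rho_{Y_s}ds}(d\eta_t+d\xi_t)]<\infty$ and $X^{x,i,\varphi}_t\ge0$ $\mathsf{P}\otimes dt$-a.e. The cost is $$\mathcal{J}_{x,i}(\varphi)=\mathsf{E}_{(x,i)}\Big[\int_0^\infty e^{-\int_0^t\rho_{Y_s}ds}h(X^\varphi_t,Y_t)dt+c_1\int_0^\infty e^{-\int_0^t\rho_{Y_s}ds}d\eta_t-c_2\int_0^\infty e^{-\int_0^t\rho_{Y_s}ds}d\xi_t\Big].$$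 **Assumptions on $h:\mathbb{R}\times\mathcal{M}\to\mathbb{R}_+$** (for each $i$): (i) $h(\cdot,i)$ is strictly convex, continuously differentiable and increasing on $[0,\infty)$, and $h(x,i)=0$ for $x\le0$; (ii) $h_x(0,i)=0$, $\lim_{x\to\infty}h_x(x,i)=+\infty$; (iii) there are $m>1$, $K_1,K_2,K_3>0$ with $h(x,i)\le K_1(1+|x|^m)$, $|h_x(x,i)|\le K_2(1+|x|^{m-1})$ for $x\in\mathbb{R}$, and $|h_x(x,i)-h_x(y,i)|\le K_3|x-y|(1+|x|^{(m-2)^+})$ for $x,y\in\mathbb{R}$; (iv) $\sup_{x\ge0}(px-h(x,i))<\infty$ for all $p>0$. **Assumptions on parameters.** $c_1(\underline\rho-r+g-\lambda_1)>c_2(\overline\rho-r+g-\lambda_N)$, and $\underline\rho>\big((r-g+\lambda_1)\vee(m(r-g+\lambda_1)+\tfrac{\sigma^2}{2}m(m-1))\big)^+$. *)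

(* Defs.v *)
From HB Require Import structures.
From mathcomp Require Import all_boot all_order all_algebra.
From mathcomp Require Import ring.
From mathcomp Require Import all_classical all_reals all_analysis.

Set Implicit Arguments.
Unset Strict Implicit.
Unset Printing Implicit Defensive.
Import Order.TTheory GRing.Theory Num.Theory.
Import numFieldNormedType.Exports.
Local Open Scope classical_set_scope.
Local Open Scope ring_scope.

(* Conventions.  Time is [0, +oo[ inside R: processes have type
   R -> Omega -> _ and their values at negative times are never used.  The
   regimes 1, ..., N (N >= 2) are the elements of 'I_n.+2, with N = n.+2,
   regime 1 being ord0 and regime N being ord_max. *)

Definition nondecreasing_path (R : realType) (f : R -> R) : Prop :=
  {in `[0, +oo[ &, {homo f : s t / s <= t}}.

(* The library's Stieltjes measure of a right-continuous F gives mass F b - F a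
   to ]a, b].  The measure df of a left-continuous nondecreasing path f on
   [0, +oo[, with df [a, b[ = f b - f a (so that an initial jump f(0+) - f(0)
   is an atom at 0), is obtained from F(t) = f(t+), constant equal to f(0) for
   t < 0; see stieltjes_itvco.  Paths that are not nondecreasing (they will
   have probability 0) are given the measure 0. *)
Definition stieltjes_cdf (R : realType) (f : R -> R) (t : R) : R :=
  if `[< nondecreasing_path f >] then
    if 0 <= t then inf (f @` `]t, +oo[) else f 0
  else 0.

Section stieltjes_cdf_cumulative.
Context {R : realType}.
Implicit Types f : R -> R.

Lemma ndpath_has_inf f t : nondecreasing_path f -> 0 <= t ->
  has_inf (f @` `]t, +oo[).
Proof.
move=> ndf t0; split.
  by exists (f (t + 1)), (t + 1) => //=; rewrite in_itv/= andbT ltrDl.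
exists (f t) => _ /= [s + <-]; rewrite in_itv/= andbT => ts.
by apply: ndf; rewrite ?in_itv/= ?andbT//; [exact: le_trans (ltW ts)|exact: ltW].
Qed.

Lemma ndpath_inf_ge f t : nondecreasing_path f -> 0 <= t ->
  f t <= inf (f @` `]t, +oo[).
Proof.
move=> ndf t0; apply: lb_le_inf; first by case: (ndpath_has_inf ndf t0).
move=> _ /= [s + <-]; rewrite in_itv/= andbT => ts.
by apply: ndf; rewrite ?in_itv/= ?andbT//; [exact: le_trans (ltW ts)|exact: ltW].
Qed.

Lemma ndpath_inf_le f s t : nondecreasing_path f -> 0 <= t -> t < s ->
  inf (f @` `]t, +oo[) <= f s.
Proof.
move=> ndf t0 ts; apply: ge_inf; first by case: (ndpath_has_inf ndf t0).
by exists s => //=; rewrite in_itv/= andbT.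
Qed.

Lemma stieltjes_cdf_nd f : nondecreasing (stieltjes_cdf f).
Proof.
move=> s t st; rewrite /stieltjes_cdf; case: ifPn => // /asboolP ndf.
have [s0|s0] := leP 0 s.
  have t0 := le_trans s0 st; rewrite t0.
  move: st; rewrite le_eqVlt => /predU1P[->//|st].
  by rewrite (le_trans (ndpath_inf_le ndf s0 st))// ndpath_inf_ge.
case: ifPn => // t0; rewrite (le_trans _ (ndpath_inf_ge ndf t0))//.
by apply: ndf; rewrite ?in_itv/= ?andbT.
Qed.

Lemma stieltjes_cdf_rc f : right_continuous (stieltjes_cdf f).
Proof.
move=> t; apply/cvgrPdist_le => e e0.
have [ndf|Nndf] := pselect (nondecreasing_path f); last first.
  by near=> s; rewrite /stieltjes_cdf asboolF// subrr normr0 ltW.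
have [t0|t0] := leP 0 t; last first.
  near=> s.
  suff -> : stieltjes_cdf f s = stieltjes_cdf f t by rewrite subrr normr0 ltW.
  have s0 : s < 0 by near: s; apply: nbhs_right_lt.
  by rewrite /stieltjes_cdf asboolT// !leNgt s0 t0.
have [_ [u + <-] fu] := inf_adherent e0 (ndpath_has_inf ndf t0).
rewrite /= in_itv/= andbT => tu.
near=> s.
have ts : t < s by near: s; apply: nbhs_right_gt.
have su : s < u by near: s; apply: nbhs_right_lt.
rewrite distrC ger0_norm ?subr_ge0 ?stieltjes_cdf_nd ?(ltW ts)//.
rewrite /stieltjes_cdf asboolT// t0 (ltW (le_lt_trans t0 ts)) lerBlDr addrC.
rewrite (le_trans _ (ltW fu))// ndpath_inf_le//.
exact: ltW (le_lt_trans t0 ts).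
Unshelve. all: by end_near. Qed.

HB.instance Definition _ f := isCumulative.Build R _ R (stieltjes_cdf f)
  (@stieltjes_cdf_nd f) (@stieltjes_cdf_rc f).

End stieltjes_cdf_cumulative.

Definition stieltjes (R : realType) (f : R -> R) :=
  lebesgue_stieltjes_measure (stieltjes_cdf f).
HB.instance Definition _ (R : realType) (f : R -> R) :=
  Measure.on (stieltjes f).

Section stieltjes_itv.
Context {R : realType}.
Variable f : R -> R.
Hypothesis ndf : nondecreasing_path f.

Lemma stieltjes_itvoc (a b : R) : a <= b ->
  stieltjes f `]a, b]%classic = (stieltjes_cdf f b - stieltjes_cdf f a)%:E.
Proof.
move=> ab; rewrite /stieltjes /lebesgue_stieltjes_measure /measure_extension/=.
by rewrite measurable_mu_extE/= ?wlength_itv_bnd//; exact: is_ocitv.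
Qed.

Hypothesis lcf : forall t : R, 0 < t -> f s @[s --> t^'-] --> f t.

Lemma stieltjes_cdf_left (t : R) : 0 <= t ->
  stieltjes_cdf f (t - n.+1%:R^-1) @[n --> \oo] --> f t.
Proof.
rewrite le_eqVlt => /predU1P[<-|t0].
  rewrite (_ : (fun n => _) = cst (f 0)); first exact: cvg_cst.
  apply/funext => n; rewrite /stieltjes_cdf asboolT// sub0r oppr_ge0.
  by rewrite leNgt invr_gt0 ltr0Sn.
have ft : f (t - n.+1%:R^-1) @[n --> \oo] --> f t.
  have /cvg_at_leftP := lcf t0; apply; split.
    by move=> n; rewrite ltrBlDr ltrDl invr_gt0.
  rewrite -[X in _ --> X]subr0; apply: cvgB; first exact: cvg_cst.
  exact: cvg_harmonic.
apply: (squeeze_cvgr _ ft (cvg_cst (f t))).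
near=> n.
have n0 : 0 <= t - n.+1%:R^-1.
  rewrite subr_ge0; near: n.
  exact: (cvgr_le _ (@cvg_harmonic R)).
have nt : t - n.+1%:R^-1 < t by rewrite ltrBlDr ltrDl invr_gt0.
rewrite /stieltjes_cdf asboolT// n0 ndpath_inf_ge//=.
exact: ndpath_inf_le.
Unshelve. all: by end_near. Qed.

Lemma stieltjes_itvco (a b : R) : 0 <= a -> a <= b ->
  stieltjes f `[a, b[%classic = (f b - f a)%:E.
Proof.
have FN1 : stieltjes_cdf f (-1) = f 0.
  by rewrite /stieltjes_cdf asboolT// oppr_ge0 leNgt ltr01.
have H (t : R) : 0 <= t ->
    stieltjes f `](-1), t[%classic = (f t - f 0)%:E.
  move=> t0.
  have tn n : -1 <= t - (n.+1%:R : R)^-1.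
    by rewrite lerBrDr addrC (le_trans _ t0)// subr_le0 invf_le1 ?ler1n.
  have E : `](-1), t[%classic =
      \bigcup_n `](-1), t - (n.+1%:R : R)^-1]%classic.
    apply/seteqP; split => x /=; rewrite !in_itv/=.
      move=> /andP[x1 xt].
      have : \forall n \near \oo, (n.+1%:R : R)^-1 < t - x.
        by apply: (cvgr_lt _ (@cvg_harmonic R)); rewrite subr_gt0.
      move=> [n _ /(_ n (leqnn n)) Hn]; exists n => //=.
      by rewrite in_itv/= x1/= lerBrDr addrC -lerBrDr ltW.
    move=> [n _]; rewrite /= in_itv/= => /andP[-> /le_lt_trans]; apply.
    by rewrite ltrBlDr ltrDl invr_gt0.
  have := @nondecreasing_cvg_mu _ _ _ (stieltjes f)
    (fun n => `](-1), t - (n.+1%:R : R)^-1]%classic).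
  rewrite -E => /(_ (fun=> measurable_itv _) (measurable_itv _)).
  have -> : stieltjes f \o (fun n => `](-1), t - (n.+1%:R : R)^-1]%classic) =
      fun n => (stieltjes_cdf f (t - n.+1%:R^-1) - f 0)%:E.
    by apply/funext => n /=; rewrite stieltjes_itvoc ?FN1.
  move=> C; apply: (cvg_unique _ (C _)) => //.
    move=> m n mn; apply/subsetPset => x /=; rewrite !in_itv/= => /andP[-> /=].
    by move=> /le_trans; apply; rewrite lerB// lef_pV2 ?posrE// ler_nat.
  apply: cvg_EFin; first exact: nearW.
  by apply: cvgB; [exact: stieltjes_cdf_left|exact: cvg_cst].
move=> a0 ab; have b0 := le_trans a0 ab.
have := H _ b0.
have -> : `](-1), b[%classic = `](-1), a[%classic `|` `[a, b[%classic.
  have := @itv_bndbnd_setU _ R (BRight (-1)) (BLeft a) (BLeft b).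
  by move=> -> //; rewrite bnd_simp// (lt_le_trans _ a0)// ltrN10.
rewrite measureU//=; last first.
  apply/seteqP; split => // x /= []; rewrite !in_itv/= => /andP[_ xa] /andP[ax _].
  by move: xa; rewrite ltNge ax.
rewrite [X in (X + _)%E]H//; case: (_ `[a, b[%classic) => [r| |] //=.
by rewrite -EFinD => -[/eqP]; rewrite addrC eq_sym -subr_eq => /eqP <-; congr (_%:E); ring.
Qed.

End stieltjes_itv.

Section processes.
Context {R : realType} {d : measure_display} {Omega : measurableType d}.
Variable P : probability Omega R.

(* The events {W_u \in B} for u in a set T of times; <<s _ >> of this family is
   the sigma-algebra generated by the W_u, u in T. *)
Definition real_events (W : R -> Omega -> R) (T : set R) : set (set Omega) :=
  [set E | exists u B, [/\ T u, measurable B & E = W u @^-1` B]].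

Definition chain_events (I : Type) (Y : R -> Omega -> I) (T : set R)
  : set (set Omega) :=
  [set E | exists u j, T u /\ E = Y u @^-1` [set j]].

Definition independent (G H : set (set Omega)) : Prop :=
  forall A B, G A -> H B -> P (A `&` B) = (P A * P B)%E.

Record brownian_motion (W : R -> Omega -> R) : Prop := BrownianMotion {
  bm_measurable : forall t : R, 0 <= t -> measurable_fun setT (W t);
  bm_start : {ae P, forall w, W 0 w = 0};
  bm_continuous : {ae P, forall w,
    {within `[0, +oo[%classic, continuous (W ^~ w)}};
  (* the second argument of normal_prob is the standard deviation *)
  bm_gaussian : forall s t : R, 0 <= s -> s < t -> forall B : set R, measurable B ->
    P ((fun w => W t w - W s w) @^-1` B) = normal_prob 0 (Num.sqrt (t - s)) B;
  bm_independent : forall s t : R, 0 <= s -> s < t ->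
    independent <<s real_events W `[0, s]%classic >>
      [set (fun w => W t w - W s w) @^-1` B | B in measurable] }.

Record irreducible_generator (n : nat) (Q : 'M[R]_n) : Prop :=
  IrreducibleGenerator {
  gen_offdiag : forall i j, j != i -> 0 <= Q i j;
  gen_diag : forall i, Q i i = - \sum_(j | j != i) Q i j;
  gen_diag_lt0 : forall i, Q i i < 0;
  gen_irreducible : forall i j, connect (fun a b => 0 < Q a b) i j }.

Record transition_semigroup (n : nat) (Q : 'M[R]_n) (p : R -> 'M[R]_n) : Prop :=
  TransitionSemigroup {
  ts_ge0 : forall t : R, 0 <= t -> forall i j, 0 <= p t i j;
  ts_sum1 : forall t : R, 0 <= t -> forall i, \sum_j p t i j = 1;
  ts_start : p 0 = 1%:M;
  ts_add : forall s t : R, 0 <= s -> 0 <= t -> p (s + t) = p s *m p t;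
  ts_generator : forall i j,
    (p e i j - (i == j)%:R) / e @[e --> 0^'+] --> Q i j }.

Record markov_chain (n : nat) (Q : 'M[R]_n) (i : 'I_n) (Y : R -> Omega -> 'I_n)
  : Prop := MarkovChain {
  mc_measurable : forall t : R, 0 <= t -> forall j, measurable (Y t @^-1` [set j]);
  mc_start : {ae P, forall w, Y 0 w = i};
  (* right-continuous paths with left limits in a discrete space *)
  mc_cadlag : {ae P, forall w,
    (forall t : R, 0 <= t -> \forall s \near t^'+, Y s w = Y t w) /\
    (forall t : R, 0 < t -> exists j, \forall s \near t^'-, Y s w = j)};
  mc_markov : exists2 p, transition_semigroup Q p &
    forall s t : R, 0 <= s -> s <= t ->
    forall A, <<s chain_events Y `[0, s]%classic >> A -> forall a b,
      P (A `&` Y s @^-1` [set a] `&` Y t @^-1` [set b]) =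
      (P (A `&` Y s @^-1` [set a]) * (p (t - s) a b)%:E)%E }.

(* The P-augmented filtration jointly generated by W and Y. *)
Definition filtration (I : Type) (W : R -> Omega -> R) (Y : R -> Omega -> I)
    (t : R) : set (set Omega) :=
  <<s real_events W `[0, t]%classic `|` chain_events Y `[0, t]%classic `|`
      [set A | P.-negligible A] >>.

Definition adapted (F : R -> set (set Omega)) (phi : R -> Omega -> R) : Prop :=
  forall t : R, 0 <= t -> forall B : set R, measurable B -> F t (phi t @^-1` B).

Definition indistinguishable (phi psi : R -> Omega -> R) : Prop :=
  {ae P, forall w, forall t : R, 0 <= t -> phi t w = psi t w}.

Definition left_continuous_path (f : R -> R) : Prop :=
  forall t : R, 0 < t -> f s @[s --> t^'-] --> f t.

Record bv_process (F : R -> set (set Omega)) (phi : R -> Omega -> R) : Prop :=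
  BVProcess {
  bv_adapted : adapted F phi;
  bv_start : {ae P, forall w, phi 0 w = 0};
  bv_left_continuous : {ae P, forall w, left_continuous_path (phi ^~ w)};
  bv_bounded_variation : {ae P, forall w,
    forall t : R, 0 <= t -> bounded_variation 0 t (phi ^~ w)} }.

(* Two measures on [0, +oo[ have disjoint supports when they are carried by
   disjoint Borel sets.  (Closed supports need not be disjoint, e.g. when one
   measure has an atom at 0 and the other has a density on ]0, 1[.) *)
Definition disjoint_supports (mu nu : set R -> \bar R) : Prop :=
  exists A : set R, [/\ measurable A, mu (~` A) = 0%E & nu A = 0%E].

Record minimal_decomposition (F : R -> set (set Omega))
    (phi xi eta : R -> Omega -> R) : Prop := MinimalDecomposition {
  md_adapted : adapted F xi /\ adapted F eta;
  md_start : {ae P, forall w, xi 0 w = 0 /\ eta 0 w = 0};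
  md_nondecreasing : {ae P, forall w,
    nondecreasing_path (xi ^~ w) /\ nondecreasing_path (eta ^~ w)};
  md_left_continuous : {ae P, forall w,
    left_continuous_path (xi ^~ w) /\ left_continuous_path (eta ^~ w)};
  md_difference : {ae P, forall w,
    forall t : R, 0 <= t -> phi t w = xi t w - eta t w};
  md_disjoint : {ae P, forall w,
    disjoint_supports (stieltjes (xi ^~ w)) (stieltjes (eta ^~ w))} }.

End processes.

(* A control phi together with the two parts xi, eta of its minimal
   decomposition phi = xi - eta (unique up to indistinguishability). *)
Record control (R : realType) (Omega : Type) := Control {
  ctl : R -> Omega -> R;
  ctl_xi : R -> Omega -> R;
  ctl_eta : R -> Omega -> R }.

Record model (R : realType) (n : nat) := Model {
  rr : R;                     (* r *)
  gg : R;                     (* g *)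
  sigma : R;
  lambda : 'I_n.+2 -> R;
  rho : 'I_n.+2 -> R;
  c1 : R;
  c2 : R;
  h : R -> 'I_n.+2 -> R }.

Definition h_x (R : realType) (n : nat) (M : model R n) (x : R) (i : 'I_n.+2)
  : R := derive1 (h M ^~ i) x.

(* h_x is the two-sided derivative; at 0 this agrees with the one-sided one, as
   h vanishes on ]-oo, 0] and h_x(0, i) = 0. *)
Record running_cost_assumptions (R : realType) (n : nat) (M : model R n) (m : R)
  (i : 'I_n.+2) : Prop := RunningCostAssumptions {
  h_ge0 : forall x : R, 0 <= h M x i;
  h_strictly_convex : forall x y a : R, 0 <= x -> 0 <= y -> x != y -> 0 < a < 1 ->
    h M (a * x + (1 - a) * y) i < a * h M x i + (1 - a) * h M y i;
  h_derivable : forall x : R, 0 <= x -> derivable (h M ^~ i) x 1;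
  h_x_continuous : {within `[0, +oo[%classic, continuous (h_x M ^~ i)};
  h_increasing : {in `[0, +oo[ &, {homo h M ^~ i : x y / x < y}};
  h_le0 : forall x : R, x <= 0 -> h M x i = 0;
  h_x0 : h_x M 0 i = 0;
  h_x_pinfty : h_x M x i @[x --> +oo] --> +oo;
  h_growth : exists K1 K2 K3 : R, [/\ 0 < K1, 0 < K2, 0 < K3 &
    [/\ forall x : R, h M x i <= K1 * (1 + `|x| `^ m),
        forall x : R, `|h_x M x i| <= K2 * (1 + `|x| `^ (m - 1)) &
        forall x y : R, `|h_x M x i - h_x M y i| <=
          K3 * `|x - y| * (1 + `|x| `^ Num.max (m - 2) 0)]];
  h_conjugate : forall p : R, 0 < p ->
    (ereal_sup [set (p * x - h M x i)%:E | x in `[0%R, +oo[%classic] < +oo)%E }.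

Section problem.
Context {R : realType} {n : nat} {d : measure_display} {Omega : measurableType d}.
Variables (P : probability Omega R) (M : model R n).
Variables (W : R -> Omega -> R) (Y : R -> Omega -> 'I_n.+2).
Local Notation leb := (@lebesgue_measure R).

(* Here Y is the chain Y^i started from the initial regime i. *)

Definition state1 (t : R) (w : Omega) : R :=
  expR ((rr M - gg M - sigma M ^+ 2 / 2) * t
        + \int[leb]_(s in `[0, t]) lambda M (Y s w) + sigma M * W t w).

Definition state (x : R) (phi : control R Omega) (t : R) (w : Omega) : R :=
  state1 t w *
  (x + \int[stieltjes (ctl_xi phi ^~ w)]_(s in `[0, t[) (state1 s w)^-1
     - \int[stieltjes (ctl_eta phi ^~ w)]_(s in `[0, t[) (state1 s w)^-1).

Definition discount (t : R) (w : Omega) : R :=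
  expR (- \int[leb]_(s in `[0, t]) rho M (Y s w)).

Definition discounted_total (xi : R -> Omega -> R) (w : Omega) : \bar R :=
  (\int[stieltjes (xi ^~ w)]_(t in `[0%R, +oo[) (discount t w)%:E)%E.

Definition admissible (x : R) : set (control R Omega) :=
  [set phi |
    [/\ bv_process P (filtration P W Y) (ctl phi),
        minimal_decomposition P (filtration P W Y)
          (ctl phi) (ctl_xi phi) (ctl_eta phi),
        (\int[P]_w (discounted_total (ctl_eta phi) w +
                    discounted_total (ctl_xi phi) w) < +oo)%E &
        {ae (P \x leb)%E, forall z : Omega * R,
          0 <= z.2 -> 0 <= state x phi z.2 z.1}]].

(* On admissible controls only the running cost can contribute +oo, so the sum
   under the expectation is never of the form oo - oo (almost surely). *)
Definition cost (x : R) (phi : control R Omega) : \bar R :=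
  (\int[P]_w
     (\int[leb]_(t in `[0%R, +oo[)
        (discount t w * h M (state x phi t w) (Y t w))%:E
      + (c1 M)%:E * discounted_total (ctl_eta phi) w
      - (c2 M)%:E * discounted_total (ctl_xi phi) w))%E.

Definition value (x : R) : \bar R := ereal_inf [set cost x phi | phi in admissible x].

Definition optimal (x : R) (phi : control R Omega) : Prop :=
  admissible x phi /\ cost x phi = value x.

End problem.

(* Main.v *)
(* Write [D] for the discount factor, [X1] for [X^{1,i,0}], [kap = rho + g - r - lambda(Y)] (positive by
   assumption) and [Z = D X1].  In the variables [L1_t = int_[0,t) dxi / X1], [L2_t = int_[0,t) deta / X1]
   the state is [X = X1 (x + L1 - L2)], affine in the control.  Since [Z] is a supermartingale with
   Doob-Meyer drift [-kap Z dt], every adapted increasing [L] satisfies [E int Z dL = E int kap Z L dt],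
   and [J] becomes, up to an additive constant, the convex functional
     [Psi(L1, L2) = E int D (h(X, Y) - c2 kap X + (c1 - c2) kap X1 L2 + K) dt],
   whose integrand is nonnegative for [K] large because [c2 < c1] and [h] is superlinear.
   Existence: among near-minimisers one that almost minimises the strictly convex
   [E int D (exp(-L1) + exp(-L2)) dt] is chosen; by the parallelogram identity these converge almost
   everywhere, and the left-continuous regularisation of the limit is a minimiser by Fatou's lemma.
   A minimising pair is turned into a control by [xi_t = int_[0,t) X1 dL1], [eta_t = int_[0,t) X1 dL2]
   and by removing from [xi] and [eta] the common part of [dxi] and [deta], which lowers [Psi].
   Uniqueness: strict convexity of [h] determines [X] almost everywhere, hence [L1 - L2], hence [phi]. *)
Require Import Defs.
From HB Require Import structures.
From mathcomp Require Import all_boot all_order all_algebra.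
From mathcomp Require Import ring lra finmap.
From mathcomp Require Import all_classical all_reals all_analysis measurable_realfun.

Set Implicit Arguments.
Unset Strict Implicit.
Unset Printing Implicit Defensive.
Import Order.TTheory GRing.Theory Num.Theory.
Import numFieldNormedType.Exports.
Local Open Scope classical_set_scope.
Local Open Scope ring_scope.

(** * Stieltjes integrals along dyadic grids *)

(** The identity for [E int Z dL] is proved without stochastic integration. On a dyadic grid the
    increment of [L] over a cell is known at the right end of that cell, so the martingale factor of
    [Z] may be replaced there by its terminal value; pathwise integration by parts against the
    decreasing factor does the rest. The obstacle is the passage to the limit, as [Z] and [L] are
    unbounded: Fatou's lemma gives one inequality, truncations of [Z] and [L] with second moments of
    the exponential martingale give the other. [Psi] is affine along common shifts of [L1] and [L2],
    so its convexity alone does not make near-minimisers converge. The auxiliary functional is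
    bounded whatever the size of [L1] and [L2]; the price is that [exp(-L)] may tend to 0, which the
    coercivity of the integrand of [Psi] excludes. Costs may be infinite, so the identities relating
    [Psi] to the cost are written additively. Almost sure path properties become sure ones by
    modifying processes on a null set; adaptedness survives because the filtration contains the null
    sets. *)

Section grid.
Context {R : realType}.
Implicit Types (s t T : R) (n k : nat).

Definition grid n k T : R := Num.min (k%:R / 2 ^+ n) T.
Definition gsize n T : nat := ((Num.truncn T).+1 * 2 ^ n)%N.
Definition gidx n s : nat := Num.truncn (s * 2 ^+ n).

Lemma pow2_gt0 n : 0 < (2 : R) ^+ n. Proof. by rewrite exprn_gt0. Qed.

Lemma grid0 n T : 0 <= T -> grid n 0 T = 0.
Proof. by move=> T0; rewrite /grid mul0r min_l. Qed.

Lemma grid_size n T : 0 <= T -> grid n (gsize n T) T = T.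
Proof.
move=> T0; rewrite /grid /gsize natrM natrX mulfK ?gt_eqF ?pow2_gt0//.
by rewrite min_r// ltW// truncnS_gt.
Qed.

Lemma le_grid n T k l : (k <= l)%N -> grid n k T <= grid n l T.
Proof.
move=> kl; rewrite /grid le_min2// ler_pM2r ?invr_gt0 ?pow2_gt0//.
by rewrite ler_nat.
Qed.

Lemma grid_ge0 n k T : 0 <= T -> 0 <= grid n k T.
Proof. by move=> T0; rewrite /grid le_min T0 andbT divr_ge0// ltW// pow2_gt0. Qed.

Lemma grid_le n k T : grid n k T <= T.
Proof. by rewrite /grid ge_min lexx orbT. Qed.

Lemma gidx_itv n T s k : 0 <= s < T ->
  (gidx n s == k) = (grid n k T <= s < grid n k.+1 T).
Proof.
move=> /andP[s0 sT]; rewrite /gidx truncn_eq ?mulr_ge0 ?(ltW (pow2_gt0 n))//.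
rewrite /grid ge_min lt_min sT andbT (leNgt T s) sT orbF.
by rewrite ler_pdivrMr ?pow2_gt0// ltr_pdivlMr ?pow2_gt0.
Qed.

Lemma gidx_size n T s : 0 <= s < T -> (gidx n s < gsize n T)%N.
Proof.
move=> /andP[s0 sT]; rewrite /gidx truncn_lt_nat ?mulr_ge0 ?(ltW (pow2_gt0 n))//.
rewrite /gsize natrM natrX ltr_pM2r ?pow2_gt0//.
exact: lt_trans (truncnS_gt _).
Qed.

Lemma grid_gidx n s T : 0 <= s < T ->
  grid n (gidx n s) T <= s < grid n (gidx n s).+1 T.
Proof. by move=> sT; rewrite -(gidx_itv _ _ sT). Qed.

Lemma grid_mesh n k T : grid n k.+1 T <= grid n k T + (2 ^+ n)^-1.
Proof.
have : 0 < (2 ^+ n)^-1 :> R by rewrite invr_gt0 pow2_gt0.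
rewrite /grid -(natr1 k) mulrDl mul1r.
move: (_ ^-1) (_ / _) => b a b0.
by case: (leP (a + b) T); case: (leP a T); lra.
Qed.

Lemma cvg_pow2V : (2 ^+ n : R)^-1 @[n --> \oo] --> 0.
Proof.
have := @cvg_expr R (2^-1); rewrite ger0_norm ?invr_ge0// => /(_ _).
under eq_cvg do rewrite exprVn.
by apply; rewrite invf_lt1// ltr1n.
Qed.

Lemma cvg_grid_left s T : 0 <= s < T -> grid n (gidx n s) T @[n --> \oo] --> s.
Proof.
move=> sT; apply: (@squeeze_cvgr _ _ _ _ (fun n => s - (2 ^+ n)^-1) (fun=> s)).
- near=> n; have /andP[h1 h2] := grid_gidx n sT.
  by rewrite h1 andbT lerBlDr (le_trans (ltW h2))// grid_mesh.
- by rewrite -[X in _ --> X]subr0; apply: cvgB; [exact: cvg_cst|exact: cvg_pow2V].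
- exact: cvg_cst.
Unshelve. all: by end_near. Qed.

Lemma cvg_grid_right s T : 0 <= s < T -> grid n (gidx n s).+1 T @[n --> \oo] --> s.
Proof.
move=> sT; apply: (@squeeze_cvgr _ _ _ _ (fun=> s) (fun n => s + (2 ^+ n)^-1)).
- near=> n; have /andP[h1 h2] := grid_gidx n sT.
  by rewrite (ltW h2)/= (le_trans (grid_mesh _ _ _))// lerD2r.
- exact: cvg_cst.
- by rewrite -[X in _ --> X]addr0; apply: cvgD; [exact: cvg_cst|exact: cvg_pow2V].
Unshelve. all: by end_near. Qed.

Section integral_step.
Variable mu : {measure set (measurableTypeR R) -> \bar R}.

Let stepE n T (a : nat -> R) s : 0 <= s < T ->
  (a (gidx n s))%:E =
  (\sum_(k < gsize n T) (a k * \1_(`[grid n k T, grid n k.+1 T[%classic) s)%:E)%E.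
Proof.
move=> sT; rewrite (bigD1 (Ordinal (gidx_size n sT)))//= big1 ?adde0.
  rewrite indicE mem_set ?mulr1//=; rewrite in_itv/=; exact: grid_gidx.
move=> k /negP kn; rewrite indicE memNset ?mulr0//= in_itv/= => H; apply: kn.
by apply/eqP/val_inj => /=; apply/esym/eqP; rewrite (gidx_itv _ _ sT).
Qed.

Lemma measurable_step n T (a : nat -> R) :
  measurable_fun `[0, T[ (fun s => a (gidx n s)).
Proof.
apply: (@eq_measurable_fun _ _ _ _ _ (fun s => (\sum_(k < gsize n T) (a k * \1_(`[grid n k T, grid n k.+1 T[%classic) s)))).
  move=> s; rewrite inE/= in_itv/= => sT; apply: EFin_inj.
  by rewrite -sumEFin (@stepE _ T).
apply: measurable_sum => k; exact: measurable_funM.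
Qed.

Lemma ge0_integral_step n T (a g : R -> R) (b : nat -> R) : (forall k, 0 <= b k) ->
  measurable_fun `[0, T[ g -> (forall s, 0 <= s < T -> 0 <= g s) ->
  (forall s, 0 <= s < T -> a s = b (gidx n s)) ->
  (\int[mu]_(s in `[0%R, T[) (a s * g s)%:E =
   \sum_(k < gsize n T) (b k)%:E * \int[mu]_(s in `[grid n k T, grid n k.+1 T[) (g s)%:E)%E.
Proof.
move=> b0 mg g0 ab.
rewrite (eq_integral (fun s : measurableTypeR R => (\sum_(k < gsize n T) ((b k)%:E * (g s * \1_(`[grid n k T, grid n k.+1 T[%classic) s)%:E))%E)); last first.
  move=> s; rewrite inE/= in_itv/= => sT; rewrite EFinM ab// (@stepE _ T)// muleC ge0_sume_distrr; last first.
    by move=> k _; rewrite lee_fin mulr_ge0.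
  by apply: eq_bigr => k _; rewrite -!EFinM; congr EFin; rewrite mulrCA.
have [T0|T0] := leP 0 T; last first.
  rewrite [X in integral _ X]set_itv_ge ?integral_set0; last by rewrite bnd_simp -leNgt ltW.
  rewrite big1// => k _; rewrite set_itv_ge ?integral_set0 ?mule0//.
  by rewrite bnd_simp -leNgt /grid !min_r// (le_trans (ltW T0))// divr_ge0// ltW// pow2_gt0.
have g1 k s : `[0, T[%classic s -> 0 <= g s * \1_(`[grid n k T, grid n k.+1 T[%classic) s :> R.
  by rewrite /= in_itv/= => ?; rewrite mulr_ge0// g0.
have mg1 k : measurable_fun `[0, T[ (fun s => (g s * \1_(`[grid n k T, grid n k.+1 T[%classic) s)%:E).
  by apply/measurable_EFinP; exact: measurable_funM.
rewrite ge0_integral_sum//.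
- apply: eq_bigr => k _.
  rewrite ge0_integralZl//; last 3 first.
    exact: mg1.
    by move=> s s0; rewrite lee_fin g1.
    by rewrite lee_fin.
  congr (_ * _)%E; rewrite [RHS]integral_mkcond [LHS]integral_mkcond.
  apply: eq_integral => s _; rewrite !patchE indicE.
  have sub : grid n k T <= s < grid n k.+1 T -> 0 <= s < T.
    by move=> /andP[h1 h2]; rewrite (le_trans _ h1) ?grid_ge0// (lt_le_trans h2)// grid_le.
  case: ifPn => [_|].
    by case: ifPn; rewrite ?mulr1 ?mulr0.
  rewrite notin_setE/= in_itv/= => sT; case: ifPn => //; rewrite inE/= in_itv/= => h.
  by case: sT; exact: sub.
- by move=> k; apply: emeasurable_funM; [exact: measurable_cst|exact: mg1].
- by move=> k s s0; rewrite mule_ge0 ?lee_fin ?g1.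
Qed.

Lemma integral_step n T (a : nat -> R) : (forall k, 0 <= a k) ->
  (\int[mu]_(s in `[0%R, T[) (a (gidx n s))%:E =
   \sum_(k < gsize n T) (a k)%:E * mu `[grid n k T, grid n k.+1 T[%classic)%E.
Proof.
move=> a0; have := @ge0_integral_step n T (a \o gidx n) (cst 1) a a0.
move=> /(_ _ (fun _ _ => ler01) (fun _ _ => erefl)) => H.
under eq_integral do rewrite -[a _]mulr1.
rewrite [LHS]H//; apply: eq_bigr => k _.
by rewrite [X in (_ * X)%E](@integral_cst _ _ _ mu _ _ 1%E)// mul1e.
Qed.

(** A weighted sum over cells is the integral of a step function, so dominated convergence applies.
    Only the value on the cell containing [s] has to converge, which covers left, right and mixed
    endpoint evaluations at once. *)
Lemma cvg_integral_step T (G : R -> R) (a : nat -> nat -> R) (C : R) :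
  (mu `[0%R, T[%classic < +oo)%E ->
  (forall n k, 0 <= a n k <= C) ->
  (forall s, 0 <= s < T -> a n (gidx n s) @[n --> \oo] --> G s) ->
  (\sum_(k < gsize n T) (a n k)%:E * mu `[grid n k T, grid n k.+1 T[%classic)%E @[n --> \oo]
   --> (\int[mu]_(s in `[0%R, T[) (G s)%:E)%E.
Proof.
move=> muT aC aG.
rewrite (_ : (fun n => _) = (fun n => \int[mu]_(s in `[0%R, T[) (a n (gidx n s))%:E)%E); last first.
  by apply/funext => n; rewrite integral_step// => k; case/andP: (aC n k).
apply: (@dominated_cvg _ _ _ _ _ _ _ _ (cst C%:E)) => //.
- by move=> n; apply/measurable_EFinP; apply: measurable_step.
- by move=> s /=; rewrite in_itv/= => sT; apply: cvg_EFin; [exact: nearW|exact: aG].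
- by apply/integrableP; split => //; rewrite integral_cst//= lte_mul_pinfty.
- by move=> n s _ /=; rewrite lee_fin ger0_norm; case/andP: (aC n (gidx n s)).
Qed.

Lemma measurable_step_lim T (G : R -> R) (a : nat -> nat -> R) :
  (forall s, 0 <= s < T -> a n (gidx n s) @[n --> \oo] --> G s) ->
  measurable_fun `[0, T[ G.
Proof.
move=> aG; apply: (@measurable_fun_cvg _ _ _ _ (fun n s => a n (gidx n s))) => //.
- by move=> n; apply: measurable_step.
Qed.

End integral_step.
End grid.

(** * Left-continuous increasing paths and their Stieltjes integrals *)

Section stieltjes_path.
Context {R : realType}.
Implicit Types (f G F : R -> R) (s t T : R).

Lemma fine_cvg_EFin (u : nat -> R) l : (u n)%:E @[n --> \oo] --> l%:E ->
  u n @[n --> \oo] --> l.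
Proof. by move=> /fine_cvgP[]. Qed.

Record increasing_path f : Prop := IncreasingPath {
  ip0 : f 0 = 0;
  ip_nd : nondecreasing_path f;
  ip_lc : left_continuous_path f }.

Definition sint G f T : R := \int[stieltjes f]_(s in `[0, T[) G s.

(** The integrand is taken at right ends because the increment of [f] over a cell is known only
    there; this is what makes the martingale property applicable in [integral_rsum_pot]. *)
Definition rsum n G f T : R :=
  \sum_(k < gsize n T) G (grid n k.+1 T) * (f (grid n k.+1 T) - f (grid n k T)).

Lemma ip_le f s t : increasing_path f -> 0 <= s -> s <= t -> f s <= f t.
Proof.
move=> [_ nd _] s0 st; apply: nd => //; rewrite in_itv/= andbT//.
exact: le_trans st.
Qed.

Lemma ip_ge0 f t : increasing_path f -> 0 <= t -> 0 <= f t.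
Proof. by move=> If t0; rewrite -[leLHS](ip0 If) ip_le. Qed.

Lemma stieltjes_grid f n k T : increasing_path f -> 0 <= T ->
  stieltjes f `[grid n k T, grid n k.+1 T[%classic =
  (f (grid n k.+1 T) - f (grid n k T))%:E.
Proof.
move=> [_ nd lc] T0; apply: stieltjes_itvco => //; first exact: grid_ge0.
exact: le_grid.
Qed.

Lemma stieltjes_0t f T : increasing_path f -> 0 <= T ->
  stieltjes f `[0, T[%classic = (f T)%:E.
Proof. by move=> [f0 nd lc] T0; rewrite stieltjes_itvco// f0 subr0. Qed.

Lemma continuous_bounded_on G T : continuous G -> exists2 C, 0 <= C &
  forall s, 0 <= s <= T -> `|G s| <= C.
Proof.
move=> cG; have [T0|T0] := leP 0 T; last first.
  by exists 0 => // s /andP[s0 /(le_trans s0)]; rewrite leNgt T0.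
have : {within `[0, T], continuous (fun s => `|G s|)}.
  by apply: continuous_subspaceT => s; apply: continuous_comp; [exact: cG|exact: norm_continuous].
move=> /(EVT_max T0)[c cT mc]; exists `|G c| => // s sT; apply: mc; rewrite in_itv.
Qed.

Lemma cvg_comp_seq G (u : nat -> R) l : continuous G -> u n @[n --> \oo] --> l ->
  G (u n) @[n --> \oo] --> G l.
Proof. by move=> cG ul; apply: continuous_cvg => //; exact: cG. Qed.

Lemma measurable_continuous G D : continuous G -> measurable_fun D G.
Proof.
move=> cG; apply: measurable_funTS; exact: continuous_measurable_fun.
Qed.

Lemma sintE G f T : increasing_path f -> 0 <= T -> continuous G ->
  (forall s, 0 <= G s) ->
  ((sint G f T)%:E = \int[stieltjes f]_(s in `[0%R, T[) (G s)%:E)%E.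
Proof.
move=> If T0 cG G0; rewrite /sint /Rintegral fineK//.
rewrite ge0_fin_numE; last by apply: integral_ge0 => s _; rewrite lee_fin.
have [C C0 HC] := continuous_bounded_on T cG.
apply: (@le_lt_trans _ _ (\int[stieltjes f]_(s in `[0%R, T[) (C%:E))%E).
  apply: ge0_le_integral => //.
  - by move=> s _; rewrite lee_fin.
  - by apply/measurable_EFinP; exact: measurable_continuous.
  - move=> s; rewrite /= in_itv/= => /andP[s0 sT]; rewrite lee_fin.
    by rewrite (le_trans (ler_norm _))// HC// s0 ltW.
by rewrite integral_cst//= stieltjes_0t// -EFinM ltry.
Qed.

Lemma cvg_rsum_gen G f T (a : nat -> nat -> R) C : increasing_path f -> 0 <= T ->
  continuous G -> (forall s, 0 <= G s) -> (forall n k, 0 <= a n k <= C) ->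
  (forall s, 0 <= s < T -> a n (gidx n s) @[n --> \oo] --> G s) ->
  (\sum_(k < gsize n T) a n k * (f (grid n k.+1 T) - f (grid n k T))) @[n --> \oo]
    --> sint G f T.
Proof.
move=> If T0 cG G0 aC aG; apply: fine_cvg_EFin.
have := @cvg_integral_step _ (stieltjes f) T G a C.
have muT : (stieltjes f `[0%R, T[%classic < +oo)%E by rewrite stieltjes_0t// ltry.
rewrite sintE// => /(_ muT aC aG).
rewrite (_ : (fun n => (\sum_(k < gsize n T) _ * _)%:E) =
  (fun n => \sum_(k < gsize n T) (a n k)%:E * stieltjes f `[grid n k T, grid n k.+1 T[%classic)%E)//.
apply/funext => n; rewrite -sumEFin; apply: eq_bigr => k _.
by rewrite stieltjes_grid // EFinM.
Qed.

Lemma cvg_rsum G f T : increasing_path f -> 0 <= T -> continuous G ->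
  (forall s, 0 <= G s) -> rsum n G f T @[n --> \oo] --> sint G f T.
Proof.
move=> If T0 cG G0.
have [C C0 HC] := continuous_bounded_on T cG.
apply: (@cvg_rsum_gen _ _ _ (fun n k => G (grid n k.+1 T)) C) => //.
  move=> n k; rewrite G0 (le_trans (ler_norm _))// HC//.
  by rewrite grid_ge0// grid_le.
by move=> s sT; apply: cvg_comp_seq => //; exact: cvg_grid_right.
Qed.

Lemma sintB G f s t : increasing_path f -> 0 <= s -> s <= t -> continuous G ->
  (forall s, 0 <= G s) ->
  ((sint G f t - sint G f s)%:E = \int[stieltjes f]_(u in `[s, t[) (G u)%:E)%E.
Proof.
move=> If s0 st cG G0; have t0 := le_trans s0 st.
have : (sint G f t)%:E = ((sint G f s)%:E + \int[stieltjes f]_(u in `[s, t[) (G u)%:E)%E.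
  rewrite !sintE// -ge0_integral_setU//=.
  - by rewrite -itv_bndbnd_setU// ?bnd_simp.
  - by apply/measurable_EFinP; exact: measurable_continuous.
  - by move=> u _; rewrite lee_fin.
  - apply/disj_setPS => u /= []; rewrite !in_itv/= => /andP[_ us] /andP[su _].
    by move: us; rewrite ltNge su.
by case: integral => [r| |]//; rewrite -EFinD => -[->]; congr EFin; rewrite addrAC subrr add0r.
Qed.

Lemma sintB_bound G f s t C : increasing_path f -> 0 <= s -> s <= t -> continuous G ->
  (forall s, 0 <= G s) -> (forall u, s <= u < t -> G u <= C) ->
  0 <= sint G f t - sint G f s <= C * (f t - f s).
Proof.
move=> If s0 st cG G0 GC; rewrite -!lee_fin sintB//.
apply/andP; split; first by apply: integral_ge0 => u _; rewrite lee_fin.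
rewrite EFinM -(@stieltjes_itvco _ f (ip_nd If) (ip_lc If) s t)//.
rewrite -integral_cst//; apply: ge0_le_integral => //.
- by move=> u _; rewrite lee_fin.
- by apply/measurable_EFinP; exact: measurable_continuous.
Qed.

Lemma sint0 G f : sint G f 0 = 0.
Proof. by rewrite /sint set_itv_ge ?Rintegral_set0// bnd_simp ltxx. Qed.

Lemma increasing_path_sint G f : increasing_path f -> continuous G ->
  (forall s, 0 <= G s) -> increasing_path (sint G f).
Proof.
move=> If cG G0.
have nd s t : 0 <= s -> s <= t -> sint G f s <= sint G f t.
  move=> s0 st; have [C C0 HC] := continuous_bounded_on t cG.
  have := @sintB_bound G f s t C If s0 st cG G0.
  case/(_ _)/andP; last by rewrite subr_ge0.
  move=> u /andP[su ut]; rewrite (le_trans (ler_norm _))// HC// (le_trans s0 su)/=.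
  exact: ltW.
split; first exact: sint0.
  by move=> s t; rewrite !in_itv/= !andbT => s0 t0; exact: nd.
move=> t t0.
have [C C0 HC] := continuous_bounded_on t cG.
apply: (@squeeze_cvgr _ _ _ _ (fun s => sint G f t - C * (f t - f s)) (fun=> sint G f t)).
- near=> s.
  have s0 : 0 <= s by near: s; apply: nbhs_left_ge.
  have st : s <= t by near: s; apply: nbhs_left_le.
  have := @sintB_bound G f s t C If s0 st cG G0.
  case/(_ _)/andP; last by rewrite subr_ge0; lra.
  move=> u /andP[su ut]; rewrite (le_trans (ler_norm _))// HC// (le_trans s0 su)/=.
  exact: ltW.
- rewrite -[X in _ --> X]subr0 -(mulr0 C) -(subrr (f t)).
  apply: cvgB; first exact: cvg_cst.
  apply: cvgMr; apply: cvgB; first exact: cvg_cst.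
  exact: (ip_lc If).
- exact: cvg_cst.
Unshelve. all: by end_near. Qed.

(** The measure of the path [sint G f] has density [G] with respect to [df]. On a grid its
    increments are integrals of [G], so the sum for [F] is the integral of a step approximation of
    [F] times [G], and dominated convergence concludes. *)
Lemma sint_chain G F f T : increasing_path f -> 0 <= T ->
  continuous G -> continuous F -> (forall s, 0 <= G s) -> (forall s, 0 <= F s) ->
  sint F (sint G f) T = sint (fun s => F s * G s) f T.
Proof.
move=> If T0 cG cF G0 F0.
have cFG : continuous (fun s => F s * G s) by move=> s; apply: cvgM; [exact: cF|exact: cG].
have FG0 s : 0 <= F s * G s by rewrite mulr_ge0.
apply: (cvg_unique _ (cvg_rsum (increasing_path_sint If cG G0) T0 cF F0)) => //=.
suff: rsum n F (sint G f) T @[n --> \oo] --> sint (fun s => F s * G s) f T by [].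
apply: fine_cvg_EFin; rewrite sintE//.
pose H n s := (F (grid n (gidx n s).+1 T)).
have -> : (fun n => (rsum n F (sint G f) T)%:E) =
    (fun n => \int[stieltjes f]_(s in `[0%R, T[) (H n s * G s)%:E)%E.
  apply/funext => n; rewrite (@ge0_integral_step _ _ n T _ _ (fun k => F (grid n k.+1 T)))//.
    rewrite /rsum -sumEFin; apply: eq_bigr => k _.
    by rewrite EFinM sintB// ?grid_ge0// le_grid.
  exact: measurable_continuous.
have [C C0 HC] := continuous_bounded_on T cF.
have [C' C0' HC'] := continuous_bounded_on T cG.
apply: (@dominated_cvg _ _ _ _ _ _ _ _ (cst (C * C')%:E)) => //.
- move=> n; apply/measurable_EFinP; apply: measurable_funM; last exact: measurable_continuous.
  exact: (@measurable_step _ n T (fun k => F (grid n k.+1 T))).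
- move=> s; rewrite /= in_itv/= => sT; apply: cvg_EFin; first exact: nearW.
  apply: cvgMl; apply: cvg_comp_seq => //; exact: cvg_grid_right.
- apply/integrableP; split => //; rewrite integral_cst//= stieltjes_0t//.
  by rewrite -EFinM ltry.
- move=> n s; rewrite /= in_itv/= => /andP[s0 sT].
  rewrite lee_fin normrM ler_pM// ?HC ?HC'// ?s0 ?(ltW sT)//.
  by rewrite grid_ge0// grid_le.
Qed.

Lemma sint1 f T : increasing_path f -> 0 <= T -> sint (cst 1) f T = f T.
Proof.
move=> If T0; apply: EFin_inj; rewrite sintE//; last by move=> ?; exact: cvg_cst.
by rewrite [LHS](@integral_cst _ _ _ (stieltjes f) _ _ 1%E)//= mul1e; exact: stieltjes_0t.
Qed.

Lemma eq_sint G F f T : (forall s, 0 <= s < T -> G s = F s) -> sint G f T = sint F f T.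
Proof. by move=> GF; apply: eq_Rintegral => s; rewrite inE/= in_itv/= => /GF. Qed.

Lemma increasing_pathD f g : increasing_path f -> increasing_path g ->
  increasing_path (fun t => f t + g t).
Proof.
move=> [f0 fn fl] [g0 gn gl]; split; first by rewrite f0 g0 addr0.
  by move=> s t s0 t0 st; rewrite lerD ?fn ?gn.
by move=> t t0; apply: cvgD; [exact: fl|exact: gl].
Qed.

Lemma increasing_pathZ f (a : R) : 0 <= a -> increasing_path f ->
  increasing_path (fun t => a * f t).
Proof.
move=> a0 [f0 fn fl]; split; first by rewrite f0 mulr0.
  by move=> s t s0 t0 st; rewrite ler_wpM2l ?fn.
by move=> t t0; apply: cvgMr; exact: fl.
Qed.

Lemma rsumD n G f g T : rsum n G (fun t => f t + g t) T = rsum n G f T + rsum n G g T.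
Proof. by rewrite /rsum -big_split/=; apply: eq_bigr => k _; ring. Qed.

Lemma eq_rsum n G f g T : 0 <= T -> (forall s, 0 <= s <= T -> f s = g s) ->
  rsum n G f T = rsum n G g T.
Proof.
move=> T0 fg; apply: eq_bigr => k _; rewrite !fg// grid_ge0// grid_le//.
Qed.

Lemma sintD G f g T : increasing_path f -> increasing_path g -> 0 <= T ->
  continuous G -> (forall s, 0 <= G s) ->
  sint G (fun t => f t + g t) T = sint G f T + sint G g T.
Proof.
move=> If Ig T0 cG G0.
apply: (cvg_unique _ (cvg_rsum (increasing_pathD If Ig) T0 cG G0)) => //=.
suff: rsum n G (fun t => f t + g t) T @[n --> \oo] --> sint G f T + sint G g T by [].
under eq_cvg do rewrite rsumD.
by apply: cvgD; exact: cvg_rsum.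
Qed.

Lemma increasing_path_min f c : 0 <= c -> increasing_path f ->
  increasing_path (fun t => Num.min (f t) c).
Proof.
move=> c0 [f0 fn fl]; split; first by rewrite f0 min_l.
  by move=> s t s0 t0 st; rewrite le_min2// fn.
move=> t t0; rewrite minr_absE; under eq_cvg do rewrite minr_absE.
apply: cvgMl; apply: cvgB; first by apply: cvgD; [exact: fl|exact: cvg_cst].
by apply: cvg_norm; apply: cvgB; [exact: fl|exact: cvg_cst].
Qed.

(** Capping a path at a level can only shrink its increments. *)
Lemma rsum_min n G f c T : increasing_path f -> 0 <= T -> (forall s, 0 <= G s) ->
  rsum n G (fun t => Num.min (f t) c) T <= rsum n G f T.
Proof.
move=> If T0 G0; apply: ler_sum => k _; apply: ler_wpM2l => //.
have := ip_le If (grid_ge0 n k T0) (le_grid n T (leqnSn k)).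
move: (f _) (f _) => a b; case: (leP a c); case: (leP b c); lra.
Qed.

Lemma sint_cvg_pinfty G f : increasing_path f -> continuous G -> (forall s, 0 <= G s) ->
  (sint G f m%:R)%:E @[m --> \oo] --> (\int[stieltjes f]_(s in `[0%R, +oo[) (G s)%:E)%E.
Proof.
move=> If cG G0.
have mG D : measurable_fun D G by exact: measurable_continuous.
have := @ge0_nondecreasing_set_cvg_integral _ _ _ (fun m => `[0:R, m%:R[%classic : set (measurableTypeR R)) (EFin \o G) (stieltjes f).
have -> : \bigcup_i `[0:R, i%:R[%classic = `[0, +oo[%classic.
  apply/seteqP; split => s /=.
    by move=> [m _]; rewrite /= !in_itv/= => /andP[->].
  rewrite in_itv/= andbT => s0; exists (Num.truncn s).+1 => //=.
  by rewrite in_itv/= s0 truncnS_gt.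
move=> H; under eq_cvg do rewrite sintE//; apply: H.
- by move=> a b ab; apply/subsetPset => s /=; rewrite !in_itv/= => /andP[-> /=] /lt_le_trans; apply; rewrite ler_nat.
- by move=> m; exact: measurable_itv.
- by move=> m; apply/measurable_EFinP; exact: mG.
- by move=> m s _; rewrite lee_fin.
Qed.

End stieltjes_path.

(** * The common part of two increasing paths *)

Section common_part.
Context {R : realType}.
Implicit Types (f g : R -> R) (s t T : R).

Lemma cvg_left_seq f (q : nat -> R) s : left_continuous_path f ->
  (forall n, 0 <= q n <= s) -> q n @[n --> \oo] --> s -> f (q n) @[n --> \oo] --> f s.
Proof.
move=> lf q0s qs.
have [s0|s0] := leP s 0.
  rewrite (_ : (fun n => f (q n)) = cst (f s)); first exact: cvg_cst.
  apply/funext => n /=; congr f; apply/eqP; rewrite eq_le.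
  by case/andP: (q0s n) => h1 ->; rewrite (le_trans s0).
apply/cvgrPdist_le => e e0.
have /cvgrPdist_le/(_ e e0) := lf s s0.
move=> [d /= d0 H].
near=> n.
have [->|qn] := eqVneq (q n) s; first by rewrite subrr normr0 ltW.
apply: H; last by rewrite lt_neqAle qn; case/andP: (q0s n).
by rewrite /=; near: n; move/cvgrPdist_lt : qs; apply.
Unshelve. all: by end_near. Qed.

Definition incr f n k T := f (grid n k.+1 T) - f (grid n k T).

(** A level [n] approximation, from above, of the mass that the minimum of the measures [df] and
    [dg] gives to [[0, T[]. *)
Definition csum n f g T : R := \sum_(k < gsize n T) Num.min (incr f n k T) (incr g n k T).

Lemma gsizeS n T : gsize n.+1 T = (2 * gsize n T)%N.
Proof. by rewrite /gsize expnS mulnCA. Qed.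

Lemma gridS n k T : grid n.+1 (2 * k) T = grid n k T.
Proof.
rewrite /grid; congr Num.min; rewrite natrM exprS invfM mulrACA divff ?mul1r//.
Qed.

Lemma sum_pairs (a : nat -> R) m :
  \sum_(k < 2 * m) a k = \sum_(k < m) (a (2 * k)%N + a (2 * k).+1).
Proof.
elim: m => [|m IH]; first by rewrite muln0 !big_ord0.
by rewrite [RHS]big_ord_recr/= -IH mulnS !big_ord_recr/= addrA.
Qed.

Lemma incr_ge0 f n k T : increasing_path f -> 0 <= T -> 0 <= incr f n k T.
Proof. by move=> If T0; rewrite subr_ge0 ip_le ?grid_ge0// le_grid. Qed.

Lemma incrS f n k T :
  incr f n k T = incr f n.+1 (2 * k) T + incr f n.+1 (2 * k).+1 T.
Proof.
rewrite /incr gridS (_ : (2 * k).+2 = (2 * k.+1)%N); last by rewrite mulnS.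
by rewrite gridS; ring.
Qed.

Lemma csum_ge0 n f g T : increasing_path f -> increasing_path g -> 0 <= T -> 0 <= csum n f g T.
Proof.
by move=> If Ig T0; apply: sumr_ge0 => k _; rewrite le_min !incr_ge0.
Qed.

(** Each cell splits in two at the next level, and the minimum of two sums dominates the sum of the
    two minima. *)
Lemma csum_noninc f g T : nonincreasing_seq (fun n => csum n f g T).
Proof.
apply/nonincreasing_seqP => n; rewrite /csum gsizeS.
rewrite (sum_pairs (fun k => Num.min (incr f n.+1 k T) (incr g n.+1 k T))).
apply: ler_sum => k _; rewrite (incrS f n k) (incrS g n k).
by rewrite le_min !lerD ?ge_min ?lexx ?orbT.
Qed.

Lemma grid_out n k T : 0 <= T -> (gsize n T <= k)%N -> grid n k T = T.
Proof.
move=> T0 h; apply/eqP; rewrite eq_le grid_le/= -[leLHS](grid_size n T0).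
exact: le_grid.
Qed.

(** Padding with empty cells lets sums over two different horizons run over the same index set,
    where they can be compared term by term. *)
Lemma sum_gsize (a : R -> R -> R) n N T : 0 <= T -> (forall x, a x x = 0) ->
  (gsize n T <= N)%N ->
  \sum_(k < gsize n T) a (grid n k T) (grid n k.+1 T) =
  \sum_(k < N) a (grid n k T) (grid n k.+1 T).
Proof.
move=> T0 aE; elim: N => [|N IH]; first by rewrite leqn0 => /eqP ->; rewrite !big_ord0.
rewrite leq_eqVlt => /predU1P[->//|NT].
by rewrite big_ord_recr/= -IH// !grid_out ?aE ?addr0//; exact: (leq_trans (ltnSE NT)).
Qed.

Lemma csumE f g n N T : 0 <= T -> (gsize n T <= N)%N ->
  csum n f g T = \sum_(k < N) Num.min (incr f n k T) (incr g n k T).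
Proof.
move=> T0; apply: (@sum_gsize (fun x y => Num.min (f y - f x) (g y - g x))) => // x.
by rewrite !subrr minxx.
Qed.

Lemma sum_incr f n N T : 0 <= T -> (gsize n T <= N)%N ->
  \sum_(k < N) incr f n k T = f T - f 0.
Proof.
move=> T0 TN; rewrite -(big_mkord xpredT (fun k => incr f n k T)).
by rewrite telescope_sumr// grid0// grid_out.
Qed.

Lemma le_gsize n s t : s <= t -> (gsize n s <= gsize n t)%N.
Proof. by move=> st; rewrite /gsize leq_mul// ltnS le_truncn. Qed.

Lemma grid_cases n k s t : s <= t ->
  (grid n k s = s /\ grid n k.+1 s = s) \/
  (grid n k s = grid n k t /\ grid n k.+1 s <= grid n k.+1 t).
Proof.
move=> st; rewrite /grid.
have kk : k%:R / 2 ^+ n <= k.+1%:R / 2 ^+ n :> R.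
  by rewrite ler_pM2r ?invr_gt0 ?pow2_gt0// ler_nat.
have [sk|ks] := leP s (k%:R / 2 ^+ n); [left|right].
  by rewrite !min_r// (le_trans sk).
by rewrite (min_l (ltW (lt_le_trans ks st))) le_min2.
Qed.

Lemma csum_nd n f g s t : increasing_path f -> increasing_path g ->
  0 <= s -> s <= t -> csum n f g s <= csum n f g t.
Proof.
move=> If Ig s0 st; have t0 := le_trans s0 st.
rewrite (csumE f g s0 (le_gsize n st)); apply: ler_sum => k _.
case: (grid_cases n k st) => [[h1 h2]|[h1 h2]]; rewrite /incr.
  by rewrite h1 h2 !subrr minxx le_min !incr_ge0.
by rewrite h1 le_min2// lerB// ip_le// grid_ge0.
Qed.

(** The bound is uniform in [n]; it passes to the limit and yields the left continuity of [common].
    Both paths appear on the right because of the cell that contains [s] in its interior. *)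
Lemma csum_lip n f g s t : increasing_path f -> increasing_path g ->
  0 <= s -> s <= t -> csum n f g t - csum n f g s <= (f t - f s) + (g t - g s).
Proof.
move=> If Ig s0 st; have t0 := le_trans s0 st.
rewrite (csumE f g s0 (le_gsize n st)).
have tel u : increasing_path u ->
    u t - u s = \sum_(k < gsize n t) (incr u n k t - incr u n k s).
  move=> Iu; rewrite sumrB !sum_incr ?le_gsize//; lra.
rewrite !tel// -big_split/= -sumrB; apply: ler_sum => k _.
have := incr_ge0 n k If t0; have := incr_ge0 n k Ig t0.
case: (grid_cases n k st) => [[h1 h2]|[h1 h2]]; rewrite /incr.
  rewrite h1 h2 !subrr minxx; move: (f _ - _) (g _ - _) => a b.
  by case: (leP a b); lra.
rewrite h1.
have := ip_le If (grid_ge0 n k.+1 s0) h2.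
have := ip_le Ig (grid_ge0 n k.+1 s0) h2.
move: (f (grid n k.+1 s)) (f (grid n k.+1 t)) (f (grid n k t)) => a b c.
move: (g (grid n k.+1 s)) (g (grid n k.+1 t)) (g (grid n k t)) => a' b' c'.
by case: (leP (b - c) (b' - c')); case: (leP (a - c) (a' - c')); lra.
Qed.

Lemma csumC n f g T : csum n f g T = csum n g f T.
Proof. by apply: eq_bigr => k _; rewrite minC. Qed.

(** When [s] is a node of the grid no cell straddles it: cells before [s] cancel, and later ones
    contribute a minimum bounded by the increment of [f] alone. This sharper bound is what makes
    [f - common f g] nondecreasing. *)
Lemma csum_dyadic m j n f g t : increasing_path f -> increasing_path g ->
  (m <= n)%N -> j%:R / 2 ^+ m <= t ->
  csum n f g t - csum n f g (j%:R / 2 ^+ m) <= f t - f (j%:R / 2 ^+ m).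
Proof.
set s := _ / _ => If Ig mn st.
have s0 : 0 <= s by rewrite divr_ge0// ltW// pow2_gt0.
have t0 := le_trans s0 st.
rewrite (csumE f g s0 (le_gsize n st)).
have -> : f t - f s = \sum_(k < gsize n t) (incr f n k t - incr f n k s).
  rewrite sumrB !sum_incr ?le_gsize//; lra.
rewrite -sumrB; apply: ler_sum => k _.
have := incr_ge0 n k If t0; have := incr_ge0 n k Ig t0.
have sE : s = (j * 2 ^ (n - m))%:R / 2 ^+ n.
  rewrite /s natrM natrX -{2}(subnK mn) exprD invfM mulrA -[j%:R * _ / _]mulrA.
  by rewrite divff ?mulr1// gt_eqF// pow2_gt0.
have [jk|kj] := leqP (j * 2 ^ (n - m)) k.
  have sk : s <= k%:R / 2 ^+ n by rewrite sE ler_pM2r ?invr_gt0 ?pow2_gt0// ler_nat.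
  have sk1 : s <= k.+1%:R / 2 ^+ n.
    by rewrite sE ler_pM2r ?invr_gt0 ?pow2_gt0// ler_nat (leq_trans jk).
  have h1 : grid n k s = s by rewrite /grid min_r.
  have h2 : grid n k.+1 s = s by rewrite /grid min_r.
  rewrite /incr h1 h2 !subrr minxx; move: (f _ - _) (g _ - _) => a b.
  by case: (leP a b); lra.
have ks : k.+1%:R / 2 ^+ n <= s by rewrite sE ler_pM2r ?invr_gt0 ?pow2_gt0// ler_nat.
have ks0 : k%:R / 2 ^+ n <= s.
  by rewrite (le_trans _ ks)// ler_pM2r ?invr_gt0 ?pow2_gt0// ler_nat.
rewrite /incr /grid !(min_l ks) !(min_l ks0) !(min_l (le_trans ks st)) !(min_l (le_trans ks0 st)).
by rewrite !subrr.
Qed.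

(** The path of the minimum of the measures [df] and [dg]: it is dominated by both, and what remains
    of them is mutually singular. *)
Definition common f g t : R := limn (fun n => csum n f g t).

Lemma cvg_common f g t : increasing_path f -> increasing_path g -> 0 <= t ->
  csum n f g t @[n --> \oo] --> common f g t.
Proof.
move=> If Ig t0; apply: nonincreasing_is_cvgn; first exact: csum_noninc.
by exists 0 => _ [n _ <-]; exact: csum_ge0.
Qed.

Lemma commonC f g : common f g = common g f.
Proof. by apply/funext => t; rewrite /common; congr (limn _); apply/funext => n; rewrite csumC. Qed.

Lemma common_dyadic m j f g t : increasing_path f -> increasing_path g ->
  j%:R / 2 ^+ m <= t ->
  common f g t - common f g (j%:R / 2 ^+ m) <= f t - f (j%:R / 2 ^+ m).
Proof.
move=> If Ig st.
have s0 : 0 <= j%:R / 2 ^+ m :> R by rewrite divr_ge0// ltW// pow2_gt0.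
have t0 := le_trans s0 st.
apply: (ler_cvg_to (cvgB (cvg_common If Ig t0) (cvg_common If Ig s0)) (cvg_cst _)).
near=> n; apply: csum_dyadic => //; near: n; exact: nbhs_infty_ge.
Unshelve. all: by end_near. Qed.

Lemma increasing_path_common f g : increasing_path f -> increasing_path g ->
  increasing_path (common f g).
Proof.
move=> If Ig.
have nd s t : 0 <= s -> s <= t -> common f g s <= common f g t.
  move=> s0 st; apply: (ler_cvg_to (cvg_common If Ig s0) (cvg_common If Ig (le_trans s0 st))).
  by apply: nearW => n; exact: csum_nd.
split; last 2 first.
- by move=> s t; rewrite !in_itv/= !andbT => s0 t0; exact: nd.
- move=> t t0; apply: (@squeeze_cvgr _ _ _ _ (fun s => common f g t - ((f t - f s) + (g t - g s))) (fun=> common f g t)).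
  + near=> s.
    have s0 : 0 <= s by near: s; apply: nbhs_left_ge.
    have st : s <= t by near: s; apply: nbhs_left_le.
    rewrite nd// andbT lerBlDr -lerBlDl.
    apply: (ler_cvg_to (cvgB (cvg_common If Ig (ltW t0)) (cvg_common If Ig s0)) (cvg_cst _)).
    by apply: nearW => n; exact: csum_lip.
  + rewrite -[X in _ --> X]subr0 -(addr0 0) -{1}(subrr (f t)) -(subrr (g t)).
    apply: cvgB; first exact: cvg_cst.
    by apply: cvgD; apply: cvgB; [exact: cvg_cst|exact: (ip_lc If)|exact: cvg_cst|exact: (ip_lc Ig)].
  + exact: cvg_cst.
have : csum n f g 0 @[n --> \oo] --> (0 : R).
  rewrite (_ : (fun n => _) = cst 0); first exact: cvg_cst.
  apply/funext => n; rewrite /csum big1// => k _.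
  have h j : grid n j 0 = 0 :> R by rewrite /grid min_r// divr_ge0// ltW// pow2_gt0.
  by rewrite /incr !h !subrr minxx.
move=> H; exact: (cvg_unique _ (cvg_common If Ig (lexx 0)) H).
Unshelve. all: by end_near. Qed.

(** [common_dyadic] gives monotonicity from dyadic starting times; an arbitrary [s] is approached
    from the left by dyadic times, and the difference is left-continuous. *)
Lemma increasing_pathB_common f g : increasing_path f -> increasing_path g ->
  increasing_path (fun t => f t - common f g t).
Proof.
move=> If Ig; have Ic := increasing_path_common If Ig.
have lc : left_continuous_path (fun t => f t - common f g t).
  by move=> t t0; apply: cvgB; [exact: (ip_lc If)|exact: (ip_lc Ic)].
split => //; first by rewrite (ip0 If) (ip0 Ic) subr0.
move=> s t; rewrite !in_itv/= !andbT => s0 t0 st.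
(* The horizon [s + 1] lies beyond [s], so the node just below [s] is not capped and is a genuine
   dyadic number. *)
have s1 : 0 <= (s : R) < s + 1 by rewrite s0/= ltrDl ltr01.
pose q n := grid n (gidx n s) (s + 1).
have q0s n : 0 <= q n <= s.
  by rewrite grid_ge0/= ?addr_ge0//; case/andP: (grid_gidx n s1).
have := cvg_left_seq lc q0s (cvg_grid_left s1).
move=> /ler_cvg_to/(_ (cvg_cst _)); apply; apply: nearW => n.
have qE : q n = (gidx n s)%:R / 2 ^+ n.
  have /andP[_] := q0s n; rewrite /q /grid ge_min => /orP[h|].
    by rewrite min_l// (le_trans h)// lerDl ler01.
  by rewrite gerDl ler10.
have := @common_dyadic n (gidx n s) f g t If Ig.
rewrite -qE => H; have /H : q n <= t by rewrite (le_trans _ st)//; case/andP: (q0s n).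
lra.
Qed.

(** Subtracting the increment of [common f g] from both increments subtracts it from their minimum.
    Summed over the cells this telescopes to [csum n f g t - common f g t]. *)
Lemma csum_common_cvg0 f g t : increasing_path f -> increasing_path g -> 0 <= t ->
  csum n (fun t => f t - common f g t) (fun t => g t - common f g t) t @[n --> \oo] --> (0 : R).
Proof.
move=> If Ig t0; have Ic := increasing_path_common If Ig.
rewrite (_ : (fun n => _) = (fun n => csum n f g t - common f g t)).
  rewrite -(subrr (common f g t)); apply: cvgB; [exact: cvg_common|exact: cvg_cst].
apply/funext => n; rewrite -[X in _ - X]subr0 -[X in _ - (_ - X)](ip0 Ic).
rewrite -(sum_incr _ t0 (leqnn (gsize n t))) -sumrB; apply: eq_bigr => k _.
rewrite (_ : incr _ n k t = incr f n k t - incr (common f g) n k t); last by rewrite /incr; ring.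
rewrite (_ : incr (fun t => g t - _) n k t = incr g n k t - incr (common f g) n k t); last by rewrite /incr; ring.
by rewrite addr_minl.
Qed.

Lemma stieltjes_neg f : nondecreasing_path f -> stieltjes f `]-oo, 0%R[%classic = 0%E.
Proof.
move=> nd.
have -> : `]-oo, 0%R[%classic = \bigcup_i `](- i%:R), (- i.+1%:R^-1)]%classic :> set R.
  apply/seteqP; split => s /=.
    rewrite in_itv/= => s0.
    have [k ks] : exists k, - s > k.+1%:R^-1.
      exists (Num.truncn ((- s)^-1)); rewrite invf_plt ?posrE ?oppr_gt0//.
      exact: truncnS_gt.
    exists (maxn k (Num.truncn (- s)).+1) => //=; rewrite in_itv/=; apply/andP; split.
      rewrite ltrNl (lt_le_trans (truncnS_gt _))// ler_nat leq_maxr//.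
    rewrite lerNr ltW//; apply: le_lt_trans ks.
    by rewrite lef_pV2 ?posrE// ler_nat ltnS leq_maxl.
  move=> [k _]; rewrite /= !in_itv/= => /andP[_ /le_lt_trans]; apply.
  by rewrite oppr_lt0 invr_gt0.
apply/eqP; rewrite eq_le measure_ge0 andbT.
have := @measure_sigma_subadditive _ _ _ (stieltjes f) _
  (fun i : nat => `](- i%:R : R), (- i.+1%:R^-1)]%classic).
move=> /(_ _ _ _ (@subset_refl _ _))/le_trans; apply.
- by move=> k; exact: measurable_itv.
- by apply: bigcup_measurable => k _; exact: measurable_itv.
rewrite eseries0// => k _ _.
have [kk|kk] := leP (- k%:R) (- k.+1%:R^-1 : R); last first.
  by rewrite set_itv_ge ?measure0// bnd_simp -leNgt ltW.
rewrite [LHS](@stieltjes_itvoc _ f _ _ kk) /stieltjes_cdf asboolT//.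
have n0 (x : R) : x < 0 -> (0 <= x) = false by move=> x0; apply/negbTE; rewrite -ltNge.
have k0 : - k.+1%:R^-1 < 0 :> R by rewrite oppr_lt0 invr_gt0.
by rewrite !n0 ?subrr// (le_lt_trans kk).
Qed.

Lemma csum_split n f g T : increasing_path f -> increasing_path g -> 0 <= T ->
  exists A B : set (measurableTypeR R), [/\ measurable A, measurable B, `[0, T[%classic `<=` A `|` B,
    (stieltjes f A <= (csum n f g T)%:E)%E & (stieltjes g B <= (csum n f g T)%:E)%E].
Proof.
move=> If Ig T0.
pose a k : R := if incr f n k T <= incr g n k T then 1 else 0.
pose b k : R := if incr g n k T < incr f n k T then 1 else 0.
pose A := `[0, T[ `&` (fun s : measurableTypeR R => a (gidx n s)) @^-1` [set 1].
pose B := `[0, T[ `&` (fun s : measurableTypeR R => b (gidx n s)) @^-1` [set 1].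
have mA : measurable A by apply: (@measurable_step _ n T a) => //; exact: measurable_set1.
have mB : measurable B by apply: (@measurable_step _ n T b) => //; exact: measurable_set1.
have key (u : R -> R) (c : nat -> R) C : increasing_path u -> (forall k, c k = 0 \/ c k = 1) ->
    measurable C -> C = `[0, T[ `&` (fun s : measurableTypeR R => c (gidx n s)) @^-1` [set 1] ->
    stieltjes u C = (\sum_(k < gsize n T) c k * incr u n k T)%:E.
  move=> Iu c01 mC CE.
  have := @integral_step _ (stieltjes u) n T c.
  case/(_ _)/wrap => [|H].
    by move=> k; case: (c01 k) => ->.
  rewrite -sumEFin (eq_bigr (fun k : 'I_(gsize n T) => (c k)%:E * stieltjes u `[grid n k T, grid n k.+1 T[%classic)%E).
    rewrite -H -[C]setIT -integral_indic//= [LHS]integral_mkcond [RHS]integral_mkcond.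
    apply: eq_integral => s _; rewrite !patchE in_setT indicE CE in_setI.
    case: (s \in _) => //=.
    by case: (c01 (gidx n s)) => E; [rewrite memNset|rewrite mem_set]; rewrite /= ?E//; lra.
  by move=> k _; rewrite stieltjes_grid// EFinM.
exists A, B; split => //.
- move=> s sT; have [h|h] := leP (incr f n (gidx n s) T) (incr g n (gidx n s) T); [left|right].
    by split => //=; rewrite /a h.
  by split => //=; rewrite /b h.
- rewrite (key f a)//; last by move=> k; rewrite /a; case: ifP; [right|left].
  rewrite lee_fin; apply: ler_sum => k _; rewrite /a le_min.
  have f0 := incr_ge0 n k If T0; have g0 := incr_ge0 n k Ig T0.
  by case: ifP => h; rewrite ?mul1r ?mul0r ?lexx ?h ?f0 ?g0.
- rewrite (key g b)//; last by move=> k; rewrite /b; case: ifP; [right|left].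
  rewrite lee_fin; apply: ler_sum => k _; rewrite /b le_min.
  have f0 := incr_ge0 n k If T0; have g0 := incr_ge0 n k Ig T0.
  by case: ifP => h; rewrite ?mul1r ?mul0r ?lexx ?(ltW h) ?f0 ?g0.
Qed.

(* [df] has small mass on the cells where the increment of [f] is the smaller one; by Borel-Cantelli,
   along fine enough grids, the limsup of these cells is [df]-null and its complement [dg]-null. *)
Lemma disjoint_supports_csum f g : increasing_path f -> increasing_path g ->
  (forall t, 0 <= t -> csum n f g t @[n --> \oo] --> (0 : R)) ->
  disjoint_supports (stieltjes f) (stieltjes g).
Proof.
move=> If Ig fg0.
have /choice[AB ABP] : forall j : nat, exists AB : set (measurableTypeR R) * set (measurableTypeR R),
   [/\ measurable AB.1, measurable AB.2, `[0, j%:R[%classic `<=` AB.1 `|` AB.2,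
    (stieltjes f AB.1 <= ((2 ^+ j)^-1)%:E)%E & (stieltjes g AB.2 <= ((2 ^+ j)^-1)%:E)%E].
  move=> j.
  have j0 : 0 <= j%:R :> R by [].
  have : \forall n \near \oo, csum n f g j%:R <= (2 ^+ j)^-1.
    by apply: (cvgr_le _ (fg0 _ j0)); rewrite invr_gt0 pow2_gt0.
  move=> [n _ /(_ n (leqnn n)) /= hn].
  have [A [B [mA mB AB fA gB]]] := csum_split n If Ig j0.
  exists (A, B); split => //=; [apply: (le_trans fA)|apply: (le_trans gB)]; by rewrite lee_fin.
pose L := lim_sup_set (fun j => (AB j).1).
pose L' := lim_sup_set (fun j => (AB j).2).
have BC (u : R -> R) (C : nat -> set (measurableTypeR R)) : (forall j, measurable (C j)) ->
    (forall j, (stieltjes u (C j) <= ((2 ^+ j)^-1)%:E)%E) -> stieltjes u (lim_sup_set C) = 0%E.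
  move=> mC uC; apply: lim_sup_set_cvg0 => //.
  have H := @epsilon_trick0 R 2 xpredT (ler0n _ 2).
  apply: (@le_lt_trans _ _ 2%:E); last by rewrite ltry.
  apply: le_trans H; apply: lee_nneseries => // j _.
  by rewrite (le_trans (uC j))// lee_fin natrX exprS invfM mulrA divff ?mul1r.
exists (~` L); split.
- apply: measurableC; apply: bigcap_measurable => // k _.
  by apply: bigcup_measurable => j _; case: (ABP j).
- rewrite setCK; apply: BC; by move=> j; case: (ABP j).
apply/eqP; rewrite eq_le measure_ge0 andbT.
have -> : 0%E = (stieltjes g `]-oo, 0%R[%classic + stieltjes g L')%E.
  rewrite (stieltjes_neg (ip_nd Ig)) add0e BC//; by move=> j; case: (ABP j).
have mL' : measurable L'.
  by apply: bigcap_measurable => // k _; apply: bigcup_measurable => j _; case: (ABP j).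
have mL : measurable L.
  by apply: bigcap_measurable => // k _; apply: bigcup_measurable => j _; case: (ABP j).
apply: (@le_trans _ _ (stieltjes g (`]-oo, 0%R[%classic `|` L'))); last first.
  by apply: (@measureU2 _ _ _ (stieltjes g)) => //; exact: measurable_itv.
apply: le_measure; rewrite ?inE//.
  exact: measurableC.
  by apply: measurableU => //; exact: measurable_itv.
(* A nonnegative [s] outside the limsup of the first sets lies, for all large [j], in [[0, j[] but
   not in the first set, hence in the second; so it lies in the limsup of the second sets. *)
move=> s Ls; have [s0|s0] := leP 0 s; [right|by left; rewrite /= in_itv].
have [m /not_implyP[_ Hm]] := (existsNP _).2 Ls.
move=> k _; exists (maxn (maxn k m) (Num.truncn s).+1).
  by rewrite /= (leq_trans (leq_maxl k m))// leq_maxl.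
set j := maxn _ _.
have : `[0, j%:R[%classic s.
  by rewrite /= in_itv/= s0/= (lt_le_trans (truncnS_gt _))// ler_nat leq_maxr.
case: (ABP j) => _ _ + _ _ => /[apply] -[Aj|//].
exfalso; apply: Hm; exists j => //=.
by rewrite (leq_trans (leq_maxr k m))// leq_maxl.
Qed.
End common_part.

(** * The exponential martingale of Brownian motion *)

Section subsigma.
Context {R : realType} {d : measure_display} {T : measurableType d}.
Implicit Types G : set (set T).

Lemma subsigma_measurable G : G `<=` measurable -> <<s G >> `<=` @measurable d T.
Proof. by move=> Gm; apply: smallest_sub => //; exact: sigma_algebra_measurable. Qed.

Lemma subsigma_measurable_fun d' (U : measurableType d') G (f : T -> U) :
  G `<=` measurable ->
  measurable_fun [set: g_sigma_algebraType G] (f : g_sigma_algebraType G -> U) ->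
  measurable_fun [set: T] f.
Proof.
move=> Gm mf _ B mB; rewrite setTI; apply: (subsigma_measurable Gm).
by have := mf measurableT B mB; rewrite setTI.
Qed.

Lemma subsigmaS_measurable_fun d' (U : measurableType d') G H (f : T -> U) :
  <<s G >> `<=` <<s H >> ->
  measurable_fun [set: g_sigma_algebraType G] (f : g_sigma_algebraType G -> U) ->
  measurable_fun [set: g_sigma_algebraType H] (f : g_sigma_algebraType H -> U).
Proof.
move=> GH mf _ B mB; rewrite setTI; apply: GH.
by have := mf measurableT B mB; rewrite setTI.
Qed.

Import HBNNSimple.

(** This replaces conditional expectations: an inequality tested on the sets of a sub-sigma-algebra
    extends to nonnegative functions measurable for it. With two measures and two weights it serves
    martingales, the squared submartingale, independence and integration against a density. *)
Lemma ge0_integral_weight_le (mu nu : {measure set T -> \bar R}) G (p q : T -> R)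
    (f : T -> \bar R) :
  G `<=` measurable -> measurable_fun setT p -> measurable_fun setT q ->
  (forall x, 0 <= p x) -> (forall x, 0 <= q x) ->
  (forall C, <<s G >> C ->
     (\int[mu]_(x in C) (p x)%:E <= \int[nu]_(x in C) (q x)%:E)%E) ->
  measurable_fun [set: g_sigma_algebraType G] (f : g_sigma_algebraType G -> \bar R) ->
  (forall x, (0 <= f x)%E) ->
  (\int[mu]_x ((p x)%:E * f x) <= \int[nu]_x ((q x)%:E * f x))%E.
Proof.
move=> Gm mp mq p0 q0 pq mf f0.
pose S := g_sigma_algebraType G.
pose f_ := @nnsfun_approx _ S R setT (@measurableT _ S) f mf.
have mfn n : measurable_fun [set: T] (f_ n : T -> R).
  by apply: (subsigma_measurable_fun Gm); exact: measurable_funP.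
have fn0 n x : 0 <= f_ n x by exact: fun_ge0.
have key (m : {measure set T -> \bar R}) (u : T -> R) : measurable_fun setT u -> (forall x, 0 <= u x) ->
    (\int[m]_x ((u x)%:E * (f_ n x)%:E))%E @[n --> \oo] --> (\int[m]_x ((u x)%:E * f x))%E.
  move=> mu0 u0.
  rewrite (_ : (\int[m]_x ((u x)%:E * f x))%E = (\int[m]_x limn (fun n => (u x)%:E * (f_ n x)%:E))%E); last first.
    apply: eq_integral => x _; apply/esym/cvg_lim => //.
    apply: cvgeZl => //; exact: (@cvg_nnsfun_approx _ S R setT measurableT f mf (fun x _ => f0 x) x).
  apply: cvg_monotone_convergence => //.
  - by move=> n; apply: emeasurable_funM; exact/measurable_EFinP.
  - by move=> n x _; rewrite -EFinM lee_fin mulr_ge0.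
  - move=> x _ a b ab; rewrite -!EFinM lee_fin ler_wpM2l//.
    by have /lefP := nd_nnsfun_approx (@measurableT _ S) mf ab; exact.
(* The simple functions approximate [f] as a function on the coarser measurable space, so their
   level sets belong to the sub-sigma-algebra, where the hypothesis applies. *)
have mset n r : <<s G >> (f_ n @^-1` [set r]).
  have mn : measurable_fun [set: S] (f_ n) by exact: measurable_funP.
  by have := mn measurableT [set r] (measurable_set1 r); rewrite setTI.
have sumE (m : {measure set T -> \bar R}) (u : T -> R) n : measurable_fun setT u -> (forall x, 0 <= u x) ->
   (\int[m]_x ((u x)%:E * (f_ n x)%:E) =
    \sum_(i < #|` fset_set (f_ n @` setT)|) ((fset_set (f_ n @` setT))`_i)%:E *
      \int[m]_(x in f_ n @^-1` [set (fset_set (f_ n @` setT))`_i]) (u x)%:E)%E.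
  move=> mu0 u0; set s := fset_set _.
  have s0 i : (i < #|`s|)%N -> 0 <= s`_i.
    move=> si; have : s`_i \in s by rewrite mem_nth.
    by rewrite in_fset_set// inE => -[x _ <-].
  rewrite (eq_integral (fun x => \sum_(i < #|`s|) ((s`_i)%:E * (u x * \1_(f_ n @^-1` [set s`_i]) x)%:E))%E); last first.
    move=> x _; rewrite (fimfunEord (f_ n) x) -EFinM mulr_sumr -sumEFin.
    by apply: eq_bigr => i _; rewrite -EFinM; congr EFin; rewrite mulrCA.
  have mi i : measurable_fun setT (fun x => u x * \1_(f_ n @^-1` [set s`_i]) x).
    apply: measurable_funM => //; apply: measurable_indic.
    exact: (subsigma_measurable Gm).
  have ui0 i x : 0 <= u x * \1_(f_ n @^-1` [set s`_i]) x by rewrite mulr_ge0.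
  rewrite ge0_integral_sum//; last 2 first.
  - by move=> i; apply: emeasurable_funM => //; exact/measurable_EFinP.
  - by move=> i x _; rewrite mule_ge0// lee_fin ?s0.
  apply: eq_bigr => i _; rewrite ge0_integralZl//; last 3 first.
  - exact/measurable_EFinP.
  - by move=> x _; rewrite lee_fin.
  - by rewrite lee_fin s0.
  congr (_ * _)%E; rewrite [RHS]integral_mkcond; apply: eq_integral => x _.
  by rewrite patchE indicE; case: (x \in _); rewrite ?mulr1 ?mulr0.
apply: (lee_cvg_to (key mu p mp p0) (key nu q mq q0)).
apply: nearW => n; rewrite !sumE//; apply: lee_sum => i _.
apply: lee_wpmul2l; last exact: pq.
rewrite lee_fin; set s := fset_set _.
have : s`_i \in s by rewrite mem_nth.
by rewrite in_fset_set// inE => -[x _ <-].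
Qed.

Lemma ge0_integral_weight (mu nu : {measure set T -> \bar R}) G (p q : T -> R)
    (f : T -> \bar R) :
  G `<=` measurable -> measurable_fun setT p -> measurable_fun setT q ->
  (forall x, 0 <= p x) -> (forall x, 0 <= q x) ->
  (forall C, <<s G >> C ->
     (\int[mu]_(x in C) (p x)%:E = \int[nu]_(x in C) (q x)%:E)%E) ->
  measurable_fun [set: g_sigma_algebraType G] (f : g_sigma_algebraType G -> \bar R) ->
  (forall x, (0 <= f x)%E) ->
  (\int[mu]_x ((p x)%:E * f x) = \int[nu]_x ((q x)%:E * f x))%E.
Proof.
move=> Gm mp mq p0 q0 pq mf f0; apply/eqP; rewrite eq_le; apply/andP; split;
  apply: (ge0_integral_weight_le Gm) => // C /pq ->//.
Qed.

End subsigma.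

Section independence.
Context {R : realType} {d : measure_display} {Omega : measurableType d}.
Variable P : probability Omega R.
Implicit Types G H : set (set Omega).

(** Independence says that the indicator of [B] and the constant [P B] have equal integrals over all
    sets of the sub-sigma-algebra, so [ge0_integral_weight] applies. *)
Lemma independent_integral G (H : set (set Omega)) (f : Omega -> \bar R) B :
  G `<=` measurable -> independent P <<s G >> H -> H B -> measurable B ->
  measurable_fun [set: g_sigma_algebraType G] (f : g_sigma_algebraType G -> \bar R) ->
  (forall w, (0 <= f w)%E) ->
  (\int[P]_(w in B) f w = P B * \int[P]_w f w)%E.
Proof.
move=> Gm GH HB mB mf f0.
have mf' := subsigma_measurable_fun Gm mf.
have PB0 : 0 <= fine (P B) by rewrite fine_ge0.
have PBE : P B = (fine (P B))%:E by rewrite fineK// fin_num_measure.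
have := @ge0_integral_weight _ _ _ P P G \1_B (cst (fine (P B))) f Gm.
move=> /(_ _ _ _ _ _ mf f0) H1.
transitivity (\int[P]_w ((\1_B w)%:E * f w))%E.
  rewrite [LHS]integral_mkcond; apply: eq_integral => w _; rewrite patchE indicE.
  by case: (w \in B); rewrite ?mul1e ?mul0e.
rewrite H1//.
- by rewrite [in RHS]PBE -ge0_integralZl//= lee_fin.
- move=> C GC; rewrite integral_indic//; last exact: (subsigma_measurable Gm).
  rewrite setIC [LHS](GH C B GC HB) [RHS](@integral_cst _ _ _ P _ _ (fine (P B))%:E)//; last exact: (subsigma_measurable Gm).
  by rewrite -PBE muleC.
Qed.

End independence.

Section gaussian.
Context {R : realType}.

Lemma normal_mgf (s a : R) : s != 0 ->
  (\int[normal_prob 0 s]_x (expR (a * x))%:E = (expR (a ^+ 2 * s ^+ 2 / 2))%:E)%E.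
Proof.
move=> s0.
have mexp : measurable_fun setT (fun x : R => expR (a * x)).
  by apply: measurableT_comp => //; exact: measurable_funM.
have := @ge0_integral_weight R _ (measurableTypeR R) (normal_prob 0 s) lebesgue_measure
   (@measurable _ (measurableTypeR R)) (cst 1) (normal_pdf 0 s) (fun x => (expR (a * x))%:E).
move=> /(_ (@subset_refl _ _) _ (measurable_normal_pdf _ _)) H.
under eq_integral do rewrite -[(expR _)%:E]mul1e.
rewrite [LHS]H//; first last.
- move=> _ B mB; rewrite setTI; apply: sub_sigma_algebra.
  by have /measurable_EFinP/(_ measurableT B mB) := mexp; rewrite setTI.
- move=> C /(subsigma_measurable (@subset_refl _ _)) mC.
  by rewrite [LHS](@integral_cst _ _ _ (normal_prob 0 s) _ mC 1%E) mul1e.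
- by move=> x; exact: normal_pdf_ge0.
(* Completing the square: [exp (a x)] times the centred density is a constant times the Gaussian
   density of mean [a s^2]. *)
rewrite (eq_integral (fun x : measurableTypeR R => (expR (a ^+ 2 * s ^+ 2 / 2))%:E * (normal_pdf (a * s ^+ 2) s x)%:E)%E); last first.
  move=> x _; rewrite -!EFinM; congr EFin.
  rewrite /normal_pdf/= (negbTE s0) -[LHS]mulrA [RHS]mulrCA; congr (_ * _).
  rewrite /normal_fun -!expRD; congr expR.
  have s2 : s ^+ 2 != 0 by rewrite expf_eq0.
  by rewrite -mulr_natl; field; rewrite ?s0.
rewrite ge0_integralZl//.
- by rewrite integral_normal_pdf mule1.
- by apply/measurable_EFinP; exact: measurable_normal_pdf.
- by move=> x _; rewrite lee_fin normal_pdf_ge0.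
Qed.
End gaussian.

Section exponential_brownian.
Context {R : realType} {d : measure_display} {Omega : measurableType d}.
Variable P : probability Omega R.
Variable W : R -> Omega -> R.
Context {n : nat}.
Variable Y : R -> Omega -> 'I_n.+2.
Hypothesis Pcomplete : measure_is_complete P.
Hypothesis bmW : brownian_motion P W.
Hypothesis mY : forall t : R, 0 <= t -> forall j, measurable (Y t @^-1` [set j]).
Hypothesis indepWY : independent P <<s real_events W `[0, +oo[%classic >>
                           <<s chain_events Y `[0, +oo[%classic >>.

Local Notation sW := (real_events W).
Local Notation sY := (chain_events Y).

Lemma real_events_measurable (S : set R) : (forall t, S t -> 0 <= t) ->
  sW S `<=` measurable.
Proof.
move=> S0 _ [t [B [St mB ->]]]; rewrite -[X in measurable X]setTI.
exact: (bm_measurable bmW (S0 _ St)).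
Qed.

Lemma chain_events_measurable (S : set R) : (forall t, S t -> 0 <= t) ->
  sY S `<=` measurable.
Proof. by move=> S0 _ [t [j [St ->]]]; exact: mY (S0 _ St) _. Qed.

Definition filtration_gen (t : R) : set (set Omega) :=
  sW `[0, t]%classic `|` sY `[0, t]%classic `|` [set A | P.-negligible A].

Lemma itv0t_ge0 (s t : R) : `[0, t]%classic s -> 0 <= s.
Proof. by rewrite /= in_itv/= => /andP[]. Qed.

Lemma itv0y_ge0 (s : R) : `[0, +oo[%classic s -> 0 <= s.
Proof. by rewrite /= in_itv/= andbT. Qed.

Lemma filtration_gen_measurable t : filtration_gen t `<=` measurable.
Proof.
move=> A [[|]|].
- by move: A; apply: real_events_measurable => v; exact: itv0t_ge0.
- by move: A; apply: chain_events_measurable => v; exact: itv0t_ge0.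
- by move=> ?; exact: Pcomplete.
Qed.

Lemma filtration_mono s t : s <= t -> filtration P W Y s `<=` filtration P W Y t.
Proof.
move=> st; apply: sub_sigma_algebra2 => A [[|]|].
- move=> [u [B [us mB ->]]]; left; left; exists u, B; split => //.
  by move: us; rewrite /= !in_itv/= => /andP[-> /le_trans]; apply.
- move=> [u [j [us ->]]]; left; right; exists u, j; split => //.
  by move: us; rewrite /= !in_itv/= => /andP[-> /le_trans]; apply.
- by right.
Qed.

Lemma measurable_expW (a t : R) : 0 <= t ->
  measurable_fun [set: g_sigma_algebraType (sW `[0, t]%classic)]
    ((fun w => expR (a * W t w)) : g_sigma_algebraType (sW `[0, t]%classic) -> R).
Proof.
move=> t0; apply: measurableT_comp => //; apply: measurable_funM => //.
move=> _ B mB; rewrite setTI; apply: sub_sigma_algebra; exists t, B; split => //=.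
by rewrite in_itv/= t0 lexx.
Qed.

Lemma sW_mono (S T : set R) : S `<=` T -> <<s sW S >> `<=` <<s sW T >>.
Proof.
move=> ST; apply: sub_sigma_algebra2 => A [u [B [us mB ->]]].
by exists u, B; split => //; exact: ST.
Qed.

Lemma mgf_increment (a s t : R) : 0 <= s -> s < t ->
  (\int[P]_w (expR (a * (W t w - W s w)))%:E = (expR (a ^+ 2 * (t - s) / 2))%:E)%E.
Proof.
move=> s0 st; have t0 := le_trans s0 (ltW st).
have mI : measurable_fun setT (fun w => W t w - W s w).
  by apply: measurable_funB; exact: (bm_measurable bmW).
have mexp : measurable_fun setT (fun x : R => expR (a * x)).
  by apply: measurableT_comp => //; exact: measurable_funM.
have ts0 : 0 < t - s by rewrite subr_gt0.
pose I : Omega -> measurableTypeR R := fun w => W t w - W s w.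
transitivity (\int[pushforward P I]_x (expR (a * x))%:E)%E.
  by rewrite (@ge0_integral_pushforward _ _ _ _ R I mI P)//; exact/measurable_EFinP.
rewrite (eq_measure_integral (normal_prob 0 (Num.sqrt (t - s))))/=.
  rewrite normal_mgf ?sqr_sqrtr ?(ltW ts0)//.
  by rewrite gt_eqF// sqrtr_gt0.
by move=> A mA _; rewrite -(bm_gaussian bmW s0 st).
Qed.

(** Factor [exp (a W_t)] into [exp (a W_s)] and an exponential of the increment. [bm_independent]
    speaks only of the past of [W]; the chain and the null sets are brought in by
    [integral_expW]. *)
Lemma integral_expW_step (a s t : R) A : 0 <= s -> s < t -> <<s sW `[0, s]%classic >> A ->
  (\int[P]_w (expR (a * W s w))%:E < +oo)%E ->
  (\int[P]_(w in A) (expR (a * W t w))%:E =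
   (expR (a ^+ 2 * (t - s) / 2))%:E * \int[P]_(w in A) (expR (a * W s w))%:E)%E.
Proof.
move=> s0 st mA fin; have t0 := le_trans s0 (ltW st).
have sm : sW `[0, s]%classic `<=` measurable.
  by apply: real_events_measurable => v; exact: itv0t_ge0.
have mA' : measurable A by exact: (subsigma_measurable sm).
pose I w := W t w - W s w.
have mI : measurable_fun setT I.
  by apply: measurable_funB; exact: (bm_measurable bmW).
pose H := [set I @^-1` B | B in @measurable _ (measurableTypeR R)].
have Hm : H `<=` measurable.
  by move=> _ [B mB <-]; rewrite -[X in measurable X]setTI; exact: mI.
pose f w := \1_A w * expR (a * W s w).
have mf : measurable_fun [set: g_sigma_algebraType (sW `[0, s]%classic)]
    (f : g_sigma_algebraType (sW `[0, s]%classic) -> R).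
  apply: measurable_funM; last exact: measurable_expW.
  exact: measurable_indic.
have mf' := subsigma_measurable_fun sm mf.
have f0 w : 0 <= f w by rewrite mulr_ge0// expR_ge0.
have fE (g : Omega -> R) : (\int[P]_(w in A) (g w)%:E = \int[P]_w (\1_A w * g w)%:E)%E.
  rewrite [LHS]integral_mkcond; apply: eq_integral => w _; rewrite patchE indicE.
  by case: (w \in A); rewrite ?mul1r ?mul0r.
have ffin : (\int[P]_w (f w)%:E \is a fin_num)%E.
  rewrite ge0_fin_numE; last by apply: integral_ge0 => w _; rewrite lee_fin.
  apply: le_lt_trans fin; apply: ge0_le_integral => //.
  - by move=> w _; rewrite lee_fin.
  - exact/measurable_EFinP.
  - apply/measurable_EFinP; apply: measurableT_comp => //; apply: measurable_funM => //.
    exact: (bm_measurable bmW).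
  - by move=> w _; rewrite lee_fin /f indicE; case: (w \in A); rewrite ?mul1r ?mul0r ?expR_ge0.
have := @ge0_integral_weight _ _ _ P P H f (cst (fine (\int[P]_w (f w)%:E)%E))
  (fun w => (expR (a * I w))%:E) Hm mf'.
move=> /(_ (measurable_cst _) f0) K.
rewrite !fE -/f.
transitivity (\int[P]_w ((f w)%:E * (expR (a * I w))%:E))%E.
  apply: eq_integral => w _; rewrite -EFinM /f -mulrA -expRD /I; congr (_ * expR _)%:E.
  by ring.
rewrite K//.
- rewrite /= ge0_integralZl//=.
  + by rewrite fineK// mgf_increment// muleC.
  + apply/measurable_EFinP; apply: measurableT_comp => //; exact: measurable_funM.
  + by rewrite lee_fin fine_ge0// integral_ge0// => w _; rewrite lee_fin.
- by move=> w /=; rewrite fine_ge0// integral_ge0// => w' _; rewrite lee_fin.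
- move=> C HC.
  have [B mB CE] : exists2 B, measurable B & C = I @^-1` B.
    move: C HC; apply: smallest_sub; last by move=> _ [B mB <-]; exists B.
    split.
    - by exists set0; rewrite ?preimage_set0.
    - move=> _ [B mB ->]; exists (~` B); first exact: measurableC.
      by rewrite setTD preimage_setC.
    - move=> F FB; have /choice[B HB] : forall i, exists B, measurable B /\ F i = I @^-1` B.
        by move=> i; have [B mB FE] := FB i; exists B.
      exists (\bigcup_i B i); first by apply: bigcup_measurable => i _; case: (HB i).
      by rewrite preimage_bigcup; apply: eq_bigcupr => i _; case: (HB i).
  have mC : measurable C by exact: (subsigma_measurable Hm).
  rewrite (@independent_integral _ _ _ P _ _ _ C sm (bm_independent bmW s0 st))//.
  + rewrite [RHS](@integral_cst _ _ _ P _ mC (fine (\int[P]_w (f w)%:E)%E)%:E)//.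
    by rewrite fineK// muleC.
  + by exists B.
  + exact/measurable_EFinP.
- apply/measurable_EFinP; apply: measurableT_comp => //; apply: measurable_funM => //.
  by move=> _ B mB; rewrite setTI; apply: sub_sigma_algebra; exists B.
Qed.

Lemma integral_expW_fin (a t : R) : 0 <= t -> (\int[P]_w (expR (a * W t w))%:E < +oo)%E.
Proof.
move=> t0.
have mE s : 0 <= s -> measurable_fun setT (fun w => (expR (a * W s w))%:E).
  move=> s0; apply/measurable_EFinP; apply: measurableT_comp => //; apply: measurable_funM => //.
  exact: (bm_measurable bmW).
have [<-|t1] := eqVneq 0 t.
  rewrite (ae_eq_integral (cst 1%E))//.
  - by rewrite integral_cst//= mul1e (le_lt_trans (probability_le1 _ _))// ltry.
  - exact: mE.
  - apply: filterS (bm_start bmW) => w W0 _; by rewrite W0 mulr0 expR0.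
have {}t1 : 0 < t by rewrite lt_neqAle t1.
rewrite (ae_eq_integral (fun w => (expR (a * (W t w - W 0 w)))%:E))//.
- by rewrite mgf_increment// ltry.
- exact: mE.
- apply/measurable_EFinP; apply: measurableT_comp => //; apply: measurable_funM => //.
  by apply: measurable_funB; exact: (bm_measurable bmW).
- by apply: filterS (bm_start bmW) => w W0 _; rewrite W0 subr0.
Qed.

(** A family closed under intersections that contains the generators of the augmented filtration.
    The exceptional null set absorbs the augmentation, and the chain enters with its whole history
    since all of it is independent of [W]. *)
Definition almost_rectangle (s : R) : set (set Omega) := [set C |
  measurable C /\ exists A B, [/\ <<s sW `[0, s]%classic >> A, <<s sY `[0, +oo[%classic >> B &
    P.-negligible ((C `\` (A `&` B)) `|` ((A `&` B) `\` C))]].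

Lemma integral_almost_eq (f : Omega -> R) C D : measurable C -> measurable D ->
  measurable_fun setT f ->
  P.-negligible ((C `\` D) `|` (D `\` C)) ->
  (\int[P]_(w in C) (f w)%:E = \int[P]_(w in D) (f w)%:E)%E.
Proof.
move=> mC mD mf N; rewrite integral_mkcond [RHS]integral_mkcond.
apply: ae_eq_integral => //.
- apply/(measurable_restrictT _ _).1 => //; apply/measurable_EFinP; exact: measurable_funTS.
- apply/(measurable_restrictT _ _).1 => //; apply/measurable_EFinP; exact: measurable_funTS.
apply: negligibleS N => w /= /not_implyP[_].
rewrite !patchE; case: (boolP (w \in C)); case: (boolP (w \in D)) => //.
  by rewrite notin_setE inE; left.
by rewrite notin_setE inE; right.
Qed.

(** On a rectangle the chain event factors out by independence, leaving [integral_expW_step]; the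
    sets where the identity holds form a Dynkin class, which extends it to the whole filtration. *)
Theorem integral_expW (a s t : R) C : 0 <= s -> s <= t -> filtration P W Y s C ->
  (\int[P]_(w in C) (expR (a * W t w))%:E =
   (expR (a ^+ 2 * (t - s) / 2))%:E * \int[P]_(w in C) (expR (a * W s w))%:E)%E.
Proof.
move=> s0; rewrite le_eqVlt => /predU1P[<- _|st mC].
  by rewrite subrr mulr0 mul0r expR0 mul1e.
have t0 := le_trans s0 (ltW st).
have sm u : sW `[0, u]%classic `<=` measurable.
  by apply: real_events_measurable => v; exact: itv0t_ge0.
have smy : sW `[0, +oo[%classic `<=` measurable.
  by apply: real_events_measurable => v; exact: itv0y_ge0.
have ym u : sY `[0, u]%classic `<=` measurable.
  by apply: chain_events_measurable => v; exact: itv0t_ge0.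
have ymy : sY `[0, +oo[%classic `<=` measurable.
  by apply: chain_events_measurable => v; exact: itv0y_ge0.
have mE u : 0 <= u -> measurable_fun setT (fun w => expR (a * W u w)).
  move=> u0; apply: measurableT_comp => //; apply: measurable_funM => //.
  exact: (bm_measurable bmW).
have E0 u w : 0 <= expR (a * W u w) by rewrite expR_ge0.
pose c : R := expR (a ^+ 2 * (t - s) / 2).
pose D := [set C | measurable C /\
   (\int[P]_(w in C) (expR (a * W t w))%:E = c%:E * \int[P]_(w in C) (expR (a * W s w))%:E)%E].
have RI : setI_closed (almost_rectangle s).
  move=> C1 C2 [mC1 [A1 [B1 [mA1 mB1 N1]]]] [mC2 [A2 [B2 [mA2 mB2 N2]]]].
  split; first exact: measurableI.
  exists (A1 `&` A2), (B1 `&` B2); split.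
  - exact: (@measurableI _ (g_sigma_algebraType (sW `[0, s]%classic))).
  - exact: (@measurableI _ (g_sigma_algebraType (sY `[0, +oo[%classic))).
  - apply: negligibleS (negligibleU N1 N2) => w /= [[[c1 c2] nab]|[[[a1 a2] [b1 b2]] nc]].
      have [ab|ab] := pselect ((A1 `&` B1) w); last by left; left; split.
      by right; left; split => // -[a2 b2]; apply: nab; case: ab.
    have [c1|c1] := pselect (C1 w); last by left; right.
    by right; right; split => // c2; apply: nc.
have RT : almost_rectangle s setT.
  split => //; exists setT, setT; split.
  - exact: (@measurableT _ (g_sigma_algebraType (sW `[0, s]%classic))).
  - exact: (@measurableT _ (g_sigma_algebraType (sY `[0, +oo[%classic))).
  - by rewrite setIT setDv setU0; exact: negligible_set0.
have RD : almost_rectangle s `<=` D.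
  move=> C' [mC' [A [B [mA mB N]]]]; split => //.
  have mA' := subsigma_measurable (sm s) mA.
  have mB' := subsigma_measurable ymy mB.
  have prodE u : s <= u -> (\int[P]_(w in C') (expR (a * W u w))%:E =
      P B * \int[P]_(w in A) (expR (a * W u w))%:E)%E.
    move=> su; have u0 := le_trans s0 su.
    rewrite (integral_almost_eq mC' (measurableI _ _ mA' mB') (mE u u0) N).
    rewrite setIC.
    pose f w := (\1_A w * expR (a * W u w))%:E.
    have H X : (\int[P]_(w in X `&` A) (expR (a * W u w))%:E = \int[P]_(w in X) f w)%E.
      rewrite integral_mkcondr; apply: eq_integral => w _; rewrite patchE /f indicE.
      by case: (w \in A); rewrite ?mul1r ?mul0r.
    rewrite H -[in RHS](setTI A) H.
    apply: (@independent_integral _ _ _ P (sW `[0, +oo[%classic) _ _ _ smy indepWY) => //.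
      have s0y : `[0, s]%classic `<=` `[0, +oo[%classic.
        by move=> v /=; rewrite !in_itv/= andbT => /andP[].
      have u0y : `[0, u]%classic `<=` `[0, +oo[%classic.
        by move=> v /=; rewrite !in_itv/= andbT => /andP[].
      apply/measurable_EFinP; apply: measurable_funM.
        apply: measurable_indic; exact: (sW_mono s0y).
      exact: (subsigmaS_measurable_fun (sW_mono u0y) (measurable_expW a u0)).
    by move=> w; rewrite lee_fin mulr_ge0// expR_ge0.
  rewrite !prodE ?(ltW st)// (integral_expW_step s0 st mA (integral_expW_fin a s0)).
  by rewrite muleCA.
have dD : dynkin D.
  have mEe u X : 0 <= u -> measurable_fun X (fun w => (expR (a * W u w))%:E).
    by move=> u0; apply: measurable_funTS; apply/measurable_EFinP; exact: mE.
  split; first exact: RD.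
  - move=> X [mX XE]; split; first exact: measurableC.
    have [_ TE] := RD _ RT.
    have splitX u : 0 <= u -> (\int[P]_(w in setT) (expR (a * W u w))%:E =
        \int[P]_(w in X) (expR (a * W u w))%:E + \int[P]_(w in ~` X) (expR (a * W u w))%:E)%E.
      move=> u0; rewrite -ge0_integral_setU ?setUv//.
      - exact: measurableC.
      - exact: mEe.
      - by apply/disj_setPS; rewrite setICr.
    (* Finiteness permits cancelling the part over [X] from the identity over the whole space. *)
    have fX : (\int[P]_(w in X) (expR (a * W t w))%:E \is a fin_num)%E.
      rewrite ge0_fin_numE; last by apply: integral_ge0 => w _; rewrite lee_fin expR_ge0.
      apply: le_lt_trans (integral_expW_fin a t0).
      apply: ge0_subset_integral => //; first exact: mEe.
    move: TE; rewrite !splitX// ge0_muleDr; last 2 first.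
    + by apply: integral_ge0 => w _; rewrite lee_fin expR_ge0.
    + by apply: integral_ge0 => w _; rewrite lee_fin expR_ge0.
    rewrite -XE => /(congr1 (fun z => z - \int[P]_(w in X) (expR (a * W t w))%:E)%E).
    by rewrite addeAC subee// add0e addeAC subee// add0e.
  - move=> F tF DF.
    have mF i : measurable (F i) by case: (DF i).
    split; first exact: bigcup_measurable.
    rewrite !ge0_integral_bigcup//; last 2 first.
    + exact: mEe.
    + exact: mEe.
    rewrite -nneseriesZl; last by move=> i _; apply: integral_ge0 => w _; rewrite lee_fin expR_ge0.
    by apply: eq_eseriesr => i _; case: (DF i).
have : <<s almost_rectangle s >> C.
  move: C mC; apply: smallest_sub; first exact: smallest_sigma_algebra.
  move=> X gX; apply: sub_sigma_algebra; split; first exact: filtration_gen_measurable gX.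
  case: gX => [[wX|yX]|nX].
  - exists X, setT; split; first exact: sub_sigma_algebra.
      exact: (@measurableT _ (g_sigma_algebraType (sY `[0, +oo[%classic))).
    by rewrite setIT setDv setU0; exact: negligible_set0.
  - exists setT, X; split.
      exact: (@measurableT _ (g_sigma_algebraType (sW `[0, s]%classic))).
      apply: sub_sigma_algebra; case: yX => v [j [vs ->]]; exists v, j; split => //.
      by move: vs; rewrite /= !in_itv/= andbT => /andP[].
    by rewrite setTI setDv setU0; exact: negligible_set0.
  - exists set0, set0; split.
      exact: (@measurable0 _ (g_sigma_algebraType (sW `[0, s]%classic))).
      exact: (@measurable0 _ (g_sigma_algebraType (sY `[0, +oo[%classic))).
    by rewrite setIid setD0 set0D setU0.
rewrite -setI_closed_g_dynkin_g_sigma_algebra// => dC.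
suff [] : D C by [].
by move: C dC {mC}; apply: smallest_sub.
Qed.

End exponential_brownian.

(** * Integration by parts for discounted processes *)

Section time_integral.
Context {R : realType}.
Implicit Types (f : R -> R) (s t T C : R).
Local Notation leb := (@lebesgue_measure R).

Definition right_continuous_path f := forall t, f s @[s --> t^'+] --> f t.

Lemma cvg_right_seq f (q : nat -> R) s : right_continuous_path f ->
  (forall n, s < q n) -> q n @[n --> \oo] --> s -> f (q n) @[n --> \oo] --> f s.
Proof.
move=> rf sq qs; apply/cvgrPdist_le => e e0.
have /cvgrPdist_le/(_ e e0) := rf s.
move=> [d /= d0 H].
near=> n; apply: H => //=; near: n; move/cvgrPdist_lt : qs; exact.
Unshelve. all: by end_near. Qed.

Lemma cvg_rc_grid f s T : right_continuous_path f -> 0 <= s < T ->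
  f (grid n (gidx n s).+1 T) @[n --> \oo] --> f s.
Proof.
move=> rf sT; apply: cvg_right_seq => //; last exact: cvg_grid_right.
by move=> n; case/andP: (grid_gidx n sT).
Qed.

Lemma measurable_rc f T : right_continuous_path f -> measurable_fun `[0, T[ f.
Proof.
move=> rf.
exact (@measurable_step_lim _ T f (fun n k => f (grid n k.+1 T)) (fun s => @cvg_rc_grid f s T rf)).
Qed.

Lemma measurable_rc_itv f (a b : R) : right_continuous_path f -> 0 <= a ->
  measurable_fun `[a, b[ f.
Proof.
move=> rf a0; have := @measurable_rc f b rf; apply: measurable_funS => //.
by move=> s /=; rewrite !in_itv/= => /andP[/(le_trans a0) -> ->].
Qed.

Definition tint f t : R := \int[leb]_(s in `[0, t]) f s.

Lemma integrable_rc f C a b : right_continuous_path f -> (forall s, `|f s| <= C) ->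
  0 <= a -> leb.-integrable `[a, b[ (EFin \o f).
Proof.
move=> rf fC a0; apply: (@le_integrable _ _ _ _ _ _ _ (cst C%:E)) => //.
- by apply/measurable_EFinP; exact: measurable_rc_itv.
- by move=> s _ /=; rewrite lee_fin (le_trans (fC s))// ler_norm.
- apply/integrableP; split => //; rewrite integral_cst//= lebesgue_measure_itv/=.
  by case: ifP => _; rewrite -?EFinD -?EFinM ?mule0 ltry.
Qed.

Lemma tintE f C t : right_continuous_path f -> (forall s, `|f s| <= C) ->
  tint f t = \int[leb]_(s in `[0, t[) f s.
Proof.
by move=> rf fC; rewrite /tint Rintegral_itv_bndo_bndc//; exact: (integrable_rc _ rf fC).
Qed.

Lemma tint_lt0 f t : t < 0 -> tint f t = 0.
Proof. by move=> t0; rewrite /tint set_itv_ge ?Rintegral_set0// bnd_simp -ltNge. Qed.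

Lemma tint0 f : tint f 0 = 0.
Proof. by rewrite /tint set_itv1 Rintegral_set1. Qed.

Lemma tintB f C s t : right_continuous_path f -> (forall s, `|f s| <= C) ->
  0 <= s -> s <= t -> tint f t - tint f s = \int[leb]_(u in `[s, t[) f u.
Proof.
move=> rf fC s0 st; have t0 := le_trans s0 st.
rewrite !(tintE _ rf fC); apply/eqP; rewrite subr_eq addrC; apply/eqP.
rewrite -Rintegral_setU//=.
- by rewrite -itv_bndbnd_setU// ?bnd_simp.
- by rewrite -itv_bndbnd_setU// ?bnd_simp//; exact: (integrable_rc _ rf fC).
- apply/disj_setPS => u /= []; rewrite !in_itv/= => /andP[_ us] /andP[su _].
  by move: us; rewrite ltNge su.
Qed.

Lemma tint_lip f C s t : right_continuous_path f -> (forall s, `|f s| <= C) ->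
  0 <= s -> s <= t -> `|tint f t - tint f s| <= C * (t - s).
Proof.
move=> rf fC s0 st; rewrite (tintB rf fC s0 st).
have fi := integrable_rc t rf fC s0.
have cst_int : leb.-integrable `[s, t[ (EFin \o cst C).
  have C0 : 0 <= C by rewrite (le_trans _ (fC 0)).
  by apply: (@integrable_rc _ C) => // [u|u]; [exact: cvg_cst|rewrite ger0_norm].
apply: (le_trans (le_normr_Rintegral _ fi)) => //.
apply: (le_trans (@le_Rintegral _ _ _ _ _ _ (cst C) _ _ _ _)) => //.
- exact: integrable_norm fi.
- rewrite Rintegral_cst//=.  rewrite lebesgue_measure_itv/= lte_fin.
  by move: st; rewrite le_eqVlt => /predU1P[->|->]//=; rewrite ltxx subrr.
Qed.

Lemma continuous_tint f C : right_continuous_path f -> (forall s, `|f s| <= C) ->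
  continuous (tint f).
Proof.
move=> rf fC.
have C0 : 0 <= C by rewrite (le_trans _ (fC 0)).
have lip s t : s <= t -> `|tint f t - tint f s| <= C * (t - s).
  move=> st; have [t0|t0] := ltP t 0.
    rewrite !tint_lt0 ?subrr ?normr0 ?mulr_ge0 ?subr_ge0//; exact: le_lt_trans t0.
  have [s0|s0] := ltP s 0; last exact: tint_lip.
  rewrite (tint_lt0 _ s0) -(tint0 f) (le_trans (tint_lip rf fC _ _))//.
  by rewrite ler_wpM2l// lerD2l lerN2 ltW.
move=> t; apply/cvgrPdist_le => e e0.
near=> s.
have lipn : `|tint f t - tint f s| <= C * `|t - s|.
  have [st|ts] := leP s t; first by rewrite (@ger0_norm _ (t - s)) ?subr_ge0// lip.
  by rewrite distrC (distrC t s) (@ger0_norm _ (s - t)) ?subr_ge0 ?(ltW ts)// lip// ltW.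
rewrite (le_trans lipn)// (@le_trans _ _ ((C + 1) * `|t - s|))//.
  by rewrite ler_wpM2r// lerDl.
rewrite -ler_pdivlMl; last by rewrite ltr_wpDl.
near: s; apply: cvgr_dist_le; first exact: cvg_id.
by rewrite mulr_gt0// invr_gt0 ltr_wpDl.
Unshelve. all: by end_near. Qed.

Lemma lebesgue_grid n k T : 0 <= T ->
  leb `[grid n k T, grid n k.+1 T[%classic = (grid n k.+1 T - grid n k T)%:E.
Proof.
move=> T0; rewrite lebesgue_measure_itv/= lte_fin.
have := le_grid n T (leqnSn k); rewrite le_eqVlt => /predU1P[->|->]; last by rewrite EFinB.
by rewrite ltxx subrr.
Qed.

Lemma lebesgue_0t T : (leb `[0%R, T[%classic < +oo)%E.
Proof. by rewrite lebesgue_measure_itv/=; case: ifP; rewrite -?EFinD ltry. Qed.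

Lemma sum_grid n T : 0 <= T -> \sum_(k < gsize n T) (grid n k.+1 T - grid n k T) = T.
Proof. by move=> T0; have := sum_incr id T0 (leqnn (gsize n T)); rewrite /incr subr0. Qed.

Lemma cvg_tint_sum f C T : right_continuous_path f -> (forall s, `|f s| <= C) -> 0 <= T ->
  \sum_(k < gsize n T) f (grid n k.+1 T) * (grid n k.+1 T - grid n k T) @[n --> \oo]
    --> tint f T.
Proof.
move=> rf fC T0.
have fC' s : - C <= f s <= C by rewrite -ler_norml.
(* Adding [C] makes the integrand nonnegative, as [cvg_integral_step] requires; the added term is
   subtracted again exactly, since the cell lengths sum to [T]. *)
have rfC : right_continuous_path (fun s => f s + C).
  by move=> t; apply: cvgD; [exact: rf|exact: cvg_cst].
have fi := integrable_rc T rf fC (lexx 0).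
have C0 : 0 <= C by rewrite (le_trans _ (fC 0)).
have cst_int : leb.-integrable `[0, T[ (EFin \o cst C).
  by apply: (@integrable_rc _ C) => // [u|u]; [exact: cvg_cst|rewrite ger0_norm].
have -> : tint f T = \int[leb]_(s in `[0, T[) (f s + C) - C * T.
  rewrite RintegralD// -(tintE _ rf fC) Rintegral_cst//=.
  rewrite lebesgue_measure_itv/= lte_fin.
  by move: T0; rewrite le_eqVlt => /predU1P[<-|->]/=; rewrite ?ltxx ?mulr0 ?oppr0 ?addr0 ?addrK ?subr0.
rewrite (_ : (fun n => _) = (fun n => \sum_(k < gsize n T) (f (grid n k.+1 T) + C) * (grid n k.+1 T - grid n k T) - C * T)); last first.
  apply/funext => n; rewrite -[X in _ - C * X](sum_grid n T0) mulr_sumr -sumrB.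
  by apply: eq_bigr => k _; ring.
apply: cvgB; last exact: cvg_cst.
apply: fine_cvg_EFin.
have fC0 s : 0 <= f s + C by case/andP: (fC' s); lra.
have fC2 s : f s + C <= C + C by case/andP: (fC' s); lra.
have -> : (\int[leb]_(s in `[0, T[) (f s + C))%:E = (\int[leb]_(s in `[0%R, T[) (f s + C)%:E)%E.
  rewrite /Rintegral fineK//; apply: integrable_fin_num => //.
  by apply: (@integrable_rc _ (C + C)) => // u; rewrite ger0_norm.
rewrite (_ : (fun n => _) = (fun n => \sum_(k < gsize n T) (f (grid n k.+1 T) + C)%:E * leb `[grid n k T, grid n k.+1 T[%classic)%E); last first.
  apply/funext => n; rewrite -sumEFin; apply: eq_bigr => k _.
  by rewrite lebesgue_grid.
have H1 n k : 0 <= f (grid n k.+1 T) + C <= C + C by rewrite fC0 fC2.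
have H2 s : 0 <= s < T -> f (grid n (gidx n s).+1 T) + C @[n --> \oo] --> f s + C.
  by move=> sT; exact: (cvg_rc_grid rfC).
exact: (@cvg_integral_step _ leb T (fun s => f s + C) (fun n k => f (grid n k.+1 T) + C) (C + C) (lebesgue_0t T) H1 H2).
Qed.

End time_integral.

Section integration_by_parts.
Context {R : realType}.
Variables (D A : R -> R).
Hypothesis cD : continuous D.
Hypothesis D0 : forall s, 0 <= D s.
Hypothesis D1 : forall s, 0 <= s -> D s <= 1.
Hypothesis DA : forall a b, 0 <= a -> a <= b -> D b * (A b - A a) <= D a - D b <= D a * (A b - A a).

(** Hypothesis [DA] is the discrete form of [dD = - D dA], and [J] stands for the integral of [D L]
    against [dA], specified only as the common limit of its Riemann sums. *)
Lemma sint_by_parts (L : R -> R) T (J : \bar R) : increasing_path L -> 0 <= T ->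
  (forall a : nat -> nat -> R,
    (forall n j, (j < gsize n T)%N -> 0 <= a n j <= L T) ->
    (forall s, 0 <= s < T -> a n (gidx n s) @[n --> \oo] --> D s * L s) ->
    (\sum_(j < gsize n T) a n j * (A (grid n j.+1 T) - A (grid n j T)))%:E @[n --> \oo] --> J) ->
  ((sint D L T)%:E = (D T * L T)%:E + J)%E.
Proof.
move=> IL T0 HJ.
have Lb s : 0 <= s <= T -> 0 <= L s <= L T.
  by move=> /andP[s0 sT]; rewrite ip_ge0// ip_le.
have gT n j : 0 <= grid n j T <= T by rewrite grid_ge0// grid_le.
have bnd n j i : 0 <= D (grid n j T) * L (grid n i T) <= L T.
  have d1 := D1 (grid_ge0 n j T0).
  have /andP[l0 l1] := Lb _ (gT n i).
  by rewrite mulr_ge0//= -[leRHS]mul1r ler_pM.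
have Lcv s : 0 <= s < T -> L (grid n (gidx n s) T) @[n --> \oo] --> L s.
  move=> sT; apply: (cvg_left_seq (ip_lc IL)); last exact: cvg_grid_left.
  by move=> n; rewrite grid_ge0//=; case/andP: (grid_gidx n sT).
have lo := HJ (fun n j => D (grid n j.+1 T) * L (grid n j T)) (fun n j _ => bnd n _ _)
  (fun s sT => cvgM (cvg_comp_seq cD (cvg_grid_right sT)) (Lcv s sT)).
have hi := HJ (fun n j => D (grid n j T) * L (grid n j T)) (fun n j _ => bnd n _ _)
  (fun s sT => cvgM (cvg_comp_seq cD (cvg_grid_left sT)) (Lcv s sT)).
(* Abel summation turns [u n] into the sum for [D dL] minus the boundary term; [DA] squeezes [u n]
   between two Riemann sums for [J]. *)
pose u n := \sum_(j < gsize n T) L (grid n j T) * (D (grid n j T) - D (grid n j.+1 T)).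
have uE n : u n = rsum n D L T - D T * L T.
  have telT : \sum_(j < gsize n T) incr (fun s => D s * L s) n j T = D T * L T.
    by rewrite (sum_incr _ T0 (leqnn _)) (ip0 IL) mulr0 subr0.
  rewrite -telT -sumrB; apply: eq_bigr => j _; rewrite /incr.
  move: (D (grid n j.+1 T)) (D (grid n j T)) (L (grid n j.+1 T)) (L (grid n j T)).
  by move=> a b c e; ring.
have uJ : (u n)%:E @[n --> \oo] --> J.
  apply: (squeeze_cvge _ (lo _) (hi _)); apply: nearW => n; rewrite !lee_fin; apply/andP; split;
    apply: ler_sum => j _; rewrite (mulrC (D _) (L _)) -mulrA; apply: ler_wpM2l;
    try (by case/andP: (Lb _ (gT n j)));
    by have /andP[] := DA (grid_ge0 n j T0) (le_grid n T (leqnSn j)).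
have uS : (u n)%:E @[n --> \oo] --> (sint D L T - D T * L T)%:E.
  apply: cvg_EFin; first exact: nearW.
  under eq_cvg do rewrite /= uE.
  by apply: cvgB; [exact: cvg_rsum|exact: cvg_cst].
by rewrite -(cvg_unique _ uS uJ)// -EFinD; congr EFin; ring.
Qed.

End integration_by_parts.

Lemma measurable_increasing_path {R : realType} (L : R -> R) (T : R) : increasing_path L ->
  measurable_fun `[0, T[%classic L.
Proof.
move=> IL.
have H s : 0 <= s < T -> L (grid n (gidx n s) T) @[n --> \oo] --> L s.
  move=> sT; apply: (cvg_left_seq (ip_lc IL)); last exact: cvg_grid_left.
  move=> n; have /andP[s0 sT'] := sT.
  by rewrite grid_ge0 ?(le_trans s0 (ltW sT'))//=; case/andP: (grid_gidx n sT).
exact: (@measurable_step_lim _ T L (fun n k => L (grid n k T)) H).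
Qed.

Lemma rsum_le_sint {R : realType} n (G L : R -> R) T : increasing_path L -> 0 <= T ->
  continuous G -> (forall s, 0 <= G s) ->
  (forall s t, 0 <= s -> s <= t -> G t <= G s) -> rsum n G L T <= sint G L T.
Proof.
move=> IL T0 cG G0 ncG; rewrite -lee_fin sintE//.
pose a k := G (grid n k.+1 T).
have -> : ((rsum n G L T)%:E = \int[stieltjes L]_(s in `[0%R, T[) (a (gidx n s))%:E)%E.
  rewrite (@integral_step _ (stieltjes L) n T a)//.
  rewrite -sumEFin; apply: eq_bigr => k _; rewrite EFinM; congr (_ * _)%E.
  exact/esym/(stieltjes_grid n k IL T0).
  by move=> k; rewrite /a.
apply: ge0_le_integral => //.
- by move=> s _; rewrite lee_fin /a.
- by apply/measurable_EFinP; exact: (@measurable_step _ n T a).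
- by apply/measurable_EFinP; exact: measurable_continuous.
- move=> s /=; rewrite in_itv/= => sT; rewrite lee_fin.
  by case/andP: (sT) => s0 _; rewrite ncG//; case/andP: (grid_gidx n sT) => _ /ltW.
Qed.

Section discounting.
Context {R : realType}.
Local Notation leb := (@lebesgue_measure R).
Variables (k : R -> R) (C : R).
Hypothesis rk : right_continuous_path k.
Hypothesis k0 : forall s, 0 <= k s.
Hypothesis kC : forall s, k s <= C.

Let nkC s : `|k s| <= C. Proof. by rewrite ger0_norm. Qed.

Definition disc t : R := expR (- tint k t).

Lemma continuous_disc : continuous disc.
Proof.
move=> t; apply: continuous_comp; last exact: continuous_expR.
apply: cvgN; exact: (continuous_tint rk nkC).
Qed.

Lemma disc_gt0 t : 0 < disc t. Proof. exact: expR_gt0. Qed.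

Lemma disc0 : disc 0 = 1. Proof. by rewrite /disc tint0 oppr0 expR0. Qed.

Lemma le_tint s t : 0 <= s -> s <= t -> tint k s <= tint k t.
Proof.
move=> s0 st; rewrite -subr_ge0 (tintB rk nkC s0 st).
by apply: Rintegral_ge0.
Qed.

Lemma le_disc s t : 0 <= s -> s <= t -> disc t <= disc s.
Proof. by move=> s0 st; rewrite ler_expR lerN2 le_tint. Qed.

Lemma disc_le1 t : 0 <= t -> disc t <= 1.
Proof. by move=> t0; rewrite -disc0 le_disc. Qed.

Lemma tintB_ge0_integral s t : 0 <= s -> s <= t ->
  ((tint k t - tint k s)%:E = \int[leb]_(u in `[s, t[) (k u)%:E)%E.
Proof.
move=> s0 st; rewrite (tintB rk nkC s0 st) /Rintegral fineK//.
apply: integrable_fin_num => //; exact: (integrable_rc _ rk nkC).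
Qed.

Lemma cvg_tint_weight (G : R -> R) (a : nat -> nat -> R) (K T : R) : 0 <= T ->
  (forall n j, (j < gsize n T)%N -> 0 <= a n j <= K) ->
  (forall s, 0 <= s < T -> a n (gidx n s) @[n --> \oo] --> G s) ->
  (\sum_(j < gsize n T) a n j * (tint k (grid n j.+1 T) - tint k (grid n j T)))%:E @[n --> \oo]
   --> (\int[leb]_(s in `[0%R, T[) (G s * k s)%:E)%E.
Proof.
move=> T0 aK aG.
(* The weights are controlled only for cells inside the horizon; setting them to 0 beyond makes them
   nonnegative at every index without changing the sums. *)
pose b n j := if (j < gsize n T)%N then a n j else 0.
have bE n s : 0 <= s < T -> b n (gidx n s) = a n (gidx n s).
  by move=> sT; rewrite /b gidx_size.
have b0 n j : 0 <= b n j.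
  by rewrite /b; case: ifP => // /(aK n) /andP[].
have bK n s : 0 <= s < T -> b n (gidx n s) <= K.
  by move=> sT; rewrite bE//; have /andP[] := aK n _ (gidx_size n sT).
rewrite (_ : (fun n => _) = (fun n => \int[leb]_(s in `[0%R, T[) (b n (gidx n s) * k s)%:E)%E); last first.
  apply/funext => n.
  rewrite (@ge0_integral_step _ leb n T (fun s => b n (gidx n s)) k (b n))//; last exact: measurable_rc.
  rewrite -sumEFin; apply: eq_bigr => j _.
  by rewrite EFinM tintB_ge0_integral ?grid_ge0// ?le_grid// /b ltn_ord.
apply: (@dominated_cvg _ _ _ _ _ _ _ _ (fun s : measurableTypeR R => (K%:E * (k s)%:E)%E)) => //.
- move=> n; apply/measurable_EFinP; apply: measurable_funM; last exact: measurable_rc.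
  exact: (@measurable_step _ n T (b n)).
- move=> s /=; rewrite in_itv/= => sT; apply: cvg_EFin; first exact: nearW.
  apply: cvgMl; under eq_cvg do rewrite bE//; exact: aG.
- apply: integrableZl => //; exact: (integrable_rc _ rk nkC).
- move=> n s /=; rewrite in_itv/= => sT; rewrite lee_fin normrM !ger0_norm//.
  by rewrite ler_wpM2r// bK.
Qed.

(** Both bounds are [1 + y <= exp y], with [y] the increment of the integral of [k] or its
    opposite. *)
Lemma disc_incr a b : 0 <= a -> a <= b ->
  disc b * (tint k b - tint k a) <= disc a - disc b <= disc a * (tint k b - tint k a).
Proof.
move=> _ _; rewrite /disc; move: (tint k a) (tint k b) => x y; apply/andP; split.
  have -> : expR (- x) = expR (- y) * expR (y - x) by rewrite -expRD; congr expR; ring.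
  rewrite -[X in _ <= _ - X]mulr1 -mulrBr ler_wpM2l ?expR_ge0//.
  by have := expR_ge1Dx (y - x); lra.
have -> : expR (- y) = expR (- x) * expR (- (y - x)) by rewrite -expRD; congr expR; ring.
rewrite -[X in X - _ <= _]mulr1 -mulrBr ler_wpM2l ?expR_ge0//.
by have := expR_ge1Dx (- (y - x)); lra.
Qed.

Lemma sint_disc (L : R -> R) T : increasing_path L -> 0 <= T ->
  ((sint disc L T)%:E = (disc T * L T)%:E + \int[leb]_(s in `[0%R, T[) (disc s * L s * k s)%:E)%E.
Proof.
move=> IL T0; apply: (sint_by_parts continuous_disc (fun s => ltW (disc_gt0 s)) disc_le1 disc_incr IL T0).
by move=> a a0 aL; exact: (cvg_tint_weight T0 a0 aL).
Qed.

End discounting.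

(** * Measurability and integration on the product of the probability space with time *)

Section joint_measurability.
Context {R : realType} {d : measure_display} {T : measurableType d}.
Implicit Types (U : R -> T -> R).

Lemma measurable_step_prod n (b : R) (V : nat -> T -> R) :
  (forall k, measurable_fun setT (V k)) ->
  measurable_fun (setT `*` `[0, b[) (fun z : T * R => V (gidx n z.2) z.1).
Proof.
move=> mV.
apply: (@eq_measurable_fun _ _ _ _ _ (fun z : T * R => \sum_(k < gsize n b)
    V k z.1 * \1_(`[grid n k b, grid n k.+1 b[%classic) z.2)).
  move=> z; rewrite inE => -[_ /=]; rewrite in_itv/= => sb.
  rewrite (bigD1 (Ordinal (gidx_size n sb)))//= big1 ?addr0.
    rewrite indicE mem_set ?mulr1//=; rewrite in_itv/=; exact: grid_gidx.
  move=> k /negP kn; rewrite indicE memNset ?mulr0//= in_itv/= => H; apply: kn.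
  by apply/eqP/val_inj => /=; apply/esym/eqP; rewrite (gidx_itv _ _ sb).
apply: measurable_funTS; apply: measurable_sum => k.
apply: measurable_funM.
  exact: (measurableT_comp (mV k)).
by apply: (measurableT_comp (measurable_indic _)) => //; exact: measurable_itv.
Qed.

(** The offset [e] selects the end of the cell at which the process is frozen: 0 suits
    left-continuous paths, 1 right-continuous ones. *)
Lemma joint_measurable U (e : nat) : (forall t, 0 <= t -> measurable_fun setT (U t)) ->
  (forall w s b, 0 <= s < b -> U (grid n (gidx n s + e) b) w @[n --> \oo] --> U s w) ->
  measurable_fun ([set: T] `*` `[(0 : R), +oo[%classic) (fun z : T * R => U z.2 z.1).
Proof.
move=> mU cU.
have -> : [set: T] `*` `[(0 : R), +oo[%classic = \bigcup_m ([set: T] `*` `[(0 : R), m%:R[%classic).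
  apply/seteqP; split => [[w s] [_ /=]|[w s] [m _] [_ /=]]; rewrite !in_itv/=.
    rewrite andbT => s0; exists (Num.truncn s).+1 => //; split => //=.
    by rewrite in_itv/= s0 truncnS_gt.
  by move=> /andP[-> _]; split.
apply/measurable_fun_bigcup => [m|m]; first by apply: measurableX => //; exact: measurable_itv.
apply: (@measurable_fun_cvg _ _ _ _ (fun n (z : T * R) => U (grid n (gidx n z.2 + e) m%:R) z.1)).
- move=> n; apply: (@measurable_step_prod n m%:R (fun k => U (grid n (k + e) m%:R))) => k.
  by apply: mU; exact: grid_ge0.
- by move=> [w s] [_ /=]; rewrite in_itv/= => sm; exact: cU.
Qed.

Lemma joint_measurable_rc U : (forall t, 0 <= t -> measurable_fun setT (U t)) ->
  (forall w, right_continuous_path (U ^~ w)) ->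
  measurable_fun ([set: T] `*` `[(0 : R), +oo[%classic) (fun z : T * R => U z.2 z.1).
Proof.
move=> mU rU; apply: (@joint_measurable U 1) => // w s b sb.
by under eq_fun do rewrite addn1; exact: (cvg_rc_grid (rU w)).
Qed.

Lemma joint_measurable_lc U : (forall t, 0 <= t -> measurable_fun setT (U t)) ->
  (forall w, left_continuous_path (U ^~ w)) ->
  measurable_fun ([set: T] `*` `[(0 : R), +oo[%classic) (fun z : T * R => U z.2 z.1).
Proof.
move=> mU lU; apply: (@joint_measurable U 0) => // w s b sb.
under eq_fun do rewrite addn0.
apply: (cvg_left_seq (lU w)); last exact: cvg_grid_left.
move=> n; have /andP[s0 sb'] := sb; rewrite grid_ge0 ?(le_trans s0 (ltW sb'))//=.
by case/andP: (grid_gidx n sb).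
Qed.

Lemma continuous_left_path (f : R -> R) : continuous f -> left_continuous_path f.
Proof. by move=> cf t _; apply: cvg_at_left_filter; exact: cf. Qed.

End joint_measurability.

Lemma joint_measurable_sub {R : realType} {d : measure_display} {T : measurableType d}
    (f : T * R -> R) (b : R) :
  measurable_fun ([set: T] `*` `[(0 : R), +oo[%classic) f ->
  measurable_fun ([set: T] `*` `[(0 : R), b[%classic) f.
Proof.
apply: measurable_funS; first by apply: measurableX; [exact: measurableT|exact: measurable_itv].
by move=> [w s] [_ /=]; rewrite !in_itv/= => /andP[-> _].
Qed.

Section tonelli.
Context {R : realType} {d : measure_display} {T : measurableType d}.
Variable P : probability T R.
Local Notation leb := (@lebesgue_measure R).
Variables (D : set R) (f : T * R -> \bar R).
Hypothesis mD : measurable D.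
Hypothesis mf : measurable_fun (setT `*` D) f.
Hypothesis f0 : forall z, D z.2 -> (0 <= f z)%E.

Let mTD : measurable ((setT : set T) `*` D). Proof. exact: measurableX. Qed.

Let g := f \_ (setT `*` D).

Let mg : measurable_fun setT g.
Proof. exact/(measurable_restrictT _ _).1. Qed.

Let g0 z : (0 <= g z)%E.
Proof.
rewrite /g patchE; case: ifPn => //; rewrite inE => -[_ Dz]; exact: f0.
Qed.

Let gE w : (\int[leb]_s g (w, s) = \int[leb]_(s in D) f (w, s))%E.
Proof.
rewrite [RHS]integral_mkcond; apply: eq_integral => s _; rewrite /g !patchE.
by congr (if _ then _ else _); apply/idP/idP; rewrite !inE/=; [case|split].
Qed.

Lemma tonelli_left :
  (\int[P]_w \int[leb]_(s in D) f (w, s) = \int[P \x leb]_(z in setT `*` D) f z)%E.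
Proof.
rewrite [RHS]integral_mkcond.
transitivity (\int[P]_w fubini_F leb g w)%E; last exact/esym/(@fubini_tonelli1 _ _ _ _ R P leb g mg g0).
by apply: eq_integral => w _; rewrite -gE.
Qed.

Lemma tonelli_right :
  (\int[leb]_(s in D) \int[P]_w f (w, s) = \int[P \x leb]_(z in setT `*` D) f z)%E.
Proof.
rewrite [RHS]integral_mkcond.
transitivity (\int[leb]_s fubini_G P g s)%E; last exact/esym/(@fubini_tonelli2 _ _ _ _ R P leb g mg g0).
rewrite [LHS]integral_mkcond; apply: eq_integral => s _; rewrite /fubini_G patchE.
case: ifPn; [rewrite inE|rewrite notin_setE] => Ds.
  by apply: eq_integral => w _; rewrite /g patchE mem_set.
by rewrite integral0_eq// => w _; rewrite /g patchE memNset// => -[].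
Qed.

Lemma measurable_tonelli : measurable_fun setT (fun w => \int[leb]_(s in D) f (w, s))%E.
Proof.
have := @measurable_fun_fubini_tonelli_F _ _ _ _ R leb g mg g0.
by rewrite /fubini_F; under eq_fun do rewrite gE.
Qed.

End tonelli.

Lemma ae_section {R : realType} {d : measure_display} {T : measurableType d}
    (P : probability T R) (Q : T * R -> Prop) :
  {ae (P \x @lebesgue_measure R)%E, forall z, Q z} ->
  {ae P, forall w, {ae @lebesgue_measure R, forall s, Q (w, s)}}.
Proof.
move=> [A [mA A0 QA]].
have mx : measurable_fun setT (fun w => lebesgue_measure (xsection A w)).
  exact: measurable_fun_xsection.
have H : (\int[P]_w `|lebesgue_measure (xsection A w)| = 0)%E.
  by rewrite -A0; apply: eq_integral => w _; rewrite gee0_abs.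
have /(ae_eq_integral_abs P measurableT mx) : (\int[P]_(w in setT) `|lebesgue_measure (xsection A w)| = 0)%E by [].
apply: filterS => w /(_ Logic.I) /= Aw0.
exists (xsection A w); split => //; first exact: measurable_xsection.
by move=> s /= nQ; rewrite /xsection /= inE; apply: QA.
Qed.

Section fatou_bounds.
Local Open Scope ereal_scope.
Context {R : realType} {d : measure_display} {T : measurableType d}.
Variables (mu : {measure set T -> \bar R}) (D : set T) (mD : measurable D).

Lemma limn_einf_le (u b : (\bar R)^nat) l : (forall n, u n <= b n) -> b @ \oo --> l ->
  limn_einf u <= l.
Proof.
move=> ub bl; rewrite limn_einf_lim.
apply: (@le_trans _ _ (limn b)); last by rewrite (cvg_lim _ bl).
apply: lee_lim; [exact: is_cvg_einfs|by apply/cvg_ex; exists l|].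
apply: nearW => n; apply: le_trans (ub n).
by apply: ereal_inf_lbound; exists n => /=.
Qed.

Lemma fatou_cvg_le (f : (T -> \bar R)^nat) g (b : (\bar R)^nat) l :
  (forall n, measurable_fun D (f n)) -> (forall n x, D x -> 0 <= f n x) ->
  (forall x, D x -> f n x @[n --> \oo] --> g x) ->
  (forall n, \int[mu]_(x in D) f n x <= b n) -> b @ \oo --> l ->
  \int[mu]_(x in D) g x <= l.
Proof.
move=> mf f0 fg fb bl.
rewrite (_ : \int[mu]_(x in D) g x = \int[mu]_(x in D) limn_einf (f ^~ x)).
  apply: le_trans (limn_einf_le fb bl); exact: fatou.
apply: eq_integral => x; rewrite inE => Dx.
by have [-> _] := cvg_limn_einf_sup (fg x Dx).
Qed.

Lemma fatou_le (f : (T -> \bar R)^nat) g l :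
  (forall n, measurable_fun D (f n)) -> (forall n x, D x -> 0 <= f n x) ->
  (forall x, D x -> f n x @[n --> \oo] --> g x) ->
  (forall n, \int[mu]_(x in D) f n x <= l) -> \int[mu]_(x in D) g x <= l.
Proof. by move=> mf f0 fg fl; apply: (fatou_cvg_le mf f0 fg fl); exact: cvg_cst. Qed.

Lemma ae_fatou (f : (T -> \bar R)^nat) g :
  (forall n, measurable_fun D (f n)) -> (forall n x, D x -> 0 <= f n x) ->
  measurable_fun D g -> (forall x, D x -> 0 <= g x) ->
  {ae mu, forall x, D x -> f n x @[n --> \oo] --> g x} ->
  \int[mu]_(x in D) g x <= limn_einf (fun n => \int[mu]_(x in D) f n x).
Proof.
move=> mf f0 mg g0 fg; apply: le_trans (fatou mu mD mf f0).
have mlf : measurable_fun D (fun x => limn_einf (f ^~ x)).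
  apply: (emeasurable_fun_cvg (fun n x => einfs (f ^~ x) n)) => [n|x Dx].
    exact: measurable_fun_einfs.
  by rewrite limn_einf_lim; exact: is_cvg_einfs.
have lf0 x : D x -> 0 <= limn_einf (f ^~ x).
  move=> Dx; rewrite limn_einf_lim; apply: lime_ge; first exact: is_cvg_einfs.
  by apply: nearW => n; apply: le_ereal_inf_tmp => _ [k _ <-]; exact: f0.
apply: ae_ge0_le_integral => //.
move: fg; apply: (@filterS _ _ (ae_filter_ringOfSetsType mu)) => x fgx Dx.
by have [-> _] := cvg_limn_einf_sup (fgx Dx).
Qed.

End fatou_bounds.

Section time_integrals.
Context {R : realType} {d : measure_display} {T : measurableType d}.
Local Notation leb := (@lebesgue_measure R).

Lemma measurable_section_time (D : set R) (f : T * R -> \bar R) w :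
  measurable D -> measurable_fun ([set: T] `*` D) f -> measurable_fun D (fun s => f (w, s)).
Proof.
move=> mD mf.
apply: (@measurable_comp _ _ _ _ _ _ (([set: T] `*` D)) f D (fun s => (w, s))) => //.
- exact: measurableX.
- by move=> _ /= [s Ds <-].
- apply: measurable_funTS; exact: pair1_measurable.
Qed.

Lemma measurable_tonelli_time (P : probability T R) (D : set R) (f : T * R -> \bar R) :
  measurable D -> measurable_fun ([set: T] `*` D) f -> (forall z, D z.2 -> (0 <= f z)%E) ->
  measurable_fun D (fun s => \int[P]_w f (w, s))%E.
Proof.
move=> mD mf f0.
have mTD : measurable ([set: T] `*` D) by exact: measurableX.
have mg : measurable_fun setT (f \_ ([set: T] `*` D)) by exact/(measurable_restrictT _ _).1.
have g0 z : (0 <= (f \_ ([set: T] `*` D)) z)%E.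
  by rewrite patchE; case: ifPn => //; rewrite inE => -[_ /=]; exact: f0.
have := @measurable_fun_fubini_tonelli_G _ _ _ _ R P _ mg g0.
move=> /(@measurable_funTS _ _ _ _ D).
apply: eq_measurable_fun => s Ds; rewrite /fubini_G; apply: eq_integral => w _.
by rewrite patchE ifT// inE; split => //; rewrite inE in Ds.
Qed.

Lemma cvg_integral_horizon (mu : {measure set (measurableTypeR R) -> \bar R}) (f : R -> \bar R) :
  measurable_fun `[(0 : R), +oo[%classic f -> (forall s, 0 <= s -> (0 <= f s)%E) ->
  (\int[mu]_(s in `[0%R, m%:R[) f s @[m --> \oo] --> \int[mu]_(s in `[0%R, +oo[) f s)%E.
Proof.
move=> mf f0.
have := @ge0_nondecreasing_set_cvg_integral _ _ _ (fun m => `[0:R, m%:R[%classic : set (measurableTypeR R)) f mu.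
have -> : \bigcup_i `[0:R, i%:R[%classic = `[0, +oo[%classic.
  apply/seteqP; split => s /=.
    by move=> [m _]; rewrite /= !in_itv/= => /andP[->].
  rewrite in_itv/= andbT => s0; exists (Num.truncn s).+1 => //=.
  by rewrite in_itv/= s0 truncnS_gt.
move=> H; apply: H.
- by move=> a b ab; apply/subsetPset => s /=; rewrite !in_itv/= => /andP[-> /=] /lt_le_trans; apply; rewrite ler_nat.
- by move=> m; exact: measurable_itv.
- move=> m; apply: measurable_funS mf; first exact: measurable_itv.
  by move=> s /=; rewrite !in_itv/= => /andP[->].
- by move=> m s; rewrite /= in_itv/= => /andP[s0 _]; exact: f0.
Qed.

Lemma integral_cst_ray (a c : R) : 0 < c -> (\int[leb]_(s in `[a, +oo[) c%:E = +oo)%E.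
Proof.
move=> c0; have -> : (\int[leb]_(s in `[a, +oo[) c%:E = c%:E * leb `[a, +oo[%classic)%E.
  exact: (integral_cst leb (measurable_itv `[a, +oo[) c%:E).
by rewrite lebesgue_measure_itv/= ltry gt0_muley// lte_fin.
Qed.

End time_integrals.

(** * Adapted processes, for a filtration given by generating families *)

Section adaptedness.
Context {R : realType} {d : measure_display} {Omega : measurableType d}.
Variable Gf : R -> set (set Omega).
Hypothesis Gm : forall t, Gf t `<=` measurable.
Hypothesis Fmono : forall s t, s <= t -> <<s Gf s >> `<=` <<s Gf t >>.
Implicit Types (U G L : R -> Omega -> R) (f : Omega -> R).

(** Stated on the type that carries the generated sigma-algebra, so that the closure properties of
    measurable functions apply directly to adapted processes. *)
Definition meas_at t f :=
  measurable_fun [set: g_sigma_algebraType (Gf t)] (f : g_sigma_algebraType (Gf t) -> R).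

Definition adapted_to U := forall t, 0 <= t -> meas_at t (U t).

Lemma meas_atW t f : meas_at t f -> measurable_fun setT f.
Proof. exact: subsigma_measurable_fun. Qed.

Lemma meas_at_mono s t f : s <= t -> meas_at s f -> meas_at t f.
Proof. by move=> st; apply: subsigmaS_measurable_fun; exact: Fmono. Qed.

Lemma adapted_at U s t : adapted_to U -> 0 <= s -> s <= t -> meas_at t (U s).
Proof. by move=> aU s0 st; apply: (meas_at_mono st); exact: aU. Qed.

Lemma adapted_toW U t : adapted_to U -> 0 <= t -> measurable_fun setT (U t).
Proof. by move=> aU t0; apply: (@meas_atW t); exact: aU. Qed.

Lemma meas_at_rsum n G L T : adapted_to G -> adapted_to L -> 0 <= T ->
  meas_at T (fun w => rsum n (G ^~ w) (L ^~ w) T).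
Proof.
move=> aG aL T0; apply: measurable_sum => k.
have h j : 0 <= grid n j T <= T by rewrite grid_ge0// grid_le.
apply: measurable_funM.
  by case/andP: (h k.+1) => h0 h1; exact: (adapted_at aG h0 h1).
apply: measurable_funB.
  by case/andP: (h k.+1) => h0 h1; exact: (adapted_at aL h0 h1).
by case/andP: (h k) => h0 h1; exact: (adapted_at aL h0 h1).
Qed.

Lemma meas_at_cvg t (u : nat -> Omega -> R) f : (forall n, meas_at t (u n)) ->
  (forall w, u n w @[n --> \oo] --> f w) -> meas_at t f.
Proof.
move=> mu uf; apply: (@measurable_fun_cvg _ (g_sigma_algebraType (Gf t)) R setT u) => //.
Qed.

Lemma adapted_sint G L : adapted_to G -> adapted_to L ->
  (forall w, continuous (G ^~ w)) -> (forall s w, 0 <= G s w) ->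
  (forall w, increasing_path (L ^~ w)) ->
  adapted_to (fun t w => sint (G ^~ w) (L ^~ w) t).
Proof.
move=> aG aL cG G0 IL T T0; apply: (@meas_at_cvg _ (fun n w => rsum n (G ^~ w) (L ^~ w) T)).
  by move=> n; exact: meas_at_rsum.
by move=> w; apply: cvg_rsum.
Qed.

Lemma adapted_tint U C : adapted_to U -> (forall w, right_continuous_path (U ^~ w)) ->
  (forall s w, `|U s w| <= C) -> adapted_to (fun t w => tint (U ^~ w) t).
Proof.
move=> aU rU UC T T0.
apply: (@meas_at_cvg _ (fun n w => \sum_(k < gsize n T) U (grid n k.+1 T) w * (grid n k.+1 T - grid n k T))).
  move=> n; apply: measurable_sum => k; apply: measurable_funM => //.
  by apply: (adapted_at aU); [exact: grid_ge0|exact: grid_le].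
by move=> w; exact: (cvg_tint_sum (rU w) (fun s => UC s w)).
Qed.

Lemma adapted_toM G L : adapted_to G -> adapted_to L -> adapted_to (fun t w => G t w * L t w).
Proof. by move=> aG aL t t0; apply: measurable_funM; [exact: aG|exact: aL]. Qed.

Lemma adapted_to_comp (g : R -> R) G : measurable_fun setT g -> adapted_to G ->
  adapted_to (fun t w => g (G t w)).
Proof. by move=> mg aG t t0; apply: (measurableT_comp mg); exact: aG. Qed.

Lemma adapted_to_min L c : adapted_to L -> adapted_to (fun t w => Num.min (L t w) c).
Proof. by move=> aL t t0; apply: measurable_minr => //; exact: aL. Qed.

Lemma adapted_joint_rc U : adapted_to U -> (forall w, right_continuous_path (U ^~ w)) ->
  measurable_fun ([set: Omega] `*` `[(0 : R), +oo[%classic) (fun z : Omega * R => U z.2 z.1).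
Proof. by move=> aU; apply: joint_measurable_rc => t t0; exact: (adapted_toW aU t0). Qed.

Lemma adapted_joint_lc U : adapted_to U -> (forall w, left_continuous_path (U ^~ w)) ->
  measurable_fun ([set: Omega] `*` `[(0 : R), +oo[%classic) (fun z : Omega * R => U z.2 z.1).
Proof. by move=> aU; apply: joint_measurable_lc => t t0; exact: (adapted_toW aU t0). Qed.

End adaptedness.

(** * Expected Stieltjes integrals of a supermartingale in multiplicative form *)

Section potential.
Context {R : realType} {d : measure_display} {Omega : measurableType d}.
Variable P : probability Omega R.
Variable Gf : R -> set (set Omega).
Hypothesis Gm : forall t, Gf t `<=` measurable.
Hypothesis Fmono : forall s t, s <= t -> <<s Gf s >> `<=` <<s Gf t >>.
Local Notation leb := (@lebesgue_measure R).
Local Notation meas_at := (meas_at Gf).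
Local Notation adapted_to := (adapted_to Gf).

Variables (E kap : R -> Omega -> R) (klo khi : R).
Hypothesis E0 : forall t w, 0 < E t w.
Hypothesis cE : forall w, continuous (E ^~ w).
Hypothesis aE : adapted_to E.
Hypothesis martE : forall s t C, 0 <= s -> s <= t -> <<s Gf s >> C ->
  (\int[P]_(w in C) (E t w)%:E = \int[P]_(w in C) (E s w)%:E)%E.
Hypothesis sqE : forall s t C, 0 <= s -> s <= t -> <<s Gf s >> C ->
  (\int[P]_(w in C) (E s w ^+ 2)%:E <= \int[P]_(w in C) (E t w ^+ 2)%:E)%E.
Hypothesis finE : forall t, 0 <= t -> (\int[P]_w (E t w ^+ 2)%:E < +oo)%E.
Hypothesis rkap : forall w, right_continuous_path (kap ^~ w).
Hypothesis akap : adapted_to kap.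
Hypothesis klo0 : 0 < klo.
Hypothesis kapb : forall t w, klo <= kap t w <= khi.

Let E0' t w : 0 <= E t w. Proof. exact: ltW. Qed.
Let kap0 t w : 0 <= kap t w.
Proof. by case/andP: (kapb t w) => + _; apply: le_trans; exact: ltW. Qed.
Let kaphi t w : kap t w <= khi. Proof. by case/andP: (kapb t w). Qed.
Let nkap t w : `|kap t w| <= khi. Proof. by rewrite ger0_norm. Qed.

(** The multiplicative Doob-Meyer form: a positive martingale times a decreasing exponential of rate
    [kap]. The decreasing factor can be integrated by parts path by path, and the martingale needs
    only its defining identity on sets. *)
Definition pot t w := E t w * disc (kap ^~ w) t.
Local Notation Z := pot.
Local Notation B w := (disc (kap ^~ w)).

Lemma adapted_disc : adapted_to (fun t w => B w t).
Proof.
apply: (adapted_to_comp (g := fun x => expR (- x))) => //.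
  by apply: measurableT_comp.
exact: (adapted_tint Fmono akap rkap nkap).
Qed.

Lemma adapted_pot : adapted_to Z.
Proof. by apply: adapted_toM => //; exact: adapted_disc. Qed.

Lemma continuous_pot w : continuous (Z ^~ w).
Proof.
move=> t; apply: cvgM; first exact: cE.
exact: (continuous_disc (@rkap w) (fun s => kap0 s w) (fun s => kaphi s w)).
Qed.

Lemma pot_gt0 t w : 0 < Z t w. Proof. by rewrite mulr_gt0// disc_gt0. Qed.

Lemma pot_ge0 t w : 0 <= Z t w. Proof. exact: ltW (pot_gt0 _ _). Qed.

Lemma mart_fun s t (G : Omega -> R) : 0 <= s -> s <= t -> meas_at s G -> (forall w, 0 <= G w) ->
  (\int[P]_w (E t w * G w)%:E = \int[P]_w (E s w * G w)%:E)%E.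
Proof.
move=> s0 st mG G0; have t0 := le_trans s0 st.
under eq_integral do rewrite EFinM.
under [RHS]eq_integral do rewrite EFinM.
apply: (@ge0_integral_weight _ _ _ P P (Gf s)) => //.
- exact: (adapted_toW Gm aE).
- exact: (adapted_toW Gm aE).
- by move=> C; exact: martE.
- exact/measurable_EFinP.
Qed.

Lemma sq_fun s t (G : Omega -> R) : 0 <= s -> s <= t -> meas_at s G -> (forall w, 0 <= G w) ->
  (\int[P]_w (E s w ^+ 2 * G w)%:E <= \int[P]_w (E t w ^+ 2 * G w)%:E)%E.
Proof.
move=> s0 st mG G0; have t0 := le_trans s0 st.
under eq_integral do rewrite EFinM.
under [leRHS]eq_integral do rewrite EFinM.
apply: (@ge0_integral_weight_le _ _ _ P P (Gf s)) => //.
- by apply: measurable_funX; exact: (adapted_toW Gm aE).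
- by apply: measurable_funX; exact: (adapted_toW Gm aE).
- by move=> w; exact: sqr_ge0.
- by move=> w; exact: sqr_ge0.
- by move=> C; exact: sqE.
- exact/measurable_EFinP.
Qed.

Section fixed_horizon.
Variables (T : R).
Hypothesis T0 : 0 <= T.

Let gT n j : 0 <= grid n j T. Proof. exact: grid_ge0. Qed.

(** In each term the discount factor and the increment of [L] are known at the right end of the
    cell, so the martingale can be moved from there to [T] under the expectation. *)
Lemma integral_rsum_pot n (L : R -> Omega -> R) : adapted_to L ->
  (forall w, increasing_path (L ^~ w)) ->
  (\int[P]_w (rsum n (Z ^~ w) (L ^~ w) T)%:E =
   \int[P]_w (E T w * rsum n (B w) (L ^~ w) T)%:E)%E.
Proof.
move=> aL IL.
have mL j : measurable_fun setT (L (grid n j T)) by exact: (adapted_toW Gm aL).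
have mB j : measurable_fun setT (fun w => B w (grid n j T)) by exact: (adapted_toW Gm adapted_disc).
have mE j : 0 <= j -> measurable_fun setT (E j) by exact: (adapted_toW Gm aE).
have dL k w : 0 <= L (grid n k.+1 T) w - L (grid n k T) w.
  by rewrite subr_ge0 (ip_le (IL w))// le_grid.
under eq_integral do rewrite /rsum -sumEFin.
under [RHS]eq_integral do rewrite /rsum mulr_sumr -sumEFin.
rewrite !ge0_integral_sum//.
- apply: eq_bigr => k _.
  have := @mart_fun (grid n k.+1 T) T
    (fun w => B w (grid n k.+1 T) * (L (grid n k.+1 T) w - L (grid n k T) w)) (gT _ _) (grid_le _ _ _).
  move=> ->.
  + by apply: eq_integral => w _; rewrite /pot mulrA.
  + apply: measurable_funM; first exact: adapted_disc.
    apply: measurable_funB; first exact: aL.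
    by apply: (adapted_at Fmono aL) => //; exact: le_grid.
  + by move=> w; rewrite mulr_ge0// ltW// disc_gt0.
- move=> k; apply/measurable_EFinP; apply: measurable_funM; first exact: mE.
  by apply: measurable_funM => //; exact: measurable_funB.
- by move=> k w _; rewrite lee_fin mulr_ge0// mulr_ge0// ltW// disc_gt0.
- move=> k; apply/measurable_EFinP; apply: measurable_funM; last exact: measurable_funB.
  exact: (adapted_toW Gm adapted_pot).
- by move=> k w _; rewrite lee_fin mulr_ge0// pot_ge0.
Qed.

Let cB w : continuous (B w).
Proof. exact: (continuous_disc (@rkap w) (fun s => kap0 s w) (fun s => kaphi s w)). Qed.
Let B0 w t : 0 <= B w t. Proof. exact/ltW/disc_gt0. Qed.
Let ncB w s t : 0 <= s -> s <= t -> B w t <= B w s.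
Proof. exact: (le_disc (@rkap w) (fun s => kap0 s w) (fun s => kaphi s w)). Qed.

(* the integral of [E_T B] against [dL], the limit of the expectations of
   the upper sums in [integral_rsum_pot] *)
Lemma integral_pot_parts (L : R -> Omega -> R) : adapted_to L ->
  (forall w, increasing_path (L ^~ w)) ->
  (\int[P]_w (E T w * sint (B w) (L ^~ w) T)%:E =
   \int[P]_w (Z T w * L T w)%:E +
   \int[P]_w \int[leb]_(s in `[0%R, T[) (kap s w * Z s w * L s w)%:E)%E.
Proof.
move=> aL IL.
have pt w : ((E T w * sint (B w) (L ^~ w) T)%:E = (Z T w * L T w)%:E +
    \int[leb]_(s in `[0%R, T[) (E T w * (kap s w * B w s * L s w))%:E)%E.
  rewrite EFinM (sint_disc (@rkap w) (fun s => kap0 s w) (fun s => kaphi s w) (IL w) T0).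
  rewrite ge0_muleDr; last 2 first.
  - by rewrite lee_fin mulr_ge0// (ip_ge0 (IL w)).
  - apply: integral_ge0 => s; rewrite /= in_itv/= => /andP[s0 _].
    by rewrite lee_fin !mulr_ge0// (ip_ge0 (IL w)).
  congr (_ + _)%E; first by rewrite -EFinM mulrA.
  rewrite -ge0_integralZl//=.
  - by apply: eq_integral => s _; rewrite -EFinM; congr EFin; ring.
  - apply/measurable_EFinP; apply: measurable_funM; last exact: (@measurable_rc R (kap ^~ w) T (@rkap w)).
    apply: measurable_funM; first exact: measurable_continuous.
    exact: measurable_increasing_path.
  - move=> s; rewrite in_itv/= => /andP[s0 _].
    by rewrite lee_fin !mulr_ge0// (ip_ge0 (IL w)).
  - by rewrite lee_fin.
under eq_integral do rewrite pt.
have mBs : measurable_fun ([set: Omega] `*` `[(0 : R), T[%classic) (fun z : Omega * R => B z.1 z.2).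
  apply: joint_measurable_sub.
  exact: (@adapted_joint_lc _ _ _ Gf Gm (fun t w => B w t) adapted_disc (fun w => continuous_left_path (@cB w))).
have mks : measurable_fun ([set: Omega] `*` `[(0 : R), T[%classic) (fun z : Omega * R => kap z.2 z.1).
  by apply: joint_measurable_sub; exact: (adapted_joint_rc Gm akap (@rkap)).
have mLs : measurable_fun ([set: Omega] `*` `[(0 : R), T[%classic) (fun z : Omega * R => L z.2 z.1).
  by apply: joint_measurable_sub; exact: (adapted_joint_lc Gm aL (fun w => ip_lc (IL w))).
have mEs : measurable_fun ([set: Omega] `*` `[(0 : R), T[%classic) (fun z : Omega * R => E z.2 z.1).
  by apply: joint_measurable_sub; exact: (adapted_joint_lc Gm aE (fun w => continuous_left_path (@cE w))).
have mT : measurable (`[(0 : R), T[%classic : set R) by exact: measurable_itv.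
pose f1 (z : Omega * R) := (E T z.1 * (kap z.2 z.1 * B z.1 z.2 * L z.2 z.1))%:E.
pose f2 (z : Omega * R) := (kap z.2 z.1 * Z z.2 z.1 * L z.2 z.1)%:E.
have mf1 : measurable_fun ([set: Omega] `*` `[(0 : R), T[%classic) f1.
  apply/measurable_EFinP; apply: measurable_funM.
    apply: (@measurableT_comp _ _ _ _ _ _ (E T) _ fst) => //.
      exact: (adapted_toW Gm aE).
    exact: measurable_funTS.
  by apply: measurable_funM => //; exact: measurable_funM.
have mf2 : measurable_fun ([set: Omega] `*` `[(0 : R), T[%classic) f2.
  apply/measurable_EFinP; do !apply: measurable_funM => //.
have f10 (z : Omega * R) : `[(0 : R), T[%classic z.2 -> (0 <= f1 z)%E.
  by rewrite /= in_itv/= => /andP[s0 _]; rewrite lee_fin !mulr_ge0// (ip_ge0 (IL z.1)).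
have f20 (z : Omega * R) : `[(0 : R), T[%classic z.2 -> (0 <= f2 z)%E.
  by rewrite /= in_itv/= => /andP[s0 _]; rewrite lee_fin !mulr_ge0// ?pot_ge0// (ip_ge0 (IL z.1)).
have mI : measurable_fun setT (fun w => \int[leb]_(s in `[0%R, T[) f1 (w, s))%E.
  exact (measurable_tonelli mT mf1 f10).
have I0 w : (0 <= \int[leb]_(s in `[0%R, T[) f1 (w, s))%E.
  by apply: integral_ge0 => s sT; exact: (f10 (w, s)).
rewrite (@ge0_integralD _ _ _ P setT measurableT (fun w => (Z T w * L T w)%:E) _ _ _ (fun w _ => I0 w) mI); last 2 first.
- by move=> w _; rewrite lee_fin mulr_ge0// ?pot_ge0// (ip_ge0 (IL w)).
- apply/measurable_EFinP; apply: measurable_funM; [exact: (adapted_toW Gm adapted_pot)|exact: (adapted_toW Gm aL)].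
congr (_ + _)%E.
(* The interchange of integrals fixes [s], and the martingale property then turns [E T] back into
   [E s], that is, restores the factor [Z s]. *)
transitivity (\int[leb]_(s in `[0%R, T[) \int[P]_w f1 (w, s))%E.
  by rewrite (tonelli_right P mT mf1 f10) -(tonelli_left P mT mf1 f10).
transitivity (\int[leb]_(s in `[0%R, T[) \int[P]_w f2 (w, s))%E; last first.
  by rewrite (tonelli_right P mT mf2 f20) -(tonelli_left P mT mf2 f20).
apply: eq_integral => s; rewrite inE/= in_itv/= => /andP[s0 sT].
rewrite /f1 /= (@mart_fun s T) ?(ltW sT)//.
- by apply: eq_integral => w _; rewrite /f2 /pot/=; congr EFin; ring.
- apply: measurable_funM; last exact: aL.
  by apply: measurable_funM; [exact: akap|exact: adapted_disc].
- by move=> w; rewrite !mulr_ge0// (ip_ge0 (IL w)).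
Qed.

Lemma eq_sint_path (G f g : R -> R) : increasing_path f -> increasing_path g ->
  continuous G -> (forall s, 0 <= G s) -> (forall s, 0 <= s <= T -> f s = g s) ->
  sint G f T = sint G g T.
Proof.
move=> If Ig cG G0 fg; have cf := cvg_rsum If T0 cG G0.
have cg := cvg_rsum Ig T0 cG G0.
rewrite -(cvg_lim (@Rhausdorff R) cf) -(cvg_lim (@Rhausdorff R) cg).
have -> : (fun n => rsum n G f T) = (fun n => rsum n G g T) by apply/funext => n; exact: eq_rsum.
by [].
Qed.

Lemma rsum_ge0 n (G L : R -> R) : increasing_path L -> (forall s, 0 <= G s) -> 0 <= rsum n G L T.
Proof.
move=> IL G0; apply: sumr_ge0 => k _; rewrite mulr_ge0// subr_ge0.
by apply: (ip_le IL) => //; exact: le_grid.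
Qed.

Lemma rsum_const_le n (G L : R -> R) c : increasing_path L -> (forall s, G s <= c) ->
  rsum n G L T <= c * L T.
Proof.
move=> IL Gc; apply: (@le_trans _ _ (rsum n (cst c) L T)).
  apply: ler_sum => k _; rewrite ler_wpM2r// subr_ge0.
  by apply: (ip_le IL) => //; exact: le_grid.
rewrite /rsum -mulr_sumr.
have -> : \sum_(i < gsize n T) (L (grid n i.+1 T) - L (grid n i T)) = L T - L 0; last by rewrite (ip0 IL) subr0.
rewrite -(big_mkord xpredT (fun i => L (grid n i.+1 T) - L (grid n i T))) telescope_sumr//.
by rewrite grid0 ?grid_size.
Qed.

(** Fatou's lemma along the right-endpoint sums; for the nonincreasing [B] such a sum lies below the
    integral. *)
Lemma integral_sint_pot_le (L : R -> Omega -> R) : adapted_to L ->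
  (forall w, increasing_path (L ^~ w)) ->
  (\int[P]_w (sint (Z ^~ w) (L ^~ w) T)%:E <=
   \int[P]_w (E T w * sint (B w) (L ^~ w) T)%:E)%E.
Proof.
move=> aL IL.
apply: (@fatou_le _ _ _ P _ measurableT (fun n w => (rsum n (Z ^~ w) (L ^~ w) T)%:E)).
- move=> n; apply/measurable_EFinP; apply: (meas_atW Gm).
  exact: (@meas_at_rsum _ _ _ Gf Fmono n Z L T adapted_pot aL T0).
- by move=> n w _; rewrite lee_fin rsum_ge0// => k; exact: pot_ge0.
- move=> w _; apply: cvg_EFin; first exact: nearW.
  by apply: (cvg_rsum (IL w) T0) => [|s]; [exact: continuous_pot|exact: pot_ge0].
- move=> n; rewrite (integral_rsum_pot n aL IL); apply: ge0_le_integral => //.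
  + by move=> w _; rewrite lee_fin mulr_ge0// rsum_ge0.
  + apply/measurable_EFinP; apply: measurable_funM; first exact: (adapted_toW Gm aE).
    apply: (meas_atW Gm).
    exact: (@meas_at_rsum _ _ _ Gf Fmono n (fun t w => B w t) L T adapted_disc aL T0).
  + apply/measurable_EFinP; apply: measurable_funM; first exact: (adapted_toW Gm aE).
    apply: (adapted_toW (U := fun t w => sint (B w) (L ^~ w) t) Gm) => //.
    exact: (@adapted_sint _ _ _ Gf Fmono (fun t w => B w t) L adapted_disc aL cB (fun s w => B0 w s) IL).
  + by move=> w _; rewrite lee_fin ler_wpM2l// (rsum_le_sint n (IL w) T0 (@cB w) (B0 w) (@ncB w)).
Qed.

(** The squared martingale is a submartingale, so every term is bounded by its value at [T], and the
    increments then telescope to at most [c]. The bound does not depend on [n] and takes the place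
    of uniform integrability. *)
Lemma rsum_pot_square n (L : R -> Omega -> R) c : 0 <= c -> adapted_to L ->
  (forall w, increasing_path (L ^~ w)) -> (forall t w, L t w <= c) ->
  (\int[P]_w (rsum n (fun s => Z s w ^+ 2) (L ^~ w) T)%:E <= c%:E * \int[P]_w (E T w ^+ 2)%:E)%E.
Proof.
move=> c0 aL IL Lc.
have mL j : measurable_fun setT (L (grid n j T)) by exact: (adapted_toW Gm aL).
have dL k w : 0 <= L (grid n k.+1 T) w - L (grid n k T) w.
  by rewrite subr_ge0 (ip_le (IL w))// le_grid.
have mdL k : measurable_fun setT (fun w => L (grid n k.+1 T) w - L (grid n k T) w).
  exact: measurable_funB.
have mE j : 0 <= j -> measurable_fun setT (fun w => E j w ^+ 2).
  by move=> j0; apply: measurable_funX; exact: (adapted_toW Gm aE).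
have B1 w s : 0 <= s -> Z s w ^+ 2 <= E s w ^+ 2.
  move=> s0; rewrite ler_sqr ?nnegrE ?pot_ge0// /pot ler_piMr//.
  exact: (disc_le1 (@rkap w) (fun s => kap0 s w) (fun s => kaphi s w)).
apply: (@le_trans _ _ (\int[P]_w (\sum_(k < gsize n T) (E T w ^+ 2 * (L (grid n k.+1 T) w - L (grid n k T) w))%:E))%E).
  rewrite (eq_integral (fun w => \sum_(k < gsize n T) (Z (grid n k.+1 T) w ^+ 2 * (L (grid n k.+1 T) w - L (grid n k T) w))%:E)%E); last first.
    by move=> w _; rewrite /rsum -sumEFin.
  rewrite !ge0_integral_sum//.
  - apply: lee_sum => k _.
    apply: (@le_trans _ _ (\int[P]_w (E (grid n k.+1 T) w ^+ 2 * (L (grid n k.+1 T) w - L (grid n k T) w))%:E)%E).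
      apply: ge0_le_integral => //.
      - by move=> w _; rewrite lee_fin mulr_ge0// sqr_ge0.
      - apply/measurable_EFinP; apply: measurable_funM => //; apply: measurable_funX.
        exact: (adapted_toW Gm adapted_pot).
      - by apply/measurable_EFinP; apply: measurable_funM => //; exact: mE.
      - by move=> w _; rewrite lee_fin ler_wpM2r// B1.
    apply: sq_fun => //; first exact: grid_le.
    apply: measurable_funB; first exact: aL.
    by apply: (adapted_at Fmono aL) => //; exact: le_grid.
  - by move=> k; apply/measurable_EFinP; apply: measurable_funM => //; exact: mE.
  - by move=> k w _; rewrite lee_fin mulr_ge0// sqr_ge0.
  - move=> k; apply/measurable_EFinP; apply: measurable_funM => //; apply: measurable_funX.
    exact: (adapted_toW Gm adapted_pot).
  - by move=> k w _; rewrite lee_fin mulr_ge0// sqr_ge0.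
rewrite -ge0_integralZl//=; last 2 first.
- by apply/measurable_EFinP; exact: mE.
- by move=> w _; rewrite lee_fin sqr_ge0.
- apply: ge0_le_integral => //.
  + by move=> w _; apply: sume_ge0 => k _; rewrite lee_fin mulr_ge0// sqr_ge0.
  + apply: emeasurable_sum => k; apply/measurable_EFinP; apply: measurable_funM => //.
    exact: mE.
  + by apply/measurable_EFinP; apply: measurable_funM => //; exact: mE.
  + move=> w _; rewrite sumEFin lee_fin.
    apply: le_trans (_ : E T w ^+ 2 * L T w <= _); last by rewrite mulrC ler_wpM2r// sqr_ge0.
    exact: (rsum_const_le n (IL w) (fun=> lexx (E T w ^+ 2))).
Qed.

(** [Z] is at most [min Z K + Z^2 / K]. The sums of the truncated process converge boundedly, those
    of [Z^2 / K] cost at most [M / K] by [rsum_pot_square], and [K] is arbitrary. *)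
Lemma integral_sint_pot_ge_bounded (L : R -> Omega -> R) c : 0 <= c -> adapted_to L ->
  (forall w, increasing_path (L ^~ w)) -> (forall t w, L t w <= c) ->
  (\int[P]_w (E T w * sint (B w) (L ^~ w) T)%:E <=
   \int[P]_w (sint (Z ^~ w) (L ^~ w) T)%:E)%E.
Proof.
move=> c0 aL IL Lc.
pose ZK (K : R) t w := Num.min (Z t w) K.
have ZK0 K t w : 0 <= K -> 0 <= ZK K t w by move=> K0; rewrite /ZK le_min pot_ge0.
have aZK K : adapted_to (ZK K) by apply: adapted_to_min; exact: adapted_pot.
have cZK K w : continuous (ZK K ^~ w).
  by move=> t; apply: (@continuous_min _ _ (Z ^~ w) (cst K)); [exact: continuous_pot|exact: cst_continuous].
have msZK K : 0 <= K -> measurable_fun setT (fun w => (sint (ZK K ^~ w) (L ^~ w) T)%:E).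
  move=> K0; apply/measurable_EFinP.
  apply: (adapted_toW (U := fun t w => sint (ZK K ^~ w) (L ^~ w) t) Gm) => //.
  exact: (@adapted_sint _ _ _ Gf Fmono (ZK K) L (aZK K) aL (@cZK K) (fun s w => ZK0 K s w K0) IL).
have msZ : measurable_fun setT (fun w => (sint (Z ^~ w) (L ^~ w) T)%:E).
  apply/measurable_EFinP.
  apply: (adapted_toW (U := fun t w => sint (Z ^~ w) (L ^~ w) t) Gm) => //.
  exact: (@adapted_sint _ _ _ Gf Fmono Z L adapted_pot aL continuous_pot pot_ge0 IL).
have sE w K : 0 <= K -> sint (ZK K ^~ w) (L ^~ w) T <= sint (Z ^~ w) (L ^~ w) T.
  move=> K0.
  have := cvg_rsum (IL w) T0 (@continuous_pot w) (fun s => pot_ge0 s w).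
  have := cvg_rsum (IL w) T0 (@cZK K w) (fun s => ZK0 K s w K0).
  move=> u1 u2; rewrite -(cvg_lim _ u1)// -(cvg_lim _ u2)//.
  apply: ler_lim; [by apply/cvg_ex; eexists; exact: u1|by apply/cvg_ex; eexists; exact: u2|].
  apply: nearW => n; apply: ler_sum => k _; rewrite ler_wpM2r//.
    by rewrite subr_ge0 (ip_le (IL w))// le_grid.
  by rewrite /ZK ge_min lexx.
set M := (c%:E * \int[P]_w (E T w ^+ 2)%:E)%E.
have M0 : (0 <= M)%E by rewrite mule_ge0// integral_ge0// => w _; rewrite lee_fin sqr_ge0.
have Mfin : M \is a fin_num.
  by rewrite ge0_fin_numE// lte_mul_pinfty// ?finE// lee_fin.
have cvgK K : 0 < K -> (\int[P]_w (rsum n (ZK K ^~ w) (L ^~ w) T)%:E @[n --> \oo] -->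
    \int[P]_w (sint (ZK K ^~ w) (L ^~ w) T)%:E)%E.
  move=> K0; have K0' := ltW K0.
  apply: (@dominated_cvg _ _ _ _ _ _ _ _ (cst (K * c)%:E)) => //.
  - move=> n; apply/measurable_EFinP; apply: (meas_atW Gm).
    exact: (@meas_at_rsum _ _ _ Gf Fmono n (ZK K) L T (aZK K) aL T0).
  - move=> w _; apply: cvg_EFin; first exact: nearW.
    exact: (cvg_rsum (IL w) T0 (@cZK K w) (fun s => ZK0 K s w K0')).
  - by apply: finite_measure_integrable_cst.
  - move=> n w _; rewrite lee_fin ger0_norm; last by apply: rsum_ge0 => // s; exact: ZK0.
    apply: le_trans (_ : K * L T w <= _); last by rewrite ler_wpM2l.
    by apply: rsum_const_le => // s; rewrite /ZK ge_min lexx orbT.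
have key K : 0 < K -> (\int[P]_w (E T w * sint (B w) (L ^~ w) T)%:E <=
   \int[P]_w (sint (Z ^~ w) (L ^~ w) T)%:E + K^-1%:E * M)%E.
  move=> K0; have K0' := ltW K0.
  apply: (@le_trans _ _ (\int[P]_w (sint (ZK K ^~ w) (L ^~ w) T)%:E + K^-1%:E * M)%E); last first.
    rewrite leeD2r//; apply: ge0_le_integral => //.
    - move=> w _; rewrite lee_fin.
      exact: (ip_ge0 (increasing_path_sint (IL w) (@cZK K w) (fun s => ZK0 K s w K0')) T0).
    - exact: msZK.
    - by move=> w _; rewrite lee_fin sE.
  apply: (@fatou_cvg_le _ _ _ P _ measurableT (fun n w => (E T w * rsum n (B w) (L ^~ w) T)%:E) _
     (fun n => \int[P]_w (rsum n (ZK K ^~ w) (L ^~ w) T)%:E + K^-1%:E * M)%E).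
  - move=> n; apply/measurable_EFinP; apply: measurable_funM; first exact: (adapted_toW Gm aE).
    apply: (meas_atW Gm).
    exact: (@meas_at_rsum _ _ _ Gf Fmono n (fun t w => B w t) L T adapted_disc aL T0).
  - by move=> n w _; rewrite lee_fin mulr_ge0// rsum_ge0.
  - move=> w _; apply: cvg_EFin; first exact: nearW.
    by apply: cvgM; [exact: cvg_cst|exact: (cvg_rsum (IL w) T0 (@cB w) (B0 w))].
  - move=> n; rewrite -(integral_rsum_pot n aL IL).
    apply: (@le_trans _ _ (\int[P]_w ((rsum n (ZK K ^~ w) (L ^~ w) T)%:E +
        K^-1%:E * (rsum n (fun s => Z s w ^+ 2) (L ^~ w) T)%:E))%E).
      apply: ge0_le_integral => //.
      - by move=> w _; rewrite lee_fin rsum_ge0// => s; exact: pot_ge0.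
      - apply/measurable_EFinP; apply: (meas_atW Gm).
        exact: (@meas_at_rsum _ _ _ Gf Fmono n Z L T adapted_pot aL T0).
      - apply: emeasurable_funD.
          apply/measurable_EFinP; apply: (meas_atW Gm).
          exact: (@meas_at_rsum _ _ _ Gf Fmono n (ZK K) L T (aZK K) aL T0).
        apply: measurable_funeM; apply/measurable_EFinP; apply: (meas_atW Gm).
        apply: (@meas_at_rsum _ _ _ Gf Fmono n (fun s w => Z s w ^+ 2) L T _ aL T0).
        by move=> s s0; apply: measurable_funX; exact: adapted_pot.
      - move=> w _; rewrite -EFinM -EFinD lee_fin /rsum mulr_sumr -big_split/=.
        apply: ler_sum => k _; rewrite mulrA -mulrDl ler_wpM2r//.
          by rewrite subr_ge0 (ip_le (IL w))// le_grid.
        rewrite /ZK; case: (leP (Z (grid n k.+1 T) w) K) => ZKl.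
          by rewrite lerDl mulr_ge0 ?invr_ge0// sqr_ge0.
        apply: le_trans (_ : K^-1 * Z (grid n k.+1 T) w ^+ 2 <= _); last by rewrite lerDr.
        by rewrite mulrC ler_pdivlMr// expr2 ler_wpM2l ?pot_ge0// ltW.
    rewrite ge0_integralD//; last 4 first.
    - by move=> w _; rewrite lee_fin rsum_ge0// => s; exact: ZK0.
    - apply/measurable_EFinP; apply: (meas_atW Gm).
      exact: (@meas_at_rsum _ _ _ Gf Fmono n (ZK K) L T (aZK K) aL T0).
    - by move=> w _; rewrite mule_ge0// ?lee_fin ?invr_ge0// rsum_ge0// => s; exact: sqr_ge0.
    - apply: measurable_funeM; apply/measurable_EFinP; apply: (meas_atW Gm).
      apply: (@meas_at_rsum _ _ _ Gf Fmono n (fun s w => Z s w ^+ 2) L T _ aL T0).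
      by move=> s s0; apply: measurable_funX; exact: adapted_pot.
    rewrite leeD2l// ge0_integralZl//=; last 3 first.
    - apply/measurable_EFinP; apply: (meas_atW Gm).
      apply: (@meas_at_rsum _ _ _ Gf Fmono n (fun s w => Z s w ^+ 2) L T _ aL T0).
      by move=> s s0; apply: measurable_funX; exact: adapted_pot.
    - by move=> w _; rewrite lee_fin rsum_ge0// => s; exact: sqr_ge0.
    - by rewrite lee_fin invr_ge0.
    by apply: lee_wpmul2l; [rewrite lee_fin invr_ge0|exact: rsum_pot_square].
  - apply: cvgeD; [|exact: cvgK|exact: cvg_cst].
    by apply: fin_num_adde_defl; rewrite fin_numM.
apply/lee_addgt0Pr => e e0.
have [m m0 Mm] : exists2 m, 0 <= m & M = m%:E by exists (fine M); rewrite ?fine_ge0// fineK.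
(* With this value of [K] the error [M / K] is at most [e]; the added 1 keeps [K] positive when [M]
   vanishes. *)
apply: le_trans (key ((m + 1) / e) _) _; first by rewrite divr_gt0// ltr_wpDl.
rewrite leeD2l// Mm -EFinM lee_fin invf_div mulrAC ler_pdivrMr ?ltr_wpDl//.
by apply: ler_wpM2l; [exact: ltW|rewrite lerDl].
Qed.

Lemma measurable_sint_pot (L : R -> Omega -> R) : adapted_to L ->
  (forall w, increasing_path (L ^~ w)) ->
  measurable_fun setT (fun w => (sint (Z ^~ w) (L ^~ w) T)%:E).
Proof.
move=> aL IL; apply/measurable_EFinP.
apply: (adapted_toW (U := fun t w => sint (Z ^~ w) (L ^~ w) t) Gm) => //.
exact: (@adapted_sint _ _ _ Gf Fmono Z L adapted_pot aL continuous_pot pot_ge0 IL).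
Qed.

(** The lower bound for unbounded [L] comes from the capped processes [min L m]: on each path they
    agree with [L] up to [T] once [m] exceeds [L T], so Fatou's lemma applies. *)
Lemma integral_sint_pot (L : R -> Omega -> R) : adapted_to L ->
  (forall w, increasing_path (L ^~ w)) ->
  (\int[P]_w (sint (Z ^~ w) (L ^~ w) T)%:E =
   \int[P]_w (Z T w * L T w)%:E +
   \int[P]_w \int[leb]_(s in `[0%R, T[) (kap s w * Z s w * L s w)%:E)%E.
Proof.
move=> aL IL; rewrite -(integral_pot_parts aL IL).
apply/eqP; rewrite eq_le integral_sint_pot_le//=.
pose Lc (m : nat) t w := Num.min (L t w) m%:R.
have aLc m : adapted_to (Lc m) by apply: adapted_to_min.
have ILc m w : increasing_path (Lc m ^~ w) by exact: increasing_path_min.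
apply: (@fatou_le _ _ _ P _ measurableT (fun m w => (E T w * sint (B w) (Lc m ^~ w) T)%:E)).
- move=> m; apply/measurable_EFinP; apply: measurable_funM; first exact: (adapted_toW Gm aE).
  apply: (adapted_toW (U := fun t w => sint (B w) (Lc m ^~ w) t) Gm) => //.
  exact: (@adapted_sint _ _ _ Gf Fmono (fun t w => B w t) (Lc m) adapted_disc (aLc m) cB (fun s w => B0 w s) (ILc m)).
- move=> m w _; rewrite lee_fin mulr_ge0//.
  exact: (ip_ge0 (increasing_path_sint (ILc m w) (@cB w) (B0 w)) T0).
- move=> w _; have [m0 Lm0] : exists m0 : nat, L T w <= m0%:R.
    by exists (Num.truncn (L T w)).+1; rewrite ltW// truncnS_gt.
  have e m : (m0 <= m)%N -> sint (B w) (Lc m ^~ w) T = sint (B w) (L ^~ w) T.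
    move=> m0m; apply: (eq_sint_path (ILc m w) (IL w) (@cB w) (B0 w)) => s /andP[s0 sT].
    by rewrite /Lc min_l// (le_trans (ip_le (IL w) s0 sT))// (le_trans Lm0)// ler_nat.
  apply: cvg_near_cst; exists m0; first by [].
  by move=> m /= m0m; rewrite (e m m0m).
- move=> m.
  have Lcm t w : Lc m t w <= m%:R by rewrite /Lc ge_min lexx orbT.
  apply: (le_trans (integral_sint_pot_ge_bounded (ler0n R m) (aLc m) (ILc m) Lcm)).
  apply: ge0_le_integral; first exact: measurableT.
  + move=> w _; rewrite lee_fin.
    exact: (ip_ge0 (increasing_path_sint (ILc m w) (@continuous_pot w) (fun s => pot_ge0 s w)) T0).
  + exact: measurable_sint_pot.
  + exact: measurable_sint_pot.
  + move=> w _; rewrite lee_fin.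
    have u1 := cvg_rsum (IL w) T0 (@continuous_pot w) (fun s => pot_ge0 s w).
    have u2 := cvg_rsum (ILc m w) T0 (@continuous_pot w) (fun s => pot_ge0 s w).
    rewrite -(cvg_lim _ u1)// -(cvg_lim _ u2)//.
    apply: ler_lim; [by apply/cvg_ex; eexists; exact: u2|by apply/cvg_ex; eexists; exact: u1|].
    by apply: nearW => n; apply: rsum_min => // s; exact: pot_ge0.
Qed.

End fixed_horizon.

Lemma joint_pot_rate (L : R -> Omega -> R) : adapted_to L ->
  (forall w, increasing_path (L ^~ w)) ->
  measurable_fun ([set: Omega] `*` `[(0 : R), +oo[%classic)
    (fun z : Omega * R => (kap z.2 z.1 * Z z.2 z.1 * L z.2 z.1)%:E).
Proof.
move=> aL IL; apply/measurable_EFinP; apply: measurable_funM; last first.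
  exact: (adapted_joint_lc Gm aL (fun w => ip_lc (IL w))).
apply: measurable_funM; first exact: (adapted_joint_rc Gm akap (@rkap)).
exact: (adapted_joint_lc Gm adapted_pot (fun w => continuous_left_path (@continuous_pot w))).
Qed.

Lemma pot_rate_ge0 (L : R -> Omega -> R) s w : increasing_path (L ^~ w) -> 0 <= s ->
  0 <= kap s w * Z s w * L s w.
Proof. by move=> IL s0; rewrite mulr_ge0 ?(ip_ge0 IL)// mulr_ge0 ?pot_ge0. Qed.

(** Letting the horizon grow, one inequality just drops the boundary term of [integral_sint_pot];
    the other needs that term to be small at arbitrarily late times. *)
Theorem integral_pot_total (L : R -> Omega -> R) : adapted_to L ->
  (forall w, increasing_path (L ^~ w)) ->
  (\int[P]_w \int[stieltjes (L ^~ w)]_(s in `[0%R, +oo[) (Z s w)%:E =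
   \int[P]_w \int[leb]_(s in `[0%R, +oo[) (kap s w * Z s w * L s w)%:E)%E.
Proof.
move=> aL IL.
have mJ := joint_pot_rate aL IL.
pose f (z : Omega * R) := (kap z.2 z.1 * Z z.2 z.1 * L z.2 z.1)%:E.
have f0 (z : Omega * R) : `[(0 : R), +oo[%classic z.2 -> (0 <= f z)%E.
  by rewrite /= in_itv/= andbT => s0; rewrite lee_fin pot_rate_ge0.
have mo : measurable (`[(0 : R), +oo[%classic : set R) by exact: measurable_itv.
have msec w := measurable_section_time w mo mJ.
have I0 w D : D `<=` `[(0 : R), +oo[%classic -> (0 <= \int[leb]_(s in D) f (w, s))%E.
  by move=> DS; apply: integral_ge0 => s Ds; apply: f0; exact: DS.
have Sm (m : R) : `[(0 : R), m[%classic `<=` `[(0 : R), +oo[%classic.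
  by move=> s /=; rewrite !in_itv/= => /andP[->].
set RHS := (X in _ = X).
have mI D : measurable D -> D `<=` `[(0 : R), +oo[%classic ->
    measurable_fun setT (fun w => \int[leb]_(s in D) f (w, s))%E.
  move=> mD DS; apply: measurable_tonelli => //; last by move=> z /DS; exact: f0.
  apply: measurable_funS mJ; first exact: measurableX.
  by move=> [w s] [_ /=] /DS.
have RHSm (m : R) : (\int[P]_w \int[leb]_(s in `[0%R, m[) f (w, s) <= RHS)%E.
  apply: ge0_le_integral; first exact: measurableT.
  - by move=> w _; apply: I0; exact: Sm.
  - exact (mI _ (measurable_itv `[(0 : R), m[) (@Sm m)).
  - exact: (mI _ mo).
  - move=> w _.
    exact: (@ge0_subset_integral _ _ _ leb _ _ (measurable_itv _) mo (fun s => f (w, s)) (msec w) (fun s => f0 (w, s)) (Sm m)).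
have cvgL w : (sint (Z ^~ w) (L ^~ w) m%:R)%:E @[m --> \oo] -->
    (\int[stieltjes (L ^~ w)]_(s in `[0%R, +oo[) (Z s w)%:E)%E.
  by apply: sint_cvg_pinfty => // [|s]; [exact: continuous_pot|exact: pot_ge0].
have Im w T : 0 <= T -> 0 <= sint (Z ^~ w) (L ^~ w) T.
  move=> T0; exact: (ip_ge0 (increasing_path_sint (IL w) (@continuous_pot w) (fun s => pot_ge0 s w)) T0).
apply/eqP; rewrite eq_le; apply/andP; split.
- apply: (@fatou_le _ _ _ P _ measurableT (fun m w => (sint (Z ^~ w) (L ^~ w) m%:R)%:E)) => //.
  + by move=> m; exact: measurable_sint_pot.
  + by move=> m w _; rewrite lee_fin Im.
  + move=> m.
    have [->|RHSfin] := eqVneq RHS +oo%E; first by rewrite leey.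
    apply/lee_addgt0Pr => e e0.
    (* If the boundary term exceeded [e] at all times after [m], the expected rate would exceed
       [klo * e] on a half-line and the right-hand side would be infinite. *)
    have [t mt ate] : exists2 t, m%:R <= t & (\int[P]_w (Z t w * L t w)%:E <= e%:E)%E.
      apply: contrapT => /forall2NP H.
      have : (RHS < +oo)%E by rewrite ltey.
      rewrite ltNge => /negP; apply.
      have -> : RHS = (\int[leb]_(s in `[0%R, +oo[) \int[P]_w f (w, s))%E.
        by rewrite /RHS (tonelli_left P mo mJ f0) -(tonelli_right P mo mJ f0).
      have mG : measurable_fun `[(0 : R), +oo[%classic (fun s => \int[P]_w f (w, s))%E.
        exact: (measurable_tonelli_time P mo mJ f0).
      apply: (@le_trans _ _ (\int[leb]_(s in `[m%:R, +oo[) (klo * e)%:E)%E).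
        by rewrite integral_cst_ray// mulr_gt0.
      have Sm' : `[(m%:R : R), +oo[%classic `<=` `[(0 : R), +oo[%classic.
        by move=> s /=; rewrite !in_itv/= !andbT; exact: le_trans.
      apply: (@le_trans _ _ (\int[leb]_(s in `[m%:R, +oo[) \int[P]_w f (w, s))%E).
        apply: ge0_le_integral => //.
        - by move=> s _; rewrite lee_fin mulr_ge0// ltW.
        - by apply: measurable_funS mG.
        - move=> s /= ; rewrite in_itv/= andbT => ms.
          have s0 : 0 <= s by exact: le_trans ms.
          have [//|/negP] := H s; rewrite -ltNge => /ltW es.
          rewrite EFinM; apply: (@le_trans _ _ (klo%:E * \int[P]_w (Z s w * L s w)%:E)%E).
            by rewrite lee_wpmul2l// lee_fin ltW.
          rewrite -ge0_integralZl//=.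
          + apply: ge0_le_integral => //.
            * move=> w _; rewrite mule_ge0 ?lee_fin ?(ltW klo0)// mulr_ge0 ?pot_ge0//.
              exact: (ip_ge0 (IL w)).
            * apply: measurable_funeM; apply/measurable_EFinP; apply: measurable_funM; [exact: (adapted_toW Gm adapted_pot)|exact: (adapted_toW Gm aL)].
            * apply/measurable_EFinP; apply: measurable_funM; last exact: (adapted_toW Gm aL).
              by apply: measurable_funM; [exact: (adapted_toW Gm akap)|exact: (adapted_toW Gm adapted_pot)].
            * move=> w _; rewrite -EFinM lee_fin mulrA ler_wpM2r ?(ip_ge0 (IL w))//.
              by rewrite ler_wpM2r ?pot_ge0//; case/andP: (kapb s w).
          + apply/measurable_EFinP; apply: measurable_funM; [exact: (adapted_toW Gm adapted_pot)|exact: (adapted_toW Gm aL)].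
          + by move=> w _; rewrite lee_fin mulr_ge0 ?pot_ge0// (ip_ge0 (IL w)).
          + by rewrite lee_fin ltW.
      apply: ge0_subset_integral => //.
      by move=> s; rewrite /= in_itv/= andbT => s0; apply: integral_ge0 => w _; apply: f0; rewrite /= in_itv/= s0.
    have t0 : 0 <= t by exact: le_trans mt.
    apply: (@le_trans _ _ (\int[P]_w (sint (Z ^~ w) (L ^~ w) t)%:E)%E).
      apply: ge0_le_integral => //.
      - by move=> w _; rewrite lee_fin Im.
      - exact: measurable_sint_pot.
      - exact: measurable_sint_pot.
      - move=> w _; rewrite lee_fin.
        exact: (ip_le (increasing_path_sint (IL w) (@continuous_pot w) (fun s => pot_ge0 s w)) _ mt).
    by rewrite integral_sint_pot// addeC; apply: leeD => //; exact: RHSm.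
- apply: (@fatou_le _ _ _ P _ measurableT (fun m w => \int[leb]_(s in `[0%R, m%:R[) f (w, s))%E).
  + by move=> m; exact (mI _ (measurable_itv `[(0 : R), m%:R[) (@Sm m%:R)).
  + by move=> m w _; apply: I0.
  + move=> w _.
    have fw0 s : 0 <= s -> (0 <= f (w, s))%E by move=> s0; apply: f0; rewrite /= in_itv/= s0.
    exact: (@cvg_integral_horizon R leb (fun s => f (w, s)) (msec w) fw0).
  + move=> m.
    apply: (@le_trans _ _ (\int[P]_w (sint (Z ^~ w) (L ^~ w) m%:R)%:E)%E).
      by rewrite integral_sint_pot// leeDr// integral_ge0// => w _; rewrite lee_fin mulr_ge0 ?pot_ge0// (ip_ge0 (IL w)).
    apply: ge0_le_integral => //.
    * by move=> w _; rewrite lee_fin Im.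
    * exact: measurable_sint_pot.
    * apply: (emeasurable_fun_cvg (fun m w => (sint (Z ^~ w) (L ^~ w) m%:R)%:E)).
        by move=> k; exact: measurable_sint_pot.
      by move=> w _; exact: cvgL.
    * move=> w _; rewrite -(cvg_lim _ (cvgL w))//; apply: lime_ge.
        by apply/cvg_ex; eexists; exact: cvgL.
      near=> k; rewrite lee_fin.
      apply: (ip_le (increasing_path_sint (IL w) (@continuous_pot w) (fun s => pot_ge0 s w))) => //.
      by rewrite ler_nat; near: k; exact: nbhs_infty_ge.
Unshelve. all: by end_near. Qed.

End potential.

(** * Minimisation of a convex functional of two increasing processes *)

Section near_minimisers.
Context {R : realType} {T : Type}.
Variables (mid : T -> T -> T) (Psi : T -> \bar R) (J C : R) (phi : T -> R).
Hypothesis phi_itv : forall u, 0 <= phi u <= C.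
Hypothesis Psi_mid : forall u v (a : R), (Psi u <= a%:E)%E -> (Psi v <= a%:E)%E ->
  (Psi (mid u v) <= a%:E)%E.
Hypothesis Psi_ex : forall e, 0 < e -> exists u, (Psi u <= (J + e)%:E)%E.

Let S (e : R) := [set phi u | u in [set u | (Psi u <= (J + e)%:E)%E]].
Let I e := inf (S e).

Let hasS e : 0 < e -> has_inf (S e).
Proof.
move=> /Psi_ex[u Su]; split; first by exists (phi u), u.
by exists 0 => _ /= [v _ <-]; case/andP: (phi_itv v).
Qed.

Let I_le e u : 0 < e -> (Psi u <= (J + e)%:E)%E -> I e <= phi u.
Proof. by move=> e0 Su; apply: ge_inf; [case: (hasS e0)|exists u]. Qed.

Let I_anti e e' : 0 < e -> e <= e' -> I e' <= I e.
Proof.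
move=> e0 ee'; have [S0 _] := hasS e0; apply: lb_le_inf => // _ [u Su <-].
apply: I_le; first exact: lt_le_trans ee'.
by apply: (le_trans Su); rewrite lee_fin lerD2l.
Qed.

(** The infimum [I e] of [phi] over [e]-near-minimisers grows as [e] decreases and stays bounded.
    Each [u j] has [phi] within [4^-j] above the supremum of [I], while a midpoint, again a
    near-minimiser, has [phi] at least that supremum minus [4^-j]; hence the gap [2 * 4^-j]. *)
Lemma near_minimisers : exists u : nat -> T, forall j,
  (Psi (u j) <= (J + (2^-1) ^+ j)%:E)%E /\
  (phi (u j) + phi (u j.+1)) / 2 - phi (mid (u j) (u j.+1)) <= 2 * (4^-1) ^+ j.
Proof.
pose A := [set I e | e in [set e | 0 < e]].
have hA : has_sup A.
  split; first by exists (I 1), 1 => //=.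
  exists C => _ [e /= e0 <-]; have [u Su] := Psi_ex e0.
  by apply: (le_trans (I_le e0 Su)); case/andP: (phi_itv u).
have I_sup e : 0 < e -> I e <= sup A.
  by move=> e0; apply: ub_le_sup; [case: hA|exists e].
have q j : 0 < (4^-1 : R) ^+ j by rewrite exprn_gt0.
have step j : exists u, exists e, [/\ 0 < e, e <= (2^-1) ^+ j, sup A - (4^-1) ^+ j < I e,
    (Psi u <= (J + e)%:E)%E & phi u <= sup A + (4^-1) ^+ j].
  have [_ [e /= e0 <-] eA] := sup_adherent (q j) hA.
  (* Lowering the level to at most [2^-j] can only raise [I], so its closeness to the supremum is
     kept. *)
  pose e' := Num.min e ((2^-1) ^+ j).
  have e'0 : 0 < e' by rewrite lt_min e0 exprn_gt0.
  have Ie' : I e <= I e' by apply: I_anti => //; rewrite ge_min lexx.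
  have [_ [u Su <-] uI] := inf_adherent (q j) (hasS e'0).
  exists u, e'; split => //; first by rewrite ge_min lexx orbT.
    exact: lt_le_trans Ie'.
  by apply: (le_trans (ltW uI)); rewrite lerD2r; exact: I_sup.
have [u Hu] := choice step; exists u => j.
have [e [e0 e2 eI Se pe]] := Hu j; have [e' [e'0 e'2 e'I Se' pe']] := Hu j.+1.
split; first by apply: (le_trans Se); rewrite lee_fin lerD2l.
have p4 : (4^-1 : R) ^+ j.+1 <= (4^-1) ^+ j by rewrite exprS ler_piMl// ?invf_le1 ?ler1n// ltW.
have lb : sup A - (4^-1) ^+ j <= phi (mid (u j) (u j.+1)).
  have [ee'|e'e] := leP e e'.
    apply: le_trans (_ : I e' <= _); first by rewrite (le_trans _ (ltW e'I))// lerB.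
    by apply: I_le => //; apply: Psi_mid => //; apply: (le_trans Se); rewrite lee_fin lerD2l.
  apply: le_trans (ltW eI) _.
  by apply: I_le => //; apply: Psi_mid => //; apply: (le_trans Se'); rewrite lee_fin lerD2l ltW.
lra.
Qed.

End near_minimisers.

Section ae_convergence.
Local Open Scope ereal_scope.
Context {R : realType} {d : measure_display} {T : measurableType d}.
Variables (mu : {measure set T -> \bar R}) (D : set T) (mD : measurable D).

(** Weighting the squared increments by [2^n] leaves integrals of order [2^-n], so the weighted
    series is finite almost everywhere. Since [|u|] is at most [2^-n + 2^n u^2], the increments are
    then absolutely summable. *)
Lemma ae_cvg_of_square_increments (f : nat -> T -> R) (om : T -> R) (C : R) :
  (forall n, measurable_fun D (f n)) -> measurable_fun D om ->
  (forall x, D x -> (0 < om x)%R) ->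
  (forall n, \int[mu]_(x in D) (om x * (f n.+1 x - f n x) ^+ 2)%:E <= (C * (4^-1) ^+ n)%:E) ->
  {ae mu, forall x, D x -> cvgn (f ^~ x)}.
Proof.
move=> mf mom om0 Hf.
pose g n x := (2 ^+ n * (om x * (f n.+1 x - f n x) ^+ 2))%:E.
have g0 n x : D x -> 0 <= g n x.
  by move=> Dx; rewrite lee_fin mulr_ge0// mulr_ge0 ?sqr_ge0// ltW// om0.
have mg0 n : measurable_fun D (fun x => (om x * (f n.+1 x - f n x) ^+ 2)%:E).
  apply/measurable_EFinP; apply: measurable_funM => //.
  by apply: measurable_funX; exact: measurable_funB.
have mg n : measurable_fun D (g n).
  apply/measurable_EFinP; apply: measurable_funM => //.
  by apply/measurable_EFinP; exact: mg0.
have gC n : \int[mu]_(x in D) g n x <= (C * (2^-1) ^+ n)%:E.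
  rewrite /g; under eq_integral do rewrite EFinM.
  rewrite ge0_integralZl//=; last first.
    by move=> x Dx; rewrite lee_fin mulr_ge0 ?sqr_ge0// ltW// om0.
  apply: le_trans (lee_wpmul2l _ (Hf n)) _; first by rewrite lee_fin.
  rewrite -EFinM lee_fin mulrCA -exprMn (_ : 2 * 4^-1 = 2^-1 :> R)%R//.
  by field.
have C0 : (0 <= C)%R.
  rewrite -lee_fin -[C]mulr1 -(expr0 4^-1) (le_trans _ (Hf 0%N))//.
  by apply: integral_ge0 => x Dx; rewrite lee_fin mulr_ge0 ?sqr_ge0// ltW// om0.
have geo n : (\sum_(0 <= k < n) (2^-1 : R) ^+ k <= 2)%R.
  suff -> : (\sum_(0 <= k < n) (2^-1 : R) ^+ k = 2 - 2 * (2^-1) ^+ n)%R.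
    by rewrite gerBl mulr_ge0.
  elim: n => [|n IH]; first by rewrite big_nil expr0 mulr1 subrr.
  by rewrite big_nat_recr//= IH exprS; field.
have sfin : \int[mu]_(x in D) (\sum_(n <oo) g n x) < +oo.
  rewrite integral_nneseries//.
  apply: (@le_lt_trans _ _ (C * 2)%:E); last by rewrite ltry.
  apply: lime_le; first by apply: is_cvg_nneseries => n _ _; apply: integral_ge0 => x; exact: g0.
  apply: nearW => n; apply: (@le_trans _ _ (\sum_(0 <= k < n) (C * (2^-1) ^+ k)%:E)).
    by apply: lee_sum => k _; exact: gC.
  by rewrite sumEFin lee_fin -mulr_sumr ler_wpM2l.
have [N [mN N0 sub]] : {ae mu, forall x, D x -> (\sum_(n <oo) g n x) \is a fin_num}.
  apply: integrable_ae => //; apply/integrableP; split.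
    by apply: ge0_emeasurable_sum => // k x Dx _; exact: g0.
  apply: le_lt_trans sfin; rewrite le_eqVlt; apply/orP; left; apply/eqP.
  apply: eq_integral => x; rewrite inE => Dx; rewrite gee0_abs//.
  by apply: nneseries_ge0 => n _ _; exact: g0.
exists N; split => // x /= Hx; apply: sub => /= H; apply: Hx => Dx.
have {}H := H Dx.
pose u n := (f n.+1 x - f n x)%R.
have uM n : (\sum_(0 <= k < n) 2 ^+ k * u k ^+ 2 <= fine (\sum_(n <oo) g n x) / om x)%R.
  rewrite ler_pdivlMr ?om0// -lee_fin fineK// mulr_suml -sumEFin.
  apply: (@le_trans _ _ (\sum_(0 <= k < n) g k x)).
    by apply: lee_sum => k _; rewrite lee_fin /u; rewrite mulrAC -mulrA.
  by apply: nneseries_lim_ge => k *; exact: (g0 k x Dx).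
have cu : cvgn (series u).
  apply: normed_cvg; apply: nondecreasing_is_cvgn.
    by apply: nondecreasing_series => k _ _; exact: normr_ge0.
  exists (2 + fine (\sum_(n <oo) g n x) / om x)%R => _ [n _ <-].
  apply: (@le_trans _ _ (\sum_(0 <= k < n) ((2^-1) ^+ k + 2 ^+ k * u k ^+ 2))%R); last first.
    by rewrite big_split/= lerD.
  apply: ler_sum => k _ /=.
  have p2 : (0 < 2 ^+ k :> R)%R by rewrite exprn_gt0.
  rewrite exprVn; have [uk|uk] := leP `|u k|%R ((2 ^+ k)^-1)%R.
    by rewrite (le_trans uk)// lerDl mulr_ge0 ?sqr_ge0// ltW.
  apply: (@le_trans _ _ (2 ^+ k * u k ^+ 2)%R); last by rewrite lerDr invr_ge0 ltW.
  rewrite -real_normK ?num_real// expr2 mulrA ler_peMl//.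
  by rewrite mulrC -ler_pdivrMr// mul1r ltW.
have -> : f ^~ x = (fun n => f 0%N x + series u n)%R.
  apply/funext => n; rewrite seriesEnat/= telescope_sumr//; first by rewrite addrC subrK.
by apply: is_cvgD => //; exact: is_cvg_cst.
Qed.

End ae_convergence.

(** * Left-continuous limits of increasing processes *)

Section left_regularisation.
Context {R : realType}.
Local Notation leb := (@lebesgue_measure R).
Implicit Types A f : R -> R.

Lemma ae_exists_itv (Q : R -> Prop) a b : {ae leb, forall s, 0 <= s -> Q s} ->
  0 <= a -> a < b -> exists s, [/\ a < s, s < b & Q s].
Proof.
move=> [N [mN N0 sub]] a0 ab; apply: contrapT => H.
have : (leb `]a, b[%classic <= leb N)%E.
  apply: le_measure; [by rewrite inE; exact: measurable_itv|by rewrite inE|].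
  move=> s /=; rewrite in_itv/= => /andP[as_ sb]; apply: sub => /= Qs; apply: H.
  by exists s; split => //; apply: Qs; rewrite (le_trans a0)// ltW.
rewrite N0 leNgt => /negP; apply.
by rewrite lebesgue_measure_itv/= lte_fin ab -EFinD lte_fin subr_gt0.
Qed.

(** Times of full measure occur arbitrarily close to [t] on its left. Time 0 is out of reach of this
    argument and is treated separately wherever it matters. *)
Lemma left_continuous_ae_ge0 f : left_continuous_path f ->
  {ae leb, forall s, 0 <= s -> 0 <= f s} -> forall t, 0 < t -> 0 <= f t.
Proof.
move=> lf aef t t0; rewrite leNgt; apply/negP => ft0.
have : \forall s \near t^'-, f s < 0 by apply: (cvgr_lt (f t)) => //; exact: lf.
move=> [e /= e0 He].
have h : Num.max 0 (t - e) < t by rewrite gt_max t0 ltrBlDr ltrDl e0.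
have m0 : 0 <= Num.max 0 (t - e) by rewrite le_max lexx.
have [s [ts st fs]] := ae_exists_itv aef m0 h.
move: fs; rewrite leNgt => /negP; apply.
apply: He => //=; rewrite gtr0_norm ?subr_gt0// ltrBlDl -ltrBlDr.
by move: ts; rewrite gt_max => /andP[].
Qed.

(** A sequence increasing to [t] strictly from the left when [t] is positive; the multiplicative
    form keeps it nonnegative and fixes 0. *)
Definition ltime (j : nat) (t : R) := t * (1 - (2^-1) ^+ j).

Definition lreg A t := limn (fun j => A (ltime j t)).

Lemma ltime_itv j t : 0 <= t -> 0 <= ltime j t <= t.
Proof.
move=> t0; have h : 0 <= (2^-1 : R) ^+ j <= 1 by rewrite exprn_ge0//= exprn_ile1// invf_le1 ?ler1n.
by case/andP: h => h0 h1; rewrite /ltime mulr_ge0 ?subr_ge0//= ler_piMr// gerBl.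
Qed.

Lemma ltime_lt j t : 0 < t -> ltime j t < t.
Proof. by move=> t0; rewrite /ltime gtr_pMr// gtrBl exprn_gt0. Qed.

Lemma le_ltime i j t : 0 <= t -> (i <= j)%N -> ltime i t <= ltime j t.
Proof.
move=> t0 ij; rewrite /ltime ler_wpM2l// lerB//.
by rewrite ler_wiXn2l// invf_le1 ?ler1n.
Qed.

Lemma ltime_gt s t : 0 <= s -> s < t -> exists j, s < ltime j t.
Proof.
move=> s0 st; have t0 : 0 < t by exact: le_lt_trans st.
have : ltime j t @[j --> \oo] --> t.
  rewrite -[X in _ --> X]mulr1 -[X in _ --> t * X]subr0; apply: cvgM; first exact: cvg_cst.
  apply: cvgB; first exact: cvg_cst.
  by apply: cvg_expr; rewrite ger0_norm// invf_lt1 ?ltr1n.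
move=> /cvgr_gt /(_ _ st)[j _ /(_ j (leqnn j)) h]; by exists j.
Qed.

Section monotone.
Variable A : R -> R.
Hypothesis A0 : A 0 = 0.
Hypothesis ndA : forall s t, 0 <= s -> s <= t -> A s <= A t.

Lemma lreg_cvg t : 0 <= t -> A (ltime j t) @[j --> \oo] --> lreg A t.
Proof.
move=> t0; apply: nondecreasing_is_cvgn.
  move=> i j ij; apply: ndA; last exact: le_ltime.
  by case/andP: (ltime_itv i t0).
exists (A t) => _ [j _ <-]; case/andP: (ltime_itv j t0) => h0 h1; exact: ndA.
Qed.

Lemma lreg_le t : 0 <= t -> lreg A t <= A t.
Proof.
move=> t0; apply: limr_le; first by apply/cvg_ex; eexists; exact: lreg_cvg.
apply: nearW => j; case/andP: (ltime_itv j t0) => h0 h1; exact: ndA.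
Qed.

Lemma lreg_ge s t : 0 <= s -> s < t -> A s <= lreg A t.
Proof.
move=> s0 st; have t0 : 0 <= t by rewrite (le_trans s0)// ltW.
have [j sj] := ltime_gt s0 st.
apply: limr_ge; first by apply/cvg_ex; eexists; exact: lreg_cvg.
exists j => //= k /= jk; apply: ndA => //; rewrite (le_trans (ltW sj))//.
exact: le_ltime.
Qed.

Lemma lreg0 : lreg A 0 = 0.
Proof.
rewrite /lreg; under eq_fun do rewrite /ltime mul0r A0.
exact: (lim_cst (@Rhausdorff R)).
Qed.

Lemma increasing_path_lreg : increasing_path (lreg A).
Proof.
split; first exact: lreg0.
- move=> s t; rewrite !in_itv/= !andbT => s0 t0; rewrite le_eqVlt => /predU1P[->//|st].
  exact: le_trans (lreg_le s0) (lreg_ge s0 st).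
- move=> t t0; apply/cvgrPdist_le => e e0.
  have [j _ Hj] : \forall j \near \oo, lreg A t - e < A (ltime j t).
    by apply: (cvgr_gt _ (lreg_cvg (ltW t0))); rewrite ltrBlDr ltrDl.
  have {}Hj := Hj j (leqnn j).
  near=> s.
  have js : ltime j t < s by near: s; apply: nbhs_left_gt; exact: ltime_lt.
  have j0 : 0 <= ltime j t by case/andP: (ltime_itv j (ltW t0)).
  have s0 : 0 <= s by rewrite (le_trans j0)// ltW.
  have st : s < t by near: s; exact: nbhs_left_lt.
  have h1 := lreg_ge j0 js.
  have h2 : lreg A s <= lreg A t by exact: le_trans (lreg_le s0) (lreg_ge s0 st).
  by rewrite ger0_norm ?subr_ge0//; lra.
Unshelve. all: by end_near. Qed.

(* between [A (t-)] and [A t] lies a rational, different for different [t] *)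
Lemma ae_lreg : {ae leb, forall t, 0 <= t -> lreg A t = A t}.
Proof.
pose J := [set t | 0 <= t /\ lreg A t < A t].
have Jq t : exists q : rat, J t -> lreg A t < ratr q < A t.
  have [[t0 Jt]|nJ] := pselect (J t); last by exists 0.
  by have [q] := rat_in_itvoo Jt; rewrite in_itv/=; exists q.
have [q Hq] := choice Jq.
have cJ : countable J.
  apply/countable_injP; exists (fun t => choice.pickle (q t)).
  have key s t : J s -> J t -> s < t -> q s != q t.
    move=> Js Jt st; apply/eqP => e.
    case/andP: (Hq s Js) => _ h1; case/andP: (Hq t Jt) => h2 _.
    have := lreg_ge Js.1 st; rewrite leNgt => /negP; apply.
    by rewrite (lt_trans h2)// -e.
  move=> s t /set_mem Js /set_mem Jt /(pcan_inj choice.pickleK) e.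
  have [st|ts|//] := ltgtP s t.
    by have := key _ _ Js Jt st; rewrite e eqxx.
  by have := key _ _ Jt Js ts; rewrite e eqxx.
exists J; split; first exact: countable_measurable.
  exact: countable_lebesgue_measure0.
move=> t /= H; have [t0|t0] := leP 0 t; last first.
  by exfalso; apply: H => t0'; move: t0; rewrite ltNge t0'.
split => //; rewrite lt_neqAle lreg_le// andbT; apply/eqP => e; apply: H => _; exact: e.
Qed.

End monotone.
End left_regularisation.

Section limit_process.
Context {R : realType} {d : measure_display} {Omega : measurableType d}.
Variable P : probability Omega R.
Variable Gf : R -> set (set Omega).
Hypothesis Fmono : forall s t, s <= t -> <<s Gf s >> `<=` <<s Gf t >>.
Hypothesis Gnull : forall t N, P.-negligible N -> <<s Gf t >> N.
Local Notation leb := (@lebesgue_measure R).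
Local Notation adapted_to := (adapted_to Gf).

Lemma meas_at_indic t (C : set Omega) : {ae P, forall w, C w} -> meas_at Gf t (\1_C).
Proof.
move=> aeC; apply: measurable_indic.
rewrite -[C]setCK; apply: measurableC.
exact: (Gnull aeC).
Qed.

Variable u : nat -> R -> Omega -> R.
Hypothesis au : forall n, adapted_to (u n).
Hypothesis Iu : forall n w, increasing_path (u n ^~ w).

Definition good_paths :=
  [set w | {ae leb, forall t, 0 <= t -> cvgn (fun n => u n t w)}].
Hypothesis aegood : {ae P, forall w, good_paths w}.

(** The lower limit exists at every time and is monotone in time even where the sequence diverges.
    On good paths it is finite, because the sequence converges at some later time; the indicator
    removes the other paths. *)
Let A t w : R := fine (limn_einf (fun n => (u n t w)%:E)) * \1_good_paths w.

Definition limit_process t w := lreg (A ^~ w) t.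

Let u0 n t w : 0 <= t -> 0 <= u n t w.
Proof. by move=> t0; exact: (ip_ge0 (Iu n w) t0). Qed.

Let einf_ge0 t w : 0 <= t -> (0 <= limn_einf (fun n => (u n t w)%:E))%E.
Proof.
move=> t0; rewrite limn_einf_lim; apply: lime_ge; first exact: is_cvg_einfs.
apply: nearW => n; apply: le_ereal_inf_tmp => _ [k _ <-].
by rewrite lee_fin u0.
Qed.

Let le_einf s t w : 0 <= s -> s <= t ->
  (limn_einf (fun n => (u n s w)%:E) <= limn_einf (fun n => (u n t w)%:E))%E.
Proof.
move=> s0 st; rewrite !limn_einf_lim; apply: lee_lim; [exact: is_cvg_einfs|exact: is_cvg_einfs|].
apply: nearW => n; apply: le_ereal_inf_tmp => _ [k nk <-].
apply: (@le_trans _ _ (u k s w)%:E); last by rewrite lee_fin (ip_le (Iu k w)).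
by apply: ereal_inf_lbound; exists k.
Qed.

Let cvg_einf t w : cvgn (fun n => u n t w) ->
  limn_einf (fun n => (u n t w)%:E) = (limn (fun n => u n t w))%:E.
Proof.
move=> cu; have : (u n t w)%:E @[n --> \oo] --> (limn (fun n => u n t w))%:E.
  by apply: cvg_EFin => //; exact: nearW.
by case/cvg_limn_einf_sup.
Qed.

Let fin_einf t w : good_paths w -> 0 <= t ->
  limn_einf (fun n => (u n t w)%:E) \is a fin_num.
Proof.
move=> gw t0.
have t1 : t < t + 1 by rewrite ltrDl.
have [s [ts _ cs]] := ae_exists_itv gw t0 t1.
rewrite ge0_fin_numE ?einf_ge0//.
by rewrite (le_lt_trans (le_einf w t0 (ltW ts)))// cvg_einf// ltry.
Qed.

Let A0 w : A 0 w = 0.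
Proof.
rewrite /A (_ : (fun n => _) = cst 0%E); last by apply/funext => n; rewrite (ip0 (Iu n w)).
have : cst 0%E @ \oo --> (0%E : \bar R) by exact: cvg_cst.
by move=> /cvg_limn_einf_sup[-> _]; rewrite mul0r.
Qed.

Let ndA w s t : 0 <= s -> s <= t -> A s w <= A t w.
Proof.
move=> s0 st; rewrite /A indicE; case: (boolP (w \in _)) => [|_]; last by rewrite !mulr0.
rewrite inE => gw; rewrite !mulr1 fine_le ?fin_einf//; last exact: le_einf.
exact: le_trans st.
Qed.

(** The regularisation at [t] uses only times [ltime j t], none later than [t], and the set of good
    paths has a null complement, so it belongs to every sigma-algebra of the filtration. *)
Lemma adapted_limit_process : adapted_to limit_process.
Proof.
move=> t t0; apply: (@meas_at_cvg _ _ _ Gf t (fun j => A (ltime j t))); last first.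
  by move=> w; exact: (lreg_cvg (@ndA w) t0).
move=> j; case/andP: (ltime_itv j t0) => s0 st.
apply: measurable_funM; last exact: meas_at_indic.
apply: (@measurableT_comp _ _ _ _ _ _ fine) => //.
apply: (@emeasurable_fun_cvg _ (g_sigma_algebraType (Gf t)) R setT (fun n w => einfs (fun k => (u k (ltime j t) w)%:E) n)).
  apply: (@measurable_fun_einfs _ (g_sigma_algebraType (Gf t)) R setT (fun k w => (u k (ltime j t) w)%:E)) => k.
  by apply/measurable_EFinP; exact: (adapted_at Fmono (au k) s0 st).
by move=> w _; rewrite limn_einf_lim; exact: is_cvg_einfs.
Qed.

Lemma increasing_path_limit_process w : increasing_path (limit_process ^~ w).
Proof. exact: (increasing_path_lreg (A0 w) (@ndA w)). Qed.

Lemma cvg_limit_process w : good_paths w ->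
  {ae leb, forall t, 0 <= t -> u n t w @[n --> \oo] --> limit_process t w}.
Proof.
move=> gw; have := ae_lreg (@ndA w); move: (gw); rewrite /good_paths/=.
apply: (@filterS2 _ _ (ae_filter_ringOfSetsType leb)) => t cu lA t0.
rewrite /limit_process lA// /A indicE mem_set// mulr1 (cvg_einf (cu t0))/=.
exact: (cu t0).
Qed.

End limit_process.

(** * Existence and uniqueness for a convex functional of pairs *)

Section convex_minimisation.
Context {R : realType} {d : measure_display} {Omega : measurableType d}.
Variable P : probability Omega R.
Variable Gf : R -> set (set Omega).
Hypothesis Gm : forall t, Gf t `<=` measurable.
Hypothesis Fmono : forall s t, s <= t -> <<s Gf s >> `<=` <<s Gf t >>.
Hypothesis Gnull : forall t N, P.-negligible N -> <<s Gf t >> N.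
Local Notation leb := (@lebesgue_measure R).
Local Notation adapted_to := (adapted_to Gf).
Local Notation DD := ([set: Omega] `*` `[(0 : R), +oo[%classic).
Local Notation mu := (P \x leb)%E.
Variable x : R.
Hypothesis x0 : 0 <= x.

Definition proc_pair := ((R -> Omega -> R) * (R -> Omega -> R))%type.
Implicit Types u v : proc_pair.

(** In the rescaled variables [fs_bound] says that the state is nonnegative. All path conditions
    hold for every [w], since null sets are removed before pairs are formed. *)
Record feasible u : Prop := Feasible {
  fs_adapted1 : adapted_to u.1;
  fs_adapted2 : adapted_to u.2;
  fs_path1 : forall w, increasing_path (u.1 ^~ w);
  fs_path2 : forall w, increasing_path (u.2 ^~ w);
  fs_bound : forall t w, 0 <= t -> u.2 t w <= x + u.1 t w }.

Definition midpair u v : proc_pair :=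
  ((fun t w => (u.1 t w + v.1 t w) / 2), (fun t w => (u.2 t w + v.2 t w) / 2)).

Lemma feasible_midpair u v : feasible u -> feasible v -> feasible (midpair u v).
Proof.
move=> [a1 a2 p1 p2 b] [a1' a2' p1' p2' b']; split => /=.
- by move=> t t0; apply: measurable_funM => //; apply: measurable_funD; [exact: a1|exact: a1'].
- by move=> t t0; apply: measurable_funM => //; apply: measurable_funD; [exact: a2|exact: a2'].
- move=> w; have := increasing_pathZ (_ : 0 <= 2^-1) (increasing_pathD (p1 w) (p1' w)).
  by under eq_fun do rewrite mulrC; apply; rewrite invr_ge0.
- move=> w; have := increasing_pathZ (_ : 0 <= 2^-1) (increasing_pathD (p2 w) (p2' w)).
  by under eq_fun do rewrite mulrC; apply; rewrite invr_ge0.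
- by move=> t w t0; have := b t w t0; have := b' t w t0; lra.
Qed.

Definition domain a b := [/\ 0 <= a, 0 <= b & b <= x + a].

Lemma feasible_domain u t w : feasible u -> 0 <= t -> domain (u.1 t w) (u.2 t w).
Proof.
move=> fu t0; split; [exact: (ip_ge0 (fs_path1 fu w))|exact: (ip_ge0 (fs_path2 fu w))|].
exact: fs_bound.
Qed.

Let mo : measurable (`[(0 : R), +oo[%classic : set R). Proof. exact: measurable_itv. Qed.
Let mDD : measurable DD. Proof. exact: measurableX. Qed.

Let mj1 u : feasible u -> measurable_fun DD (fun z : Omega * R => u.1 z.2 z.1).
Proof. by move=> fu; apply: (adapted_joint_lc Gm (fs_adapted1 fu)) => w; exact: (ip_lc (fs_path1 fu w)). Qed.
Let mj2 u : feasible u -> measurable_fun DD (fun z : Omega * R => u.2 z.2 z.1).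
Proof. by move=> fu; apply: (adapted_joint_lc Gm (fs_adapted2 fu)) => w; exact: (ip_lc (fs_path2 fu w)). Qed.

(** The weight [exp (- t)] in the auxiliary functional. Its role is to be positive and of finite
    total mass; it makes the functional bounded whatever the model. *)
Let om (z : Omega * R) : R := exponential_pdf 1 z.2.

Let mom : measurable_fun DD om.
Proof.
apply: measurable_funTS; apply: (@measurableT_comp _ _ _ _ _ _ (exponential_pdf 1)) => //.
exact: measurable_exponential_pdf.
Qed.

Let om0 z : DD z -> 0 < om z.
Proof.
by move=> [_ /=]; rewrite in_itv/= andbT => z0; rewrite /om exponential_pdfE ?ler01// mul1r expR_gt0.
Qed.

Let om_int : (\int[mu]_(z in DD) (om z)%:E <= 1)%E.
Proof.
have mE : measurable_fun DD (fun z => (om z)%:E) by exact/measurable_EFinP.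
have E0 (z : Omega * R) : `[(0 : R), +oo[%classic z.2 -> (0 <= (om z)%:E)%E.
  by move=> z0; rewrite lee_fin ltW// om0.
rewrite -(tonelli_left P mo mE E0).
rewrite [leRHS](_ : 1 = \int[P]_w 1)%E; last first.
  by rewrite integral_cst// mul1e; exact/esym/probability_setT.
apply: ge0_le_integral => //.
- by move=> w _; apply: integral_ge0 => s s0; exact: (E0 (w, s)).
- exact: (measurable_tonelli mo mE E0).
- move=> w _; rewrite -(integral_exponential_pdf (ltr01 : 0 < 1 :> R)).
  apply: ge0_subset_integral => //.
  + by apply/measurable_EFinP; exact: measurable_exponential_pdf.
  + by move=> s _; rewrite lee_fin exponential_pdf_ge0.
Qed.

Let ephi (f : Omega * R -> R) := (\int[mu]_(z in DD) (om z * expR (- f z))%:E)%E.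

Let mexp (f : Omega * R -> R) (c : R) : measurable_fun DD f ->
  measurable_fun DD (fun z => expR (c * f z)).
Proof. by move=> mf; apply: measurableT_comp => //; apply: measurable_funM. Qed.

Let momexp (f : Omega * R -> R) : measurable_fun DD f ->
  measurable_fun DD (fun z => (om z * expR (- f z))%:E).
Proof.
move=> mf; apply/measurable_EFinP; apply: measurable_funM => //.
by apply: eq_measurable_fun (mexp (-1) mf) => z _; rewrite mulN1r.
Qed.

Let ephi_itv (f : Omega * R -> R) : measurable_fun DD f -> (forall z, DD z -> 0 <= f z) ->
  (0 <= ephi f <= 1)%E.
Proof.
move=> mf f0; apply/andP; split.
  by apply: integral_ge0 => z Dz; rewrite lee_fin mulr_ge0// ltW// om0.
apply: le_trans om_int; apply: ge0_le_integral => //.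
- by move=> z Dz; rewrite lee_fin mulr_ge0// ltW// om0.
- exact: momexp.
- exact/measurable_EFinP.
- move=> z Dz; rewrite lee_fin ler_piMr ?(ltW (om0 Dz))//.
  by rewrite -expR0 ler_expR oppr_le0 f0.
Qed.

Let ephi_fin (f : Omega * R -> R) : measurable_fun DD f -> (forall z, DD z -> 0 <= f z) ->
  (fine (ephi f))%:E = ephi f.
Proof.
move=> mf f0; case/andP: (ephi_itv mf f0) => h0 h1; rewrite fineK//.
by rewrite ge0_fin_numE// (le_lt_trans h1)// ltry.
Qed.

(* with [p = exp (-a/2)] and [q = exp (-b/2)], [(p ^ 2 + q ^ 2) / 2 - p q = (p - q) ^ 2 / 2] *)
Let ephi_gap (f g : Omega * R -> R) : measurable_fun DD f -> measurable_fun DD g ->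
  (forall z, DD z -> 0 <= f z) -> (forall z, DD z -> 0 <= g z) ->
  (\int[mu]_(z in DD) (om z * (expR (- 2^-1 * g z) - expR (- 2^-1 * f z)) ^+ 2)%:E =
   (2 * ((fine (ephi f) + fine (ephi g)) / 2 - fine (ephi (fun z => (f z + g z) / 2)%R)))%:E)%E.
Proof.
move=> mf mg f0 g0; pose k z := (f z + g z) / 2.
have mk : measurable_fun DD k by apply: measurable_funM => //; exact: measurable_funD.
have k0 z : DD z -> 0 <= k z by move=> Dz; rewrite /k mulr_ge0 ?addr_ge0 ?f0 ?g0.
have mS : measurable_fun DD (fun z => (om z * (expR (- 2^-1 * g z) - expR (- 2^-1 * f z)) ^+ 2)%:E).
  apply/measurable_EFinP; apply: measurable_funM => //; apply: measurable_funX.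
  by apply: measurable_funB; exact: mexp.
have e0 (h : Omega * R -> R) z : DD z -> (0 <= (om z * expR (- h z))%:E)%E.
  by move=> Dz; rewrite lee_fin mulr_ge0// ltW// om0.
have H : (\int[mu]_(z in DD) (om z * (expR (- 2^-1 * g z) - expR (- 2^-1 * f z)) ^+ 2)%:E +
    2%:E * ephi k = ephi f + ephi g)%E.
  rewrite /ephi -ge0_integralZl//; last 2 first.
  - exact: momexp.
  - exact: e0.
  rewrite -!ge0_integralD//; last 7 first.
  - exact: e0.
  - exact: momexp.
  - exact: e0.
  - exact: momexp.
  - by move=> z Dz; rewrite lee_fin mulr_ge0 ?sqr_ge0// ltW// om0.
  - by move=> z Dz; rewrite mule_ge0// e0.
  - by apply: measurable_funeM; exact: momexp.
  apply: eq_integral => z _; rewrite -EFinM -!EFinD; congr EFin.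
  have -> : expR (- f z) = expR (- 2^-1 * f z) ^+ 2 by rewrite -expRM_natl; congr expR; field.
  have -> : expR (- g z) = expR (- 2^-1 * g z) ^+ 2 by rewrite -expRM_natl; congr expR; field.
  have -> : expR (- k z) = expR (- 2^-1 * f z) * expR (- 2^-1 * g z).
    by rewrite -expRD; congr expR; rewrite /k; field.
  ring.
move: H; rewrite -(ephi_fin mf f0) -(ephi_fin mg g0) -(ephi_fin mk k0).
set S := (\int[mu]_(z in DD) _)%E; rewrite -/k.
generalize (fine (ephi f)) (fine (ephi g)) (fine (ephi k)) => a b c.
case: S => [s [e]|//|//]; congr EFin => /=.
by rewrite -[s](addrK (2 * c)) e; field.
Qed.

Let two_four (a q : R) : a <= 2 * q -> 2 * a <= 4 * q.
Proof. lra. Qed.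

Let half_double (a : R) : 2^-1 * (a + a) <= a.
Proof. lra. Qed.

Let sum_itv2 (a b : R) : 0 <= b <= 1 -> 0 <= a <= 1 -> 0 <= a + b <= 2.
Proof. by move=> /andP[? ?] /andP[? ?]; apply/andP; split; lra. Qed.

Let half_gap (a a' b b' m m' q : R) :
  (a + b + (a' + b')) / 2 - (m + m') <= q -> 0 <= (b + b') / 2 - m' -> (a + a') / 2 - m <= q.
Proof. lra. Qed.

Let half_gap' (a a' b b' m m' q : R) :
  (a + b + (a' + b')) / 2 - (m + m') <= q -> 0 <= (a + a') / 2 - m -> (b + b') / 2 - m' <= q.
Proof. lra. Qed.

Variable F : R -> Omega -> R -> R -> R.
Hypothesis mF : forall u, feasible u ->
  measurable_fun DD (fun z : Omega * R => F z.2 z.1 (u.1 z.2 z.1) (u.2 z.2 z.1)).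
Hypothesis F0 : forall t w a b, 0 <= t -> domain a b -> 0 <= F t w a b.
Hypothesis Fmid : forall t w a b a' b', 0 <= t -> domain a b -> domain a' b' ->
  F t w ((a + a') / 2) ((b + b') / 2) <= (F t w a b + F t w a' b') / 2.
Hypothesis Fcvg : forall t w (a b : nat -> R) a' b', 0 <= t ->
  (forall n, domain (a n) (b n)) -> domain a' b' ->
  a n @[n --> \oo] --> a' -> b n @[n --> \oo] --> b' -> F t w (a n) (b n) @[n --> \oo] --> F t w a' b'.
Hypothesis Fcoer : forall t w, 0 <= t -> exists del C : R, 0 < del /\
  forall a b, domain a b -> del * (a + b) <= F t w a b + C.

Let Fz u (z : Omega * R) := (F z.2 z.1 (u.1 z.2 z.1) (u.2 z.2 z.1))%:E.

Definition total u : \bar R :=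
  (\int[P]_w \int[leb]_(s in `[0%R, +oo[) (F s w (u.1 s w) (u.2 s w))%:E)%E.

Let mFz u : feasible u -> measurable_fun DD (Fz u).
Proof. by move=> fu; apply/measurable_EFinP; exact: mF. Qed.

Let Fz0 u : feasible u -> forall z, `[(0 : R), +oo[%classic z.2 -> (0 <= Fz u z)%E.
Proof.
move=> fu [w s] /=; rewrite in_itv/= andbT => s0.
by rewrite lee_fin F0//; exact: feasible_domain.
Qed.

Let totalE u : feasible u -> total u = (\int[mu]_(z in DD) Fz u z)%E.
Proof. by move=> fu; rewrite -(tonelli_left P mo (mFz fu) (Fz0 fu)). Qed.

Lemma total_ge0 u : feasible u -> (0 <= total u)%E.
Proof. by move=> fu; rewrite totalE//; apply: integral_ge0 => z [_ Dz]; exact: Fz0. Qed.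

Let DD0 (z : Omega * R) : DD z -> 0 <= z.2.
Proof. by move=> [_ /=]; rewrite in_itv/= andbT. Qed.

(** The nonnegative convexity gap is added on the left instead of being obtained by subtraction, so
    the identity holds even for infinite totals. *)
Lemma total_midpair_halves u v : feasible u -> feasible v ->
  (total (midpair u v) + \int[mu]_(z in DD)
     ((F z.2 z.1 (u.1 z.2 z.1) (u.2 z.2 z.1) + F z.2 z.1 (v.1 z.2 z.1) (v.2 z.2 z.1)) / 2
      - F z.2 z.1 ((midpair u v).1 z.2 z.1) ((midpair u v).2 z.2 z.1))%:E
   = 2^-1%:E * (total u + total v))%E.
Proof.
move=> fu fv; have fm := feasible_midpair fu fv.
rewrite !totalE// -ge0_integralD//; last 4 first.
- by move=> z [_ Dz]; exact: (Fz0 fm).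
- exact: mFz.
- move=> z Dz; rewrite lee_fin subr_ge0 Fmid//; first exact: DD0.
    by apply: feasible_domain => //; exact: DD0.
  by apply: feasible_domain => //; exact: DD0.
- apply/measurable_EFinP; apply: measurable_funB; last exact: mF.
  by apply: measurable_funM => //; apply: measurable_funD; exact: mF.
rewrite -ge0_integralD//; last 4 first.
- by move=> z [_ Dz]; exact: (Fz0 fu).
- exact: mFz.
- by move=> z [_ Dz]; exact: (Fz0 fv).
- exact: mFz.
rewrite -ge0_integralZl//; last 2 first.
- by apply: emeasurable_funD; exact: mFz.
- by move=> z [_ Dz]; apply: adde_ge0; exact: Fz0.
apply: eq_integral => z _; rewrite /Fz -!EFinD -EFinM; congr EFin.
by rewrite addrC subrK mulrC.
Qed.

Lemma total_midpair_le u v (a : R) : feasible u -> feasible v ->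
  (total u <= a%:E)%E -> (total v <= a%:E)%E -> (total (midpair u v) <= a%:E)%E.
Proof.
move=> fu fv ua va; have fm := feasible_midpair fu fv.
apply: (@le_trans _ _ (2^-1%:E * (total u + total v))%E).
  rewrite -(total_midpair_halves fu fv) leeDl//; apply: integral_ge0 => z Dz.
  rewrite lee_fin subr_ge0 Fmid//; first exact: DD0.
    by apply: feasible_domain => //; exact: DD0.
  by apply: feasible_domain => //; exact: DD0.
apply: (@le_trans _ _ (2^-1%:E * (a%:E + a%:E))%E).
  by apply: lee_wpmul2l; [rewrite lee_fin invr_ge0|exact: leeD].
by rewrite -EFinD -EFinM lee_fin half_double.
Qed.

(** [near_minimisers] bounds the gap of the sum of the two auxiliary functionals. By convexity each
    has a nonnegative gap, so each gap obeys the same bound, and [ephi_gap] converts it into small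
    square increments. *)
Lemma minimising_sequence (J : R) :
  (forall e, 0 < e -> exists2 u, feasible u & (total u <= (J + e)%:E)%E) ->
  exists2 u : nat -> proc_pair, (forall n, feasible (u n)) &
    (forall n, (total (u n) <= (J + (2^-1) ^+ n)%:E)%E) /\
    {ae mu, forall z, DD z -> cvgn (fun n => expR (- 2^-1 * (u n).1 z.2 z.1)) /\
                              cvgn (fun n => expR (- 2^-1 * (u n).2 z.2 z.1))}.
Proof.
move=> HJ.
pose T := {u : proc_pair | feasible u}.
pose tmid (u v : T) : T := exist _ (midpair (sval u) (sval v)) (feasible_midpair (svalP u) (svalP v)).
pose f1 (u : T) (z : Omega * R) := (sval u).1 z.2 z.1.
pose f2 (u : T) (z : Omega * R) := (sval u).2 z.2 z.1.
have mf1 (u : T) : measurable_fun DD (f1 u) by exact: mj1 (svalP u).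
have mf2 (u : T) : measurable_fun DD (f2 u) by exact: mj2 (svalP u).
have f10 (u : T) z : DD z -> 0 <= f1 u z.
  by move=> /DD0 z0; exact: (ip_ge0 (fs_path1 (svalP u) z.1) z0).
have f20 (u : T) z : DD z -> 0 <= f2 u z.
  by move=> /DD0 z0; exact: (ip_ge0 (fs_path2 (svalP u) z.1) z0).
pose phi (u : T) := fine (ephi (f1 u)) + fine (ephi (f2 u)).
have phi_itv (u : T) : 0 <= phi u <= 2.
  have := ephi_itv (mf1 u) (f10 u); have := ephi_itv (mf2 u) (f20 u).
  rewrite -(ephi_fin (mf1 u) (f10 u)) -(ephi_fin (mf2 u) (f20 u)) !lee_fin /phi.
  generalize (fine (ephi (f1 u))) (fine (ephi (f2 u))) => a b.
  exact: sum_itv2.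
have [u Hu] : exists u : nat -> T, forall j,
    (total (sval (u j)) <= (J + (2^-1) ^+ j)%:E)%E /\
    (phi (u j) + phi (u j.+1)) / 2 - phi (tmid (u j) (u j.+1)) <= 2 * (4^-1) ^+ j.
  apply: (@near_minimisers R T tmid (total \o sval) J 2 phi phi_itv) => [u v a ua va|e e0].
    by apply: total_midpair_le => //; exact: svalP.
  by have [u fu Hu] := HJ e e0; exists (exist _ u fu).
exists (fun n => sval (u n)); first by move=> n; exact: svalP.
split; first by move=> n; have [] := Hu n.
have gap (f : T -> Omega * R -> R) (mf : forall u : T, measurable_fun DD (f u))
    (f0 : forall (u : T) z, DD z -> 0 <= f u z) j :
    0 <= (fine (ephi (f (u j))) + fine (ephi (f (u j.+1)))) / 2 -
      fine (ephi (fun z => (f (u j) z + f (u j.+1) z) / 2)).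
  have : (0 <= \int[mu]_(z in DD) (om z * (expR (- 2^-1 * f (u j.+1) z) - expR (- 2^-1 * f (u j) z)) ^+ 2)%:E)%E.
    by apply: integral_ge0 => z Dz; rewrite lee_fin mulr_ge0 ?sqr_ge0// ltW// om0.
  by rewrite ephi_gap// ?lee_fin ?pmulr_rge0// => z; exact: f0.
have gap1 := gap f1 mf1 f10; have gap2 := gap f2 mf2 f20.
have cv (f : T -> Omega * R -> R) (mf : forall u : T, measurable_fun DD (f u))
    (f0 : forall (u : T) z, DD z -> 0 <= f u z) :
    (forall j, (fine (ephi (f (u j))) + fine (ephi (f (u j.+1)))) / 2 -
      fine (ephi (fun z => (f (u j) z + f (u j.+1) z) / 2)) <= 2 * (4^-1) ^+ j) ->
    {ae mu, forall z, DD z -> cvgn (fun n => expR (- 2^-1 * f (u n) z))}.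
  (* The constant 4 is the 2 of [near_minimisers] times the 2 of [ephi_gap]. *)
  move=> H; apply: (@ae_cvg_of_square_increments _ _ _ mu DD mDD
    (fun n z => expR (- 2^-1 * f (u n) z)) om 4) => //.
  - by move=> n; exact: mexp.
  - move=> n; rewrite ephi_gap//; [|exact: f0|exact: f0].
    by rewrite lee_fin; exact: (two_four (H n)).
have c1 := cv f1 mf1 f10 (fun j => half_gap (Hu j).2 (gap2 j)).
have c2 := cv f2 mf2 f20 (fun j => half_gap' (Hu j).2 (gap1 j)).
move: c1 c2; apply: (@filterS2 _ _ (ae_filter_ringOfSetsType mu)) => z h1 h2 Dz.
by split; [exact: h1|exact: h2].
Qed.

(** Convergence of [exp (- a / 2)] leaves open that [a] tends to infinity; being below [K]
    infinitely often forces a positive limit, whose logarithm can be taken. *)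
Let cvg_of_expR (a : nat -> R) (K : R) : (forall n, 0 <= a n) ->
  cvgn (fun n => expR (- 2^-1 * a n)) -> (forall N, exists2 n, (N <= n)%N & a n <= K) -> cvgn a.
Proof.
move=> a0 ce HK; set l := limn (fun n => expR (- 2^-1 * a n)) in ce *.
have l0 : 0 < l.
  apply: (@lt_le_trans _ _ (expR (- 2^-1 * K))); first exact: expR_gt0.
  rewrite leNgt; apply/negP => lK.
  have [N _ HN] : \forall n \near \oo, expR (- 2^-1 * a n) < expR (- 2^-1 * K).
    exact: (cvgr_lt _ ce).
  have [n Nn anK] := HK N; have := HN n Nn.
  by rewrite ltr_expR !mulNr ltrN2 ltr_pM2l ?invr_gt0// ltNge anK.
have -> : a = (fun n => - 2 * ln (expR (- 2^-1 * a n))).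
  by apply/funext => n; rewrite expRK mulrA mulrNN mulfV ?pnatr_eq0// mul1r.
apply/cvg_ex; exists (- 2 * ln l); apply: cvgM; first exact: cvg_cst.
by apply: (cvg_comp (fun n => expR (- 2^-1 * a n)) (@ln R) ce); exact: continuous_ln.
Qed.

(** A finite lower limit of the integrand bounds it along infinitely many indices, and coercivity
    then bounds [a] and [b] along them. The constants may depend on [t] and [w], the argument being
    pointwise. *)
Let coercive_cvg t w (a b : nat -> R) : 0 <= t -> (forall n, domain (a n) (b n)) ->
  cvgn (fun n => expR (- 2^-1 * a n)) -> cvgn (fun n => expR (- 2^-1 * b n)) ->
  (limn_einf (fun n => (F t w (a n) (b n))%:E) < +oo)%E -> cvgn a /\ cvgn b.
Proof.
move=> t0 dab ca cb lF.
have [M LM] : exists M : R, (limn_einf (fun n => (F t w (a n) (b n))%:E) < M%:E)%E.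
  move: lF; case: (limn_einf _) => [r| |] // _; last by exists 0; rewrite ltNyr.
  by exists (r + 1); rewrite lte_fin ltrDl.
have inf_often N : exists2 n, (N <= n)%N & F t w (a n) (b n) <= M.
  apply: contrapT => H; move: LM; rewrite ltNge => /negP; apply.
  rewrite limn_einf_lim; apply: lime_ge; first exact: is_cvg_einfs.
  exists N => // k /= Nk; apply: le_ereal_inf_tmp => _ [n /= kn <-].
  rewrite lee_fin leNgt; apply/negP => Fn; apply: H; exists n; last exact: ltW.
  exact: leq_trans kn.
have [del [C [del0 HC]]] := Fcoer w t0.
have dabn n : [/\ 0 <= a n, 0 <= b n & del * (a n + b n) <= F t w (a n) (b n) + C].
  by have [h1 h2 _] := dab n; split => //; exact: HC.
by split; [apply: (@cvg_of_expR a ((M + C) / del)) => // n|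
           apply: (@cvg_of_expR b ((M + C) / del)) => // n];
  try (by have [] := dabn n); have [k nk Fk] := inf_often n; exists k => //;
  have [ak bk Hk] := dabn k; rewrite ler_pdivlMr// mulrC;
  apply: le_trans (_ : del * (a k + b k) <= _);
  rewrite ?ler_pM2l// ?lerDl ?lerDr//; apply: (le_trans Hk); rewrite lerD2r.
Qed.

Lemma feasible_limit (u : nat -> proc_pair) : (forall n, feasible (u n)) ->
  {ae P, forall w, {ae leb, forall t, 0 <= t ->
    cvgn (fun n => (u n).1 t w) /\ cvgn (fun n => (u n).2 t w)}} ->
  exists2 L, feasible L & {ae P, forall w, {ae leb, forall t, 0 <= t ->
    (u n).1 t w @[n --> \oo] --> L.1 t w /\ (u n).2 t w @[n --> \oo] --> L.2 t w}}.
Proof.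
move=> fu aecvg.
have limit (v : nat -> R -> Omega -> R) : (forall n, adapted_to (v n)) ->
    (forall n w, increasing_path (v n ^~ w)) -> {ae P, forall w, good_paths v w} ->
    exists L, [/\ adapted_to L, forall w, increasing_path (L ^~ w) &
      forall w, good_paths v w -> {ae leb, forall t, 0 <= t -> v n t w @[n --> \oo] --> L t w}].
  move=> av Iv gv; exists (limit_process v); split.
  - exact: (adapted_limit_process Fmono Gnull av Iv gv).
  - by move=> w; exact: increasing_path_limit_process.
  - by move=> w; exact: cvg_limit_process.
pose good := good_paths (fun n => (u n).1) `&` good_paths (fun n => (u n).2).
have aegood : {ae P, forall w, good w}.
  move: aecvg; apply: (@filterS _ _ (ae_filter_ringOfSetsType P)) => w cw.
  by split; move: cw; apply: (@filterS _ _ (ae_filter_ringOfSetsType leb)) => t H /H[].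
have [L1 [aL1 IL1 cL1]] : exists L, [/\ adapted_to L, forall w, increasing_path (L ^~ w) &
      forall w, good w -> {ae leb, forall t, 0 <= t -> (u n).1 t w @[n --> \oo] --> L t w}].
  have [|||L [? ? cL]] := @limit (fun n => (u n).1).
  - by move=> n; exact: fs_adapted1.
  - by move=> n w; exact: (fs_path1 (fu n)).
  - by move: aegood; apply: (@filterS _ _ (ae_filter_ringOfSetsType P)) => w [].
  by exists L; split => // w [gw _]; exact: cL.
have [L2 [aL2 IL2 cL2]] : exists L, [/\ adapted_to L, forall w, increasing_path (L ^~ w) &
      forall w, good w -> {ae leb, forall t, 0 <= t -> (u n).2 t w @[n --> \oo] --> L t w}].
  have [|||L [? ? cL]] := @limit (fun n => (u n).2).
  - by move=> n; exact: fs_adapted2.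
  - by move=> n w; exact: (fs_path2 (fu n)).
  - by move: aegood; apply: (@filterS _ _ (ae_filter_ringOfSetsType P)) => w [].
  by exists L; split => // w [_ gw]; exact: cL.
have mI t : meas_at Gf t (\1_good : Omega -> R) by apply: (meas_at_indic Gnull).
have I0 w : 0 <= \1_good w :> R by rewrite indicE.
have I1 w : good w -> \1_good w = 1 :> R by move=> gw; rewrite indicE mem_set.
exists ((fun t w => \1_good w * L1 t w), (fun t w => \1_good w * L2 t w)).
  split => /=.
  - by move=> t t0; apply: measurable_funM; [exact: mI|exact: aL1].
  - by move=> t t0; apply: measurable_funM; [exact: mI|exact: aL2].
  - by move=> w; apply: increasing_pathZ.
  - by move=> w; apply: increasing_pathZ.
  - move=> t w t0; have [gw|ngw] := pselect (good w); last first.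
      by rewrite indicE memNset// !mul0r addr0.
    rewrite (I1 w gw) !mul1r.
    move: t0; rewrite le_eqVlt => /predU1P[<-|t0].
      by rewrite (ip0 (IL1 w)) (ip0 (IL2 w)) addr0.
    (* The constraint passes to the limit only at the times of convergence, almost all of them; left
       continuity extends it to every positive time. *)
    rewrite -subr_ge0; move: t t0; apply: left_continuous_ae_ge0.
      move=> t t0; apply: cvgB; last exact: (ip_lc (IL2 w)).
      by apply: cvgD; [exact: cvg_cst|exact: (ip_lc (IL1 w))].
    move: (cL1 w gw) (cL2 w gw); apply: (@filterS2 _ _ (ae_filter_ringOfSetsType leb)) => t c1 c2 t0.
    have cc : x + (u n).1 t w - (u n).2 t w @[n --> \oo] --> x + L1 t w - L2 t w.
      by apply: cvgB; [apply: cvgD; [exact: cvg_cst|exact: c1]|exact: c2].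
    rewrite -(cvg_lim (@Rhausdorff R) cc); apply: limr_ge; first by apply/cvg_ex; eexists; exact: cc.
    by apply: nearW => n; rewrite subr_ge0 (fs_bound (fu n)).
move: aegood; apply: (@filterS _ _ (ae_filter_ringOfSetsType P)) => w gw.
move: (cL1 w gw) (cL2 w gw); apply: (@filterS2 _ _ (ae_filter_ringOfSetsType leb)) => t c1 c2 t0 /=.
by rewrite (I1 w gw) !mul1r; split; [exact: c1|exact: c2].
Qed.

(** Fatou's lemma is used twice: on the product space, to make the lower limit of the integrands
    finite almost everywhere, which gives convergence by coercivity; then first in time and next in
    [w], the form in which convergence to the regularised limit is known. *)
Theorem minimiser_exists : (exists2 u, feasible u & (total u < +oo)%E) ->
  exists2 u, feasible u & forall v, feasible v -> (total u <= total v)%E.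
Proof.
move=> [u1 fu1 fin1].
pose V := ereal_inf [set total u | u in feasible].
have V0 : (0 <= V)%E by apply: le_ereal_inf_tmp => _ [u fu <-]; exact: total_ge0.
have Vfin : V \is a fin_num.
  by rewrite ge0_fin_numE// (le_lt_trans _ fin1)//; apply: ereal_inf_lbound; exists u1.
have [J VJ] : exists J : R, V = J%:E by exists (fine V); rewrite fineK.
have HJ e : 0 < e -> exists2 u, feasible u & (total u <= (J + e)%:E)%E.
  move=> e0; have [_ [u fu <-] ue] := lb_ereal_inf_adherent e0 Vfin.
  by exists u => //; rewrite EFinD -VJ ltW.
have [u fu [uJ cu]] := minimising_sequence HJ.
have J2 : (J + (2^-1) ^+ n)%:E @[n --> \oo] --> J%:E.
  apply: cvg_EFin; first exact: nearW.
  rewrite -[X in _ --> X]addr0; apply: cvgD; first exact: cvg_cst.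
  by apply: cvg_expr; rewrite ger0_norm// invf_lt1 ?ltr1n.
pose lz z := limn_einf (fun n => Fz (u n) z).
have mlz : measurable_fun DD lz.
  apply: (emeasurable_fun_cvg (fun n z => einfs (fun n => Fz (u n) z) n)) => [n|z Dz].
    by apply: (@measurable_fun_einfs _ _ _ _ (fun n z => Fz (u n) z)) => k; exact: mFz.
  by rewrite /lz limn_einf_lim; exact: is_cvg_einfs.
have lz0 z : DD z -> (0 <= lz z)%E.
  move=> [_ Dz]; rewrite /lz limn_einf_lim; apply: lime_ge; first exact: is_cvg_einfs.
  by apply: nearW => n; apply: le_ereal_inf_tmp => _ [k _ <-]; exact: Fz0.
have aelz : {ae mu, forall z, DD z -> (lz z < +oo)%E}.
  have : {ae mu, forall z, DD z -> lz z \is a fin_num}.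
    apply: integrable_ae => //; apply/integrableP; split => //.
    rewrite (_ : (\int[mu]_(z in DD) `|lz z|)%E = (\int[mu]_(z in DD) lz z)%E); last first.
      by apply: eq_integral => z /set_mem Dz; rewrite gee0_abs ?lz0.
    apply: le_lt_trans (fatou mu mDD (fun n => mFz (fu n)) (fun n z Dz => Fz0 (fu n) Dz.2)) _.
    apply: (@le_lt_trans _ _ J%:E); last by rewrite ltry.
    by apply: (limn_einf_le _ J2) => n; rewrite -totalE.
  apply: (@filterS _ _ (ae_filter_ringOfSetsType mu)) => z Hz Dz.
  by rewrite -ge0_fin_numE ?lz0 ?Hz.
have aecvg : {ae P, forall w, {ae leb, forall t, 0 <= t ->
    cvgn (fun n => (u n).1 t w) /\ cvgn (fun n => (u n).2 t w)}}.
  apply: (@ae_section _ _ _ P (fun z => 0 <= z.2 ->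
    cvgn (fun n => (u n).1 z.2 z.1) /\ cvgn (fun n => (u n).2 z.2 z.1))).
  move: cu aelz; apply: (@filterS2 _ _ (ae_filter_ringOfSetsType mu)) => z cz lzz z0.
  have Dz : DD z by split => //=; rewrite in_itv/= z0.
  have [c1 c2] := cz Dz.
  apply: (coercive_cvg z0 _ c1 c2 (lzz Dz)) => n; exact: feasible_domain.
have [L fL cL] := feasible_limit fu aecvg.
exists L => // v fv; apply: (@le_trans _ _ V); last by apply: ereal_inf_lbound; exists v.
have msec u' w : feasible u' -> measurable_fun `[(0 : R), +oo[%classic (fun s => (F s w (u'.1 s w) (u'.2 s w))%:E).
  by move=> fu'; exact: (measurable_section_time w mo (mFz fu')).
have sec0 u' w s : feasible u' -> `[(0 : R), +oo[%classic s -> (0 <= (F s w (u'.1 s w) (u'.2 s w))%:E)%E.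
  by move=> fu' s0; exact: (@Fz0 u' fu' (w, s)).
pose H n w := (\int[leb]_(s in `[0%R, +oo[) (F s w ((u n).1 s w) ((u n).2 s w))%:E)%E.
have mH u' : feasible u' -> measurable_fun setT (fun w => \int[leb]_(s in `[0%R, +oo[) (F s w (u'.1 s w) (u'.2 s w))%:E)%E.
  by move=> fu'; exact: (measurable_tonelli mo (mFz fu') (Fz0 fu')).
have H0 u' w : feasible u' -> (0 <= \int[leb]_(s in `[0%R, +oo[) (F s w (u'.1 s w) (u'.2 s w))%:E)%E.
  by move=> fu'; apply: integral_ge0 => s; exact: sec0.
apply: (@le_trans _ _ (\int[P]_w limn_einf (H ^~ w))%E).
  apply: ae_ge0_le_integral => //.
  - by move=> w _; exact: H0.
  - exact: mH.
  - move=> w _; rewrite limn_einf_lim; apply: lime_ge; first exact: is_cvg_einfs.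
    by apply: nearW => n; apply: le_ereal_inf_tmp => _ [k _ <-]; exact: H0.
  - apply: (emeasurable_fun_cvg (fun n w => einfs (H ^~ w) n)) => [n|w _].
      by apply: measurable_fun_einfs => k; exact: mH.
    by rewrite limn_einf_lim; exact: is_cvg_einfs.
  - move: cL; apply: (@filterS _ _ (ae_filter_ringOfSetsType P)) => w cLw _.
    apply: (@ae_fatou _ _ _ leb _ mo (fun n s => (F s w ((u n).1 s w) ((u n).2 s w))%:E)).
    + by move=> n; exact: msec.
    + by move=> n s; exact: sec0.
    + exact: msec.
    + by move=> s; exact: sec0.
    + move: cLw; apply: (@filterS _ _ (ae_filter_ringOfSetsType leb)) => s cs.
      rewrite /= in_itv/= andbT => s0; have [c1 c2] := cs s0.
      apply: cvg_EFin; first exact: nearW.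
      exact: (@Fcvg s w (fun n => (u n).1 s w) (fun n => (u n).2 s w) _ _ s0 (fun n => feasible_domain w (fu n) s0) (feasible_domain w fL s0) c1 c2).
apply: le_trans (fatou P measurableT (fun n => mH _ (fu n)) (fun n w _ => H0 _ w (fu n))) _.
by rewrite VJ; exact: (limn_einf_le uJ J2).
Qed.

Hypothesis Fstrict : forall t w a b a' b', 0 <= t -> domain a b -> domain a' b' ->
  (F t w a b + F t w a' b') / 2 <= F t w ((a + a') / 2) ((b + b') / 2) -> a - b = a' - b'.

(** The midpoint of two minimisers is feasible, so the convexity gap integrates to 0 and vanishes
    almost everywhere. [Fstrict] then fixes only the difference of the two components, and left
    continuity extends the equality to all times. *)
Theorem minimiser_unique u v : feasible u -> feasible v -> (total u < +oo)%E ->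
  (forall v', feasible v' -> (total u <= total v')%E) -> total v = total u ->
  {ae P, forall w, forall t, 0 <= t -> u.1 t w - u.2 t w = v.1 t w - v.2 t w}.
Proof.
move=> fu fv ufin umin vu; have fm := feasible_midpair fu fv.
pose gap z := ((F z.2 z.1 (u.1 z.2 z.1) (u.2 z.2 z.1) + F z.2 z.1 (v.1 z.2 z.1) (v.2 z.2 z.1)) / 2
      - F z.2 z.1 ((midpair u v).1 z.2 z.1) ((midpair u v).2 z.2 z.1)).
have gap0 z : DD z -> (0 <= (gap z)%:E)%E.
  move=> Dz; rewrite lee_fin subr_ge0.
  apply: Fmid; [exact: DD0| |]; apply: feasible_domain => //; exact: DD0.
have mgap : measurable_fun DD (fun z => (gap z)%:E).
  apply/measurable_EFinP; apply: measurable_funB; last exact: mF.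
  by apply: measurable_funM => //; apply: measurable_funD; exact: mF.
have I0 : (\int[mu]_(z in DD) (gap z)%:E = 0)%E.
  have := total_midpair_halves fu fv; rewrite -/gap vu.
  have := umin _ fm; have := total_ge0 fu; have := total_ge0 fm.
  have : (0 <= \int[mu]_(z in DD) (gap z)%:E)%E by exact: integral_ge0.
  move: ufin; rewrite /gap; move: (total u) (total (midpair u v)) (integral _ _ _).
  case=> [a| |]// [b| |]// [c| |]//.
  rewrite !lee_fin => _ c0 b0 a0 ab [e].
  congr EFin; apply/eqP; rewrite eq_le c0 andbT.
  have : 2^-1 * (a + a) = a by apply/eqP; rewrite eq_le half_double/=; lra.
  by rewrite -e => h; lra.
have aegap : {ae mu, forall z, DD z -> gap z = 0}.
  have /(ae_eq_integral_abs mu mDD mgap) : (\int[mu]_(z in DD) `|(gap z)%:E| = 0)%E.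
    by rewrite -[RHS]I0; apply: eq_integral => z /set_mem Dz; rewrite gee0_abs// gap0.
  by apply: (@filterS _ _ (ae_filter_ringOfSetsType mu)) => z H Dz; have [] := H Dz.
have := @ae_section _ _ _ P (fun z => DD z -> gap z = 0) aegap.
apply: (@filterS _ _ (ae_filter_ringOfSetsType P)) => w Hw.
have E : {ae leb, forall t, 0 <= t -> u.1 t w - u.2 t w = v.1 t w - v.2 t w}.
  move: Hw; apply: (@filterS _ _ (ae_filter_ringOfSetsType leb)) => t Ht t0.
  apply: (@Fstrict t w _ _ _ _ t0 (feasible_domain w fu t0) (feasible_domain w fv t0)).
  rewrite -subr_le0; have -> // : forall r : R, r = 0 -> r <= 0 by move=> r ->.
  by apply: Ht; split => //=; rewrite in_itv/= t0.
have lc u' : feasible u' -> left_continuous_path (fun t => u'.1 t w - u'.2 t w).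
  move=> fu' t t0; apply: cvgB; [exact: (ip_lc (fs_path1 fu' w))|exact: (ip_lc (fs_path2 fu' w))].
have le u' v' : feasible u' -> feasible v' ->
    {ae leb, forall t, 0 <= t -> u'.1 t w - u'.2 t w = v'.1 t w - v'.2 t w} ->
    forall t, 0 < t -> u'.1 t w - u'.2 t w <= v'.1 t w - v'.2 t w.
  move=> fu' fv' e t t0; rewrite -subr_ge0.
  apply: (@left_continuous_ae_ge0 R (fun t => v'.1 t w - v'.2 t w - (u'.1 t w - u'.2 t w)) _ _ t t0).
    by move=> s s0; apply: cvgB; exact: lc.
  by move: e; apply: (@filterS _ _ (ae_filter_ringOfSetsType leb)) => s es s0; rewrite es// subrr.
move=> t; rewrite le_eqVlt => /predU1P[<-|t0].
  by rewrite (ip0 (fs_path1 fu w)) (ip0 (fs_path2 fu w)) (ip0 (fs_path1 fv w)) (ip0 (fs_path2 fv w)).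
apply/eqP; rewrite eq_le le//= le//.
by move: E; apply: (@filterS _ _ (ae_filter_ringOfSetsType leb)) => s es s0; rewrite es.
Qed.

End convex_minimisation.

Lemma continuous_max0 {R : realType} (f : R -> R) :
  {in `]0, +oo[, continuous f} -> f s @[s --> (0 : R)^'+] --> f 0 ->
  continuous (fun t : R => f (Num.max t 0)).
Proof.
move=> cf cf0 t; have [t0|] := boolP (0 < t).
  have ct : f s @[s --> t] --> f t by apply: cf; rewrite in_itv/= t0.
  rewrite /continuous_at (max_l (ltW t0)); apply/cvgrPdist_le => e e0.
  near=> s; have s0 : 0 <= s by apply: ltW; near: s; exact: lt_nbhsr.
  by rewrite (max_l s0); near: s; move/cvgrPdist_le : ct => /(_ _ e0).
rewrite -leNgt => t0; apply/(left_right_continuousP (fun t : R => f (Num.max t 0))).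
rewrite (max_r t0); split.
  apply: cvg_near_cst; near=> s; rewrite max_r//.
  by rewrite (le_trans _ t0)//; near: s; exact: nbhs_left_le.
move: t0; rewrite le_eqVlt => /predU1P[->|t0].
  apply/cvgrPdist_le => e e0; near=> s; rewrite max_l; last by near: s; exact: nbhs_right_ge.
  by near: s; move/cvgrPdist_le : cf0 => /(_ _ e0).
by apply: cvg_near_cst; near=> s; rewrite max_r//; near: s; exact: nbhs_right_le.
Unshelve. all: by end_near. Qed.

(** * The control problem *)

Section regularised_paths.
Context {R : realType} {d : measure_display} {Omega : measurableType d}.
Variable P : probability Omega R.
Variable W : R -> Omega -> R.
Context {n : nat}.
Variable Y : R -> Omega -> 'I_n.+2.
Hypothesis Pcomplete : measure_is_complete P.
Hypothesis bmW : brownian_motion P W.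
Hypothesis mY : forall t : R, 0 <= t -> forall j, measurable (Y t @^-1` [set j]).
Hypothesis rcY : {ae P, forall w, forall t : R, 0 <= t -> \forall s \near t^'+, Y s w = Y t w}.
Hypothesis indepWY : independent P <<s real_events W `[0, +oo[%classic >>
                           <<s chain_events Y `[0, +oo[%classic >>.
Local Notation Gf := (filtration_gen P W Y).
Local Notation adapted_to := (adapted_to Gf).
Local Notation leb := (@lebesgue_measure R).

Let Gm : forall t, Gf t `<=` measurable.
Proof. by move=> t; exact: filtration_gen_measurable. Qed.

Let Fmono s t : s <= t -> <<s Gf s >> `<=` <<s Gf t >>.
Proof. exact: filtration_mono. Qed.

Lemma filtration_gen_null t N : P.-negligible N -> <<s Gf t >> N.
Proof. by move=> N0; apply: sub_sigma_algebra; right. Qed.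

(** Every subset of the null set where [f] and [g] differ is negligible, hence an event of the
    augmented filtration. *)
Lemma meas_at_ae t (f g : Omega -> R) : {ae P, forall w, f w = g w} ->
  meas_at Gf t f -> meas_at Gf t g.
Proof.
move=> fg mf _ B mB; rewrite setTI.
pose N := [set w | f w <> g w].
have mN (A : set Omega) : A `<=` N -> <<s Gf t >> A.
  move=> AN; apply: filtration_gen_null; apply: negligibleS fg.
  by move=> w /AN.
have -> : g @^-1` B = ((f @^-1` B) `\` N) `|` ((g @^-1` B) `&` N).
  apply/seteqP; split => w /=.
    by move=> gB; have [e|ne] := pselect (f w = g w); [left; rewrite e; split => // /(_ e)|right].
  by move=> [[fB /contrapT <-]|[]].
have mNt : measurable (N : set (g_sigma_algebraType (Gf t))) by exact: mN.
apply: (@measurableU _ (g_sigma_algebraType (Gf t))).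
  apply: (@measurableD _ (g_sigma_algebraType (Gf t))) => //.
  by have := mf measurableT B mB; rewrite setTI.
by apply: mN => w [].
Qed.

Definition regular_paths := [set w | [/\ W 0 w = 0, {within `[0, +oo[%classic, continuous (W ^~ w)} &
  forall t : R, 0 <= t -> \forall s \near t^'+, Y s w = Y t w]].

Lemma ae_regular_paths : {ae P, forall w, regular_paths w}.
Proof.
have := bm_start bmW; have := bm_continuous bmW; move: rcY.
apply: (@filterS3 _ _ (ae_filter_ringOfSetsType P)) => w h1 h2 h3.
by split.
Qed.

(* Off the null set of irregular paths the processes are frozen, so that the path properties
   needed below hold for every [w]. *)
Definition regW t w : R := if `[< regular_paths w >] then W (Num.max t 0) w else 0.
Definition regY t w : 'I_n.+2 := if `[< regular_paths w >] then Y (Num.max t 0) w else ord0.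

Lemma regWE t w : regular_paths w -> 0 <= t -> regW t w = W t w.
Proof. by move=> rw t0; rewrite /regW asboolT// max_l. Qed.

Lemma regYE t w : regular_paths w -> 0 <= t -> regY t w = Y t w.
Proof. by move=> rw t0; rewrite /regY asboolT// max_l. Qed.

Lemma regW0 w : regW 0 w = 0.
Proof. by rewrite /regW; case: asboolP => // -[? _ _]; rewrite max_l. Qed.

Lemma continuous_regW w : continuous (regW ^~ w).
Proof.
rewrite /regW; case: asboolP => [[_ /continuous_within_itvcyP[cW cW0] _]|_]; last exact: cst_continuous.
exact: (@continuous_max0 R (W ^~ w)).
Qed.

Lemma adapted_regW : adapted_to regW.
Proof.
move=> t t0; apply: (@meas_at_ae t (W t)).
  by apply: filterS ae_regular_paths => w rw; rewrite regWE.
move=> _ B mB; rewrite setTI; apply: sub_sigma_algebra; left; left.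
by exists t, B; split => //=; rewrite in_itv/= t0 lexx.
Qed.

Lemma right_constant_regY w (t : R) : \forall s \near t^'+, regY s w = regY t w.
Proof.
rewrite /regY; case: asboolP => [[_ _ rY]|_]; last exact: nearW.
have [t0|t0] := leP 0 t.
  have := rY t t0; near_simpl => H; near=> s.
  rewrite !max_l//; last by rewrite (le_trans t0)//; near: s; exact: nbhs_right_ge.
  by near: s.
have e : \forall s \near t^'+, s <= 0 by exact: nbhs_right_le.
near=> s; have s0 : s <= 0 by near: s.
by rewrite (max_r s0).
Unshelve. all: by end_near. Qed.

Lemma right_continuous_regY (f : 'I_n.+2 -> R) w : right_continuous_path (fun t => f (regY t w)).
Proof.
move=> t; apply: cvg_near_cst; have := right_constant_regY w t.
by apply: filterS => s ->.
Qed.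

Lemma adapted_regY (f : 'I_n.+2 -> R) : adapted_to (fun t w => f (regY t w)).
Proof.
move=> t t0; apply: (@meas_at_ae t (fun w => f (Y t w))).
  by apply: filterS ae_regular_paths => w rw; rewrite regYE.
have -> : (fun w => f (Y t w)) = (fun w => \sum_j f j * \1_(Y t @^-1` [set j]) w).
  apply/funext => w; rewrite (bigD1 (Y t w))//= indicE mem_set// mulr1 big1 ?addr0// => j jY.
  by rewrite indicE memNset ?mulr0//= => e; move: jY; rewrite e eqxx.
apply: measurable_sum => j; apply: measurable_funM => //.
apply: measurable_indic; apply: sub_sigma_algebra; left; right.
by exists t, j; split => //=; rewrite in_itv/= t0 lexx.
Qed.

Section exponential_martingale.
Variable sg : R.

Definition expmart t w : R := expR (sg * regW t w - sg ^+ 2 / 2 * Num.max t 0).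

Lemma expmart_gt0 t w : 0 < expmart t w. Proof. exact: expR_gt0. Qed.

Lemma continuous_expmart w : continuous (expmart ^~ w).
Proof.
move=> t; apply: continuous_comp; last exact: continuous_expR.
apply: cvgB; first by apply: cvgM; [exact: cvg_cst|exact: continuous_regW].
apply: cvgM; first exact: cvg_cst.
by apply: (@continuous_max _ _ id (cst 0)) => //; exact: cst_continuous.
Qed.

Lemma adapted_expmart : adapted_to expmart.
Proof.
move=> t t0; apply: measurableT_comp => //; apply: measurable_funB => //.
by apply: measurable_funM => //; exact: adapted_regW.
Qed.

(** The values 0 and 1 of [a] treat the martingale and its square together, as instances of
    [integral_expW] with parameters [sg] and [2 * sg]. *)
Let integral_expmart (a : nat) s t C : 0 <= s -> <<s Gf s >> C -> 0 <= t ->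
  (\int[P]_(w in C) (expmart t w ^+ a.+1)%:E =
   (expR (- (a.+1%:R * (sg ^+ 2 / 2) * t)))%:E * \int[P]_(w in C) (expR (a.+1%:R * sg * W t w))%:E)%E.
Proof.
move=> s0 mC t0; have mC' : measurable C by exact: (subsigma_measurable (@Gm s) mC).
have mW : measurable_fun C (fun w => (expR (a.+1%:R * sg * W t w))%:E).
  apply/measurable_EFinP; apply: measurableT_comp => //; apply: measurable_funM => //.
  by apply: measurable_funTS; exact: (bm_measurable bmW t0).
rewrite -ge0_integralZl//=.
apply: ae_eq_integral => //.
- apply/measurable_EFinP; apply: measurable_funX; apply: measurable_funTS.
  exact: (adapted_toW Gm adapted_expmart t0).
- exact: measurable_funeM.
- apply: filterS ae_regular_paths => w rw _.
  rewrite -EFinM -expRD /expmart -expRM_natl regWE// max_l//; congr (expR _)%:E.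
  by rewrite mulrBr; ring.
Qed.

Lemma martingale_expmart s t C : 0 <= s -> s <= t -> <<s Gf s >> C ->
  (\int[P]_(w in C) (expmart t w)%:E = \int[P]_(w in C) (expmart s w)%:E)%E.
Proof.
move=> s0 st mC; have t0 := le_trans s0 st.
rewrite (integral_expmart 0 s0 mC t0) (integral_expmart 0 s0 mC s0) !mul1r.
rewrite (integral_expW Pcomplete bmW mY indepWY sg s0 st mC) muleA -EFinM -expRD.
by congr ((expR _)%:E * _)%E; field.
Qed.

Lemma submartingale_expmart_sq s t C : 0 <= s -> s <= t -> <<s Gf s >> C ->
  (\int[P]_(w in C) (expmart s w ^+ 2)%:E <= \int[P]_(w in C) (expmart t w ^+ 2)%:E)%E.
Proof.
move=> s0 st mC; have t0 := le_trans s0 st.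
rewrite (integral_expmart 1 s0 mC t0) (integral_expmart 1 s0 mC s0).
rewrite (integral_expW Pcomplete bmW mY indepWY (2 * sg) s0 st mC) muleA -EFinM -expRD.
apply: lee_wpmul2r; first by apply: integral_ge0.
rewrite lee_fin ler_expR.
have -> : - (2 * (sg ^+ 2 / 2) * t) + (2 * sg) ^+ 2 * (t - s) / 2 =
   - (2 * (sg ^+ 2 / 2) * s) + sg ^+ 2 * (t - s) by field.
by rewrite lerDl mulr_ge0 ?sqr_ge0// subr_ge0.
Qed.

Lemma expmart_sq_fin t : 0 <= t -> (\int[P]_w (expmart t w ^+ 2)%:E < +oo)%E.
Proof.
move=> t0; rewrite (integral_expmart 1 (lexx 0) _ t0); last first.
  exact: (@measurableT _ (g_sigma_algebraType (Gf 0))).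
apply: lte_mul_pinfty => //.
exact: (integral_expW_fin bmW).
Qed.

Lemma expmart0 w : expmart 0 w = 1.
Proof. by rewrite /expmart regW0 max_l// !mulr0 subrr expR0. Qed.

End exponential_martingale.

End regularised_paths.

Lemma tint_affine {R : realType} (f g : R -> R) (C c t : R) : right_continuous_path f ->
  right_continuous_path g -> (forall s, `|f s| <= C) -> (forall s, `|g s| <= C) -> 0 <= t ->
  tint (fun s => f s - g s + c) t = tint f t - tint g t + c * t.
Proof.
move=> rf rg fC gC t0.
have rc : right_continuous_path (cst c) by move=> s; exact: cvg_cst.
have rfg : right_continuous_path (fun s => f s - g s + c).
  by move=> s; apply: cvgD; [apply: cvgB; [exact: rf|exact: rg]|exact: rc].
have cC (s : R) : `|cst c s| <= `|c| by [].
have fgC s : `|f s - g s + c| <= C + C + `|c|.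
  by rewrite (le_trans (ler_normD _ _))// lerD2r (le_trans (ler_normB _ _))// lerD.
rewrite (tintE _ rfg fgC) (tintE _ rf fC) (tintE _ rg gC).
have If := integrable_rc t rf fC (lexx 0); have Ig := integrable_rc t rg gC (lexx 0).
have Ic := integrable_rc t rc cC (lexx 0).
have mI : measurable (`[0, t[%classic : set R) by exact: measurable_itv.
have rfg' : right_continuous_path (fun s => f s - g s).
  by move=> s; apply: cvgB; [exact: rf|exact: rg].
have fgC' s : `|f s - g s| <= C + C by rewrite (le_trans (ler_normB _ _))// lerD.
have Ifg := integrable_rc t rfg' fgC' (lexx 0).
have mI' := mI : measurable (`[0, t[%classic : set (measurableTypeR R)).
rewrite (RintegralD mI' Ifg Ic) (RintegralB mI' If Ig); congr (_ + _).
by rewrite Rintegral_cst// /= lebesgue_measure_itv/= lte_fin; case: ltgtP t0 => //= [?|<-] _; rewrite ?oppr0 ?addr0 ?subr0 ?mulr0.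
Qed.

Lemma disc_le_expR {R : realType} (k : R -> R) (klo khi t : R) : right_continuous_path k ->
  (forall s, klo <= k s <= khi) -> 0 <= klo -> 0 <= t -> disc k t <= expR (- (klo * t)).
Proof.
move=> rk kb klo0 t0; rewrite /disc ler_expR lerN2.
have rz : right_continuous_path (cst (0 : R)) by move=> s; exact: cvg_cst.
pose k' s := k s - cst 0 s + - klo.
have rk' : right_continuous_path k'.
  by move=> s; apply: cvgD; [apply: cvgB; [exact: rk|exact: rz]|exact: cvg_cst].
have kb' s : 0 <= k' s <= khi.
  by rewrite /k'/= subr0; case/andP: (kb s) => h1 h2; apply/andP; split; lra.
have := le_tint rk' (fun s => proj1 (andP (kb' s))) (fun s => proj2 (andP (kb' s))) (lexx 0) t0.
have kC s : `|k s| <= khi.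
  by case/andP: (kb s) => h1 h2; rewrite ger0_norm// (le_trans klo0).
have zC (s : R) : `|cst (0 : R) s| <= khi by rewrite normr0 (le_trans _ (kC 0)).
rewrite tint0 (tint_affine _ rk rz kC zC t0).
have -> : tint (cst (0 : R)) t = 0 by rewrite (tintE t rz zC) Rintegral_cst// mul0r.
by rewrite subr0 mulNr subr_ge0.
Qed.

Lemma integral_expR_decay {R : realType} (k : R) : 0 < k ->
  (\int[@lebesgue_measure R]_(s in `[0%R, +oo[) (expR (- (k * s)))%:E = (k^-1)%:E)%E.
Proof.
move=> k0; have := integral_exponential_pdf k0.
have -> : (\int[@lebesgue_measure R]_x (exponential_pdf k x)%:E =
    k%:E * \int[@lebesgue_measure R]_(s in `[0%R, +oo[) (expR (- (k * s)))%:E)%E.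
  rewrite -ge0_integralZl//=; last 2 first.
  - by apply/measurable_EFinP; apply: measurable_funTS; apply: measurableT_comp => //; apply: measurableT_comp => //; exact: measurable_funM.
  - by rewrite lee_fin ltW.
  rewrite [RHS]integral_mkcond; apply: eq_integral => s _.
  by rewrite /exponential_pdf !patchE; case: ifP => // _; rewrite -EFinM mulNr.
move: (integral _ _ _) => [s [e]||]; last 2 first.
- by rewrite gt0_muley.
- by rewrite gt0_muleNy.
by congr EFin; apply: (mulfI (lt0r_neq0 k0)); rewrite e mulfV// gt_eqF.
Qed.

(** * Translation of the control problem into the convex problem *)

Section model_processes.
Context {R : realType} {n : nat} {d : measure_display} {Omega : measurableType d}.
Variables (P : probability Omega R) (M : model R n).
Variables (W : R -> Omega -> R) (Y : R -> Omega -> 'I_n.+2).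
Variables (rho_lo rho_hi m : R).
Hypothesis Pcomplete : measure_is_complete P.
Hypothesis bmW : brownian_motion P W.
Hypothesis mY : forall t : R, 0 <= t -> forall j, measurable (Y t @^-1` [set j]).
Hypothesis rcY : {ae P, forall w, forall t : R, 0 <= t -> \forall s \near t^'+, Y s w = Y t w}.
Hypothesis indepWY : independent P <<s real_events W `[0, +oo[%classic >>
                           <<s chain_events Y `[0, +oo[%classic >>.
Hypothesis lambda_mono : {homo lambda M : i j / (i <= j)%N >-> j <= i}.
Hypothesis rho_lo0 : 0 < rho_lo.
Hypothesis rho_itv : forall i, rho_lo <= rho M i <= rho_hi.
Hypothesis rho_gt : rr M - gg M + lambda M ord0 < rho_lo.

Local Notation Gf := (filtration_gen P W Y).
Local Notation adapted_to := (adapted_to Gf).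
Local Notation leb := (@lebesgue_measure R).

Let Gm : forall t, Gf t `<=` measurable.
Proof. by move=> t; exact: filtration_gen_measurable. Qed.

Let Fmono s t : s <= t -> <<s Gf s >> `<=` <<s Gf t >>.
Proof. exact: filtration_mono. Qed.

Definition kappa t w := rho M (regY W Y t w) - lambda M (regY W Y t w) + (gg M - rr M).
Definition kappa_lo := rho_lo - lambda M ord0 + (gg M - rr M).
Definition kappa_hi := rho_hi - lambda M ord_max + (gg M - rr M).

Local Notation E := (expmart W Y (sigma M)).
(** [Zp] is built directly in multiplicative form and [X1] is recovered as the quotient by the
    discount factor; [state1E] checks that this quotient is the uncontrolled state. *)
Definition Zp := pot E kappa.
Definition Dp t w := disc (fun s => rho M (regY W Y s w)) t.
Definition X1 t w := Zp t w / Dp t w.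

Lemma kappa_lo_gt0 : 0 < kappa_lo.
Proof. by rewrite /kappa_lo; move: rho_gt; lra. Qed.

Lemma kappa_itv t w : kappa_lo <= kappa t w <= kappa_hi.
Proof.
have /andP[h1 h2] := rho_itv (regY W Y t w).
have h3 : lambda M (regY W Y t w) <= lambda M ord0 by exact: lambda_mono.
have h4 : lambda M ord_max <= lambda M (regY W Y t w) by apply: lambda_mono; exact: leq_ord.
by rewrite /kappa /kappa_lo /kappa_hi !lerD2r lerB//= lerB.
Qed.

Lemma kappa_lo_le_hi : kappa_lo <= kappa_hi.
Proof.
have /andP[h1 h2] := rho_itv ord0.
have h3 : lambda M ord_max <= lambda M ord0 by exact: lambda_mono.
by rewrite /kappa_lo /kappa_hi lerD2r lerB// (le_trans h1).
Qed.

Lemma right_continuous_kappa w : right_continuous_path (kappa ^~ w).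
Proof. exact: (@right_continuous_regY R d Omega W n Y (fun j => rho M j - lambda M j + (gg M - rr M)) w). Qed.

Lemma adapted_kappa : adapted_to kappa.
Proof. exact: (adapted_regY bmW rcY (fun j => rho M j - lambda M j + (gg M - rr M))). Qed.

Let rrho w : right_continuous_path (fun s => rho M (regY W Y s w)).
Proof. exact: (@right_continuous_regY R d Omega W n Y (rho M) w). Qed.
Let rho0 s w : 0 <= rho M (regY W Y s w).
Proof. by have /andP[h _] := rho_itv (regY W Y s w); rewrite (le_trans _ h)// ltW. Qed.
Let rho1 s w : rho M (regY W Y s w) <= rho_hi.
Proof. by have /andP[] := rho_itv (regY W Y s w). Qed.
Let nrho s w : `|rho M (regY W Y s w)| <= rho_hi.
Proof. by rewrite ger0_norm. Qed.

Let cE w : continuous (E ^~ w). Proof. exact: continuous_expmart. Qed.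
Let aE : adapted_to E. Proof. exact: adapted_expmart. Qed.

Lemma Zp_gt0 t w : 0 < Zp t w. Proof. by apply: pot_gt0 => ? ?; exact: expmart_gt0. Qed.
Lemma Dp_gt0 t w : 0 < Dp t w. Proof. exact: disc_gt0. Qed.
Lemma X1_gt0 t w : 0 < X1 t w. Proof. by rewrite divr_gt0 ?Zp_gt0 ?Dp_gt0. Qed.

Lemma continuous_Zp w : continuous (Zp ^~ w).
Proof. exact: (continuous_pot cE right_continuous_kappa kappa_lo_gt0 kappa_itv). Qed.

Lemma continuous_Dp w : continuous (Dp ^~ w).
Proof. exact: (continuous_disc (@rrho w) (fun s => rho0 s w) (fun s => rho1 s w)). Qed.

Lemma continuous_X1 w : continuous (X1 ^~ w).
Proof.
move=> t; apply: cvgM; first exact: continuous_Zp.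
by apply: cvgV; [rewrite gt_eqF// Dp_gt0|exact: continuous_Dp].
Qed.

Lemma continuous_X1V w : continuous (fun t => (X1 t w)^-1).
Proof. by move=> t; apply: cvgV; [rewrite gt_eqF// X1_gt0|exact: continuous_X1]. Qed.

Lemma adapted_Zp : adapted_to Zp.
Proof. exact: (adapted_pot Fmono aE right_continuous_kappa adapted_kappa kappa_lo_gt0 kappa_itv). Qed.

Lemma adapted_Dp : adapted_to Dp.
Proof.
apply: (adapted_to_comp (g := fun x => expR (- x))) => //.
  by apply: measurableT_comp.
exact: (adapted_tint Fmono (adapted_regY bmW rcY (rho M)) (@rrho) nrho).
Qed.

Lemma adapted_inv U : adapted_to U -> (forall t w, 0 < U t w) -> adapted_to (fun t w => (U t w)^-1).
Proof.
move=> aU U0 t t0.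
have -> : (fun w => (U t w)^-1) = (fun w => expR (- ln (U t w))).
  by apply/funext => w; rewrite expRN lnK// posrE.
apply: measurableT_comp => //; apply: measurableT_comp => //.
by apply: measurableT_comp => //; exact: aU.
Qed.

Lemma adapted_X1 : adapted_to X1.
Proof.
apply: adapted_toM; first exact: adapted_Zp.
by apply: adapted_inv; [exact: adapted_Dp|exact: Dp_gt0].
Qed.

Lemma discountE t w : regular_paths W Y w -> 0 <= t -> discount M Y t w = Dp t w.
Proof.
move=> rw t0; rewrite /discount /Dp /disc /tint; congr (expR (- _)).
apply: eq_Rintegral => s; rewrite inE/= in_itv/= => /andP[s0 _].
by rewrite regYE.
Qed.

Lemma state1E t w : regular_paths W Y w -> 0 <= t -> state1 M W Y t w = X1 t w.
Proof.
move=> rw t0; pose f s := rho M (regY W Y s w); pose g s := lambda M (regY W Y s w).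
have rf : right_continuous_path f by exact: (@right_continuous_regY R d Omega W n Y (rho M) w).
have rg : right_continuous_path g by exact: (@right_continuous_regY R d Omega W n Y (lambda M) w).
pose C := \sum_j (`|rho M j| + `|lambda M j|).
have Cj j : `|rho M j| + `|lambda M j| <= C.
  by rewrite /C (bigD1 j)//= lerDl sumr_ge0// => k _; rewrite addr_ge0.
have fC s : `|f s| <= C by rewrite (le_trans _ (Cj (regY W Y s w)))// lerDl.
have gC s : `|g s| <= C by rewrite (le_trans _ (Cj (regY W Y s w)))// lerDr.
rewrite /X1 /Zp /pot /Dp /disc /kappa -/f (tint_affine (gg M - rr M) rf rg fC gC t0).
rewrite /expmart regWE// max_l// -expRN -!expRD /state1; congr expR.
have -> : \int[leb]_(s in `[0, t]) lambda M (Y s w) = tint g t.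
  by apply: eq_Rintegral => s; rewrite inE/= in_itv/= => /andP[s0 _]; rewrite /g regYE.
by generalize (tint f t) (tint g t) (W t w) => a b c; ring.
Qed.

Lemma DpX1 t w : Dp t w * X1 t w = Zp t w.
Proof. by rewrite /X1 mulrCA mulfV ?mulr1// gt_eqF// Dp_gt0. Qed.

Lemma integral_Zp_total (L : R -> Omega -> R) : adapted_to L ->
  (forall w, increasing_path (L ^~ w)) ->
  (\int[P]_w \int[stieltjes (L ^~ w)]_(s in `[0%R, +oo[) (Zp s w)%:E =
   \int[P]_w \int[leb]_(s in `[0%R, +oo[) (kappa s w * Zp s w * L s w)%:E)%E.
Proof.
apply: (integral_pot_total Gm Fmono (fun t w => expmart_gt0 W Y (sigma M) t w) cE aE _ _ _
  right_continuous_kappa adapted_kappa kappa_lo_gt0 kappa_itv).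
- by move=> s t C; exact: martingale_expmart.
- by move=> s t C; exact: submartingale_expmart_sq.
- by move=> t t0; exact: expmart_sq_fin.
Qed.

Lemma integral_Zp_le t : 0 <= t -> (\int[P]_w (Zp t w)%:E <= (expR (- (kappa_lo * t)))%:E)%E.
Proof.
move=> t0; apply: (@le_trans _ _ (\int[P]_w ((expR (- (kappa_lo * t)))%:E * (E t w)%:E))%E).
  apply: ge0_le_integral => //.
  - by move=> w _; rewrite lee_fin ltW// Zp_gt0.
  - by apply/measurable_EFinP; exact: (adapted_toW Gm adapted_Zp).
  - by apply: measurable_funeM; apply/measurable_EFinP; exact: (adapted_toW Gm aE).
  - move=> w _; rewrite -EFinM lee_fin /Zp /pot mulrC ler_wpM2r ?(ltW (expmart_gt0 _ _ _ _ _))//.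
    exact: (disc_le_expR (@right_continuous_kappa w) (fun s => kappa_itv s w) (ltW kappa_lo_gt0) t0).
rewrite ge0_integralZl//=; last 2 first.
- by apply/measurable_EFinP; exact: (adapted_toW Gm aE).
- by move=> w _; rewrite lee_fin expR_ge0.
rewrite (@martingale_expmart _ _ _ P W n Y Pcomplete bmW mY rcY indepWY (sigma M) 0 t)//; last first.
  exact: (@measurableT _ (g_sigma_algebraType (Gf 0))).
under eq_integral do rewrite expmart0.
by rewrite integral_cst// mul1e [X in (_ * X)%E](_ : _ = 1%E) ?mule1//; exact: probability_setT.
Qed.

Let mo : measurable (`[(0 : R), +oo[%classic : set R). Proof. exact: measurable_itv. Qed.

Let joint_fin (U : R -> Omega -> R) (k : R) : adapted_to U -> (forall w, left_continuous_path (U ^~ w)) ->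
  (forall t w, 0 <= U t w) -> 0 < k ->
  (forall t, 0 <= t -> (\int[P]_w (U t w)%:E <= (expR (- (k * t)))%:E)%E) ->
  (\int[P]_w \int[leb]_(s in `[0%R, +oo[) (U s w)%:E < +oo)%E.
Proof.
move=> aU lU U0 k0 Uk.
have mU : measurable_fun ([set: Omega] `*` `[(0 : R), +oo[%classic) (fun z : Omega * R => (U z.2 z.1)%:E).
  by apply/measurable_EFinP; exact: (adapted_joint_lc Gm aU lU).
have U0' (z : Omega * R) : `[(0 : R), +oo[%classic z.2 -> (0 <= (U z.2 z.1)%:E)%E by rewrite lee_fin.
rewrite (tonelli_left P mo mU U0') -(tonelli_right P mo mU U0').
apply: (@le_lt_trans _ _ (\int[leb]_(s in `[0%R, +oo[) (expR (- (k * s)))%:E)%E).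
  apply: ge0_le_integral => //.
  - by move=> s _; apply: integral_ge0 => w _; rewrite lee_fin.
  - exact: (measurable_tonelli_time P mo mU U0').
  - apply/measurable_EFinP; apply: measurable_funTS; apply: measurableT_comp => //.
    by apply: measurableT_comp => //; exact: measurable_funM.
  - by move=> s; rewrite /= in_itv/= andbT => s0; exact: Uk.
by rewrite integral_expR_decay// ltry.
Qed.

Lemma Zp_fin : (\int[P]_w \int[leb]_(s in `[0%R, +oo[) (Zp s w)%:E < +oo)%E.
Proof.
apply: (joint_fin adapted_Zp _ _ kappa_lo_gt0 integral_Zp_le).
- by move=> w; exact: continuous_left_path (@continuous_Zp w).
- by move=> t w; exact: ltW (Zp_gt0 t w).
Qed.

Lemma Dp_fin : (\int[P]_w \int[leb]_(s in `[0%R, +oo[) (Dp s w)%:E < +oo)%E.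
Proof.
apply: (joint_fin adapted_Dp _ _ rho_lo0).
- by move=> w; exact: continuous_left_path (@continuous_Dp w).
- by move=> t w; exact: ltW (Dp_gt0 t w).
move=> t t0; apply: (@le_trans _ _ (\int[P]_w (expR (- (rho_lo * t)))%:E)%E); last first.
  by rewrite integral_cst// [X in (_ * X)%E](_ : _ = 1%E) ?mule1//; exact: probability_setT.
apply: ge0_le_integral => //.
- by move=> w _; rewrite lee_fin ltW// Dp_gt0.
- by apply/measurable_EFinP; exact: (adapted_toW Gm adapted_Dp).
- move=> w _; rewrite lee_fin.
  exact: (disc_le_expR (@rrho w) (fun s => rho_itv (regY W Y s w)) (ltW rho_lo0) t0).
Qed.

Hypothesis c2_gt0 : 0 < c2 M.
Hypothesis c12 : c2 M < c1 M.
Hypothesis hA : forall i, running_cost_assumptions M m i.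

Lemma kappa_hi_gt0 : 0 < kappa_hi.
Proof. exact: lt_le_trans kappa_lo_gt0 kappa_lo_le_hi. Qed.

Lemma kappa_gt0 t w : 0 < kappa t w.
Proof. by case/andP: (kappa_itv t w) => h _; exact: lt_le_trans kappa_lo_gt0 h. Qed.

Lemma continuous_h j : continuous (h M ^~ j).
Proof.
move=> y; have [y0|y0] := leP 0 y.
  exact/differentiable_continuous/derivable1_diffP/(h_derivable (hA j)).
rewrite /continuous_at (h_le0 (hA j) (ltW y0)); apply: cvg_near_cst.
near=> z; rewrite (h_le0 (hA j))//; apply: ltW; near: z; exact: lt_nbhsl.
Unshelve. all: by end_near. Qed.

Lemma h_mid_lt j y z : 0 <= y -> 0 <= z -> y != z ->
  h M ((y + z) / 2) j < (h M y j + h M z j) / 2.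
Proof.
move=> y0 z0 yz; have h2 : 0 < (2^-1 : R) < 1 by rewrite invr_gt0 invf_lt1 ?ltr1n ?ltr0n.
have := h_strictly_convex (hA j) y0 z0 yz h2.
have -> : 2^-1 * y + (1 - 2^-1) * z = (y + z) / 2 by field.
by have -> : 2^-1 * h M y j + (1 - 2^-1) * h M z j = (h M y j + h M z j) / 2 by field.
Qed.

Lemma h_mid_le j y z : 0 <= y -> 0 <= z -> h M ((y + z) / 2) j <= (h M y j + h M z j) / 2.
Proof.
move=> y0 z0; have [->|yz] := eqVneq y z; last exact/ltW/h_mid_lt.
have half (r : R) : (r + r) / 2 = r by field.
by rewrite !half.
Qed.

(** In the slope, [c2 M * kappa_hi] pays for the linear term with negative sign in [pcost], and the
    extra 1 leaves one copy of the state, needed for coercivity. There are finitely many regimes, so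
    one [K] serves all. *)
Lemma h_bound : exists2 K, 0 < K &
  forall j y, 0 <= y -> (c2 M * kappa_hi + 1) * y - h M y j <= K.
Proof.
have p0 : 0 < c2 M * kappa_hi + 1 by rewrite addr_gt0// mulr_gt0// kappa_hi_gt0.
have H j : exists Kj : R, forall y, 0 <= y -> (c2 M * kappa_hi + 1) * y - h M y j <= Kj.
  have := h_conjugate (hA j) p0; set S := ereal_sup _ => Sfin.
  have SU y : 0 <= y -> (((c2 M * kappa_hi + 1) * y - h M y j)%:E <= S)%E.
    by move=> y0; apply: ereal_sup_ubound; exists y => //=; rewrite in_itv/= y0.
  exists (fine S) => y y0; rewrite -lee_fin fineK; first exact: SU.
  rewrite fin_numElt Sfin andbT; apply: lt_le_trans (SU 0 (lexx 0)); exact: ltNyr.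
have [K HK] := choice H.
exists (1 + \sum_j `|K j|); first by rewrite ltr_pwDl// sumr_ge0.
move=> j y y0; apply: le_trans (HK j y y0) _.
by rewrite (bigD1 j)//= (le_trans (ler_norm _))// addrCA lerDl addr_ge0// sumr_ge0.
Qed.

Variables (x K : R).
Hypothesis x0 : 0 <= x.
Hypothesis K0 : 0 < K.
Hypothesis hK : forall j y, 0 <= y -> (c2 M * kappa_hi + 1) * y - h M y j <= K.

(* the integrand of [Psi], at [L1 = a] and [L2 = b] *)
Definition pcost t w a b : R :=
  Dp t w * (h M (X1 t w * (x + a - b)) (regY W Y t w)
            - c2 M * kappa t w * (X1 t w * (x + a - b)) + K
            + (c1 M - c2 M) * kappa t w * (X1 t w * b)).

Let Dp0 t w : 0 <= Dp t w := ltW (Dp_gt0 t w).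

Let dom_ge0 t w a b : domain x a b -> 0 <= X1 t w * (x + a - b).
Proof. by case=> a0 b0 bxa; rewrite mulr_ge0 ?(ltW (X1_gt0 t w))// subr_ge0. Qed.

Let bound_aux (A B C y hh : R) : B + y - hh <= A -> C <= B -> y <= hh - C + A.
Proof. lra. Qed.

(** The source of nonnegativity, coercivity and integrability: the spare unit of slope in [h_bound]
    leaves the discounted state, and [c2 M < c1 M] leaves a multiple of [b]. *)
Lemma pcost_ge t w a b : domain x a b ->
  Dp t w * (X1 t w * (x + a - b)) + (c1 M - c2 M) * kappa_lo * (Zp t w * b) <= pcost t w a b.
Proof.
move=> dab; have y0 := dom_ge0 t w dab; case: (dab) => _ b0 _.
have -> : Dp t w * (X1 t w * (x + a - b)) + (c1 M - c2 M) * kappa_lo * (Zp t w * b) =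
    Dp t w * (X1 t w * (x + a - b) + (c1 M - c2 M) * kappa_lo * (X1 t w * b)).
  rewrite -DpX1; generalize (Dp t w) (X1 t w) kappa_lo => D X k; ring.
rewrite /pcost ler_wpM2l//.
case/andP: (kappa_itv t w) => k1 k2.
apply: lerD.
  have hy := hK (regY W Y t w) y0; rewrite mulrDl mul1r in hy.
  have : c2 M * kappa t w * (X1 t w * (x + a - b)) <= c2 M * kappa_hi * (X1 t w * (x + a - b)).
    by rewrite ler_wpM2r// ler_pM2l.
  by move: hy; apply: bound_aux.
apply: ler_wpM2r; first exact: (mulr_ge0 (ltW (X1_gt0 t w)) b0).
by rewrite ler_pM2l// subr_gt0.
Qed.

Lemma pcost_ge0 t w a b : domain x a b -> 0 <= pcost t w a b.
Proof.
move=> dab; apply: le_trans (pcost_ge t w dab); case: (dab) => _ b0 _.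
have h1 := dom_ge0 t w dab; have h2 := ltW kappa_lo_gt0; have h3 := ltW (Zp_gt0 t w).
have h4 : 0 <= c1 M - c2 M by rewrite subr_ge0 ltW.
by apply: addr_ge0; apply: mulr_ge0 => //; exact: mulr_ge0.
Qed.

Let mid_aux (D A B C k1 k2 X y z b b' : R) : 0 <= D -> A <= (B + C) / 2 ->
  D * (A - k1 * ((y + z) / 2) + K + k2 * (X * ((b + b') / 2))) <=
  (D * (B - k1 * y + K + k2 * (X * b)) + D * (C - k1 * z + K + k2 * (X * b'))) / 2.
Proof. by move=> D0 ABC; rewrite -mulrDr -mulrA ler_wpM2l//; lra. Qed.

Let mid_aux_lt (D A B C k1 k2 X y z b b' : R) : 0 < D -> A < (B + C) / 2 ->
  D * (A - k1 * ((y + z) / 2) + K + k2 * (X * ((b + b') / 2))) <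
  (D * (B - k1 * y + K + k2 * (X * b)) + D * (C - k1 * z + K + k2 * (X * b'))) / 2.
Proof. by move=> D0 ABC; rewrite -mulrDr -mulrA ltr_pM2l//; lra. Qed.

Lemma pcost_mid t w a b a' b' : domain x a b -> domain x a' b' ->
  pcost t w ((a + a') / 2) ((b + b') / 2) <= (pcost t w a b + pcost t w a' b') / 2.
Proof.
move=> d1 d2; have y0 := dom_ge0 t w d1; have z0 := dom_ge0 t w d2.
have := h_mid_le (regY W Y t w) y0 z0; rewrite /pcost.
have -> : X1 t w * (x + (a + a') / 2 - (b + b') / 2) =
  (X1 t w * (x + a - b) + X1 t w * (x + a' - b')) / 2 by field.
exact: mid_aux.
Qed.

(** [pcost] is strictly convex only through the state, which depends on [a - b]; hence a conclusion
    about differences alone. *)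
Lemma pcost_strict t w a b a' b' : domain x a b -> domain x a' b' ->
  (pcost t w a b + pcost t w a' b') / 2 <= pcost t w ((a + a') / 2) ((b + b') / 2) ->
  a - b = a' - b'.
Proof.
move=> d1 d2 H; have y0 := dom_ge0 t w d1; have z0 := dom_ge0 t w d2.
have [e|yz] := eqVneq (X1 t w * (x + a - b)) (X1 t w * (x + a' - b')).
  by move/(mulfI (lt0r_neq0 (X1_gt0 t w))) : e; lra.
have := h_mid_lt (regY W Y t w) y0 z0 yz; move: H; rewrite leNgt => /negP H hlt; exfalso; apply: H.
rewrite /pcost.
have -> : X1 t w * (x + (a + a') / 2 - (b + b') / 2) =
  (X1 t w * (x + a - b) + X1 t w * (x + a' - b')) / 2 by field.
by apply: mid_aux_lt; [exact: Dp_gt0|exact: hlt].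
Qed.

Lemma pcost_cvg t w (a b : nat -> R) a' b' :
  a n @[n --> \oo] --> a' -> b n @[n --> \oo] --> b' ->
  pcost t w (a n) (b n) @[n --> \oo] --> pcost t w a' b'.
Proof.
move=> ca cb.
have cy : X1 t w * (x + a n - b n) @[n --> \oo] --> X1 t w * (x + a' - b').
  by apply: cvgM; [exact: cvg_cst|apply: cvgB => //; apply: cvgD => //; exact: cvg_cst].
apply: cvgM; first exact: cvg_cst.
apply: cvgD; last by apply: cvgM; [exact: cvg_cst|apply: cvgM => //; exact: cvg_cst].
apply: cvgD; last exact: cvg_cst.
apply: cvgB; last by apply: cvgM; [exact: cvg_cst|exact: cy].
exact: (cvg_comp_seq (@continuous_h (regY W Y t w)) cy).
Qed.

Lemma pcost_coercive t w : exists del C : R, 0 < del /\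
  forall a b, domain x a b -> del * (a + b) <= pcost t w a b + C.
Proof.
pose e := (c1 M - c2 M) * kappa_lo.
have e0 : 0 < e by rewrite mulr_gt0 ?subr_gt0// kappa_lo_gt0.
(* With [y = x + a - b], the product [(y + e * b) * (1 + 2 / e)] is at least [y + 2 * b], which is
   at least [a + b] because [x] is nonnegative. *)
exists (Zp t w / (1 + 2 / e)), 0; split; first by rewrite divr_gt0 ?Zp_gt0// addr_gt0// divr_gt0.
move=> a b dab; rewrite addr0; apply: le_trans (pcost_ge t w dab).
rewrite mulrA DpX1 -/e mulrCA -mulrDr -mulrA ler_pM2l ?Zp_gt0//.
rewrite mulrC ler_pdivrMr; last by rewrite addr_gt0// divr_gt0.
case: dab => a0 b0 bxa.
have -> : (x + a - b + e * b) * (1 + 2 / e) = (x + a - b) * (1 + 2 / e) + e * b + 2 * b.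
  by field; rewrite gt_eqF.
have : x + a - b <= (x + a - b) * (1 + 2 / e).
  by rewrite ler_peMr ?subr_ge0// lerDl divr_ge0// ltW.
have : 0 <= e * b by rewrite mulr_ge0// ltW.
move: x0; lra.
Qed.

Let mDD : measurable ([set: Omega] `*` `[(0 : R), +oo[%classic). Proof. exact: measurableX. Qed.

Lemma joint_lc U : adapted_to U -> (forall w, continuous (U ^~ w)) ->
  measurable_fun ([set: Omega] `*` `[(0 : R), +oo[%classic) (fun z : Omega * R => U z.2 z.1).
Proof. by move=> aU cU; apply: (adapted_joint_lc Gm aU) => w; exact: continuous_left_path. Qed.

Lemma joint_h (U : R -> Omega -> R) :
  measurable_fun ([set: Omega] `*` `[(0 : R), +oo[%classic) (fun z : Omega * R => U z.2 z.1) ->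
  measurable_fun ([set: Omega] `*` `[(0 : R), +oo[%classic)
    (fun z : Omega * R => h M (U z.2 z.1) (regY W Y z.2 z.1)).
Proof.
move=> mU; apply: (@eq_measurable_fun _ _ _ _ _ (fun z : Omega * R =>
    \sum_j h M (U z.2 z.1) j * (regY W Y z.2 z.1 == j)%:R)).
  move=> z _; rewrite (bigD1 (regY W Y z.2 z.1))//= eqxx mulr1 big1 ?addr0// => j jY.
  by rewrite eq_sym (negbTE jY) mulr0.
apply: measurable_sum => j; apply: measurable_funM.
  apply: (@measurableT_comp _ _ _ _ _ _ (h M ^~ j)) => //.
  by apply: continuous_measurable_fun; exact: continuous_h.
apply: (adapted_joint_rc (U := fun t w => (regY W Y t w == j)%:R) Gm).
  exact: (adapted_regY bmW rcY (fun k => (k == j)%:R)).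
exact: (fun w => @right_continuous_regY R d Omega W n Y (fun k => (k == j)%:R) w).
Qed.

Lemma joint_kappa :
  measurable_fun ([set: Omega] `*` `[(0 : R), +oo[%classic) (fun z : Omega * R => kappa z.2 z.1).
Proof. exact: (adapted_joint_rc Gm adapted_kappa (@right_continuous_kappa)). Qed.

Lemma measurable_pcost (u : proc_pair) : feasible Gf x u ->
  measurable_fun ([set: Omega] `*` `[(0 : R), +oo[%classic)
   (fun z : Omega * R => pcost z.2 z.1 (u.1 z.2 z.1) (u.2 z.2 z.1)).
Proof.
move=> fu.
have m1 := adapted_joint_lc Gm (fs_adapted1 fu) (fun w => ip_lc (fs_path1 fu w)).
have m2 := adapted_joint_lc Gm (fs_adapted2 fu) (fun w => ip_lc (fs_path2 fu w)).
have mX := joint_lc adapted_X1 (@continuous_X1).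
have mD := joint_lc adapted_Dp (@continuous_Dp).
have mk := joint_kappa.
have my : measurable_fun ([set: Omega] `*` `[(0 : R), +oo[%classic)
    (fun z : Omega * R => X1 z.2 z.1 * (x + u.1 z.2 z.1 - u.2 z.2 z.1)).
  apply: measurable_funM => //; apply: measurable_funB => //.
  by apply: measurable_funD.
have mh := joint_h (U := fun t w => X1 t w * (x + u.1 t w - u.2 t w)) my.
apply: measurable_funM => //; apply: measurable_funD.
  apply: measurable_funD => //; apply: measurable_funB => //.
  by apply: measurable_funM => //; apply: measurable_funM.
apply: measurable_funM; last by apply: measurable_funM.
by apply: measurable_funM.
Qed.

Local Notation Psi := (total P pcost).

Lemma Psi_minimiser : (exists2 u, feasible Gf x u & (Psi u < +oo)%E) ->
  exists2 u, feasible Gf x u & forall v, feasible Gf x v -> (Psi u <= Psi v)%E.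
Proof.
apply: (minimiser_exists Gm Fmono (@filtration_gen_null _ _ _ P W n Y) x0).
- exact: measurable_pcost.
- by move=> t w a b _; exact: pcost_ge0.
- by move=> t w a b a' b' _; exact: pcost_mid.
- by move=> t w a b a' b' _ _ _; exact: pcost_cvg.
- by move=> t w _; exact: pcost_coercive.
Qed.

Definition iter_int (f : R -> Omega -> R) : \bar R :=
  (\int[P]_w \int[leb]_(s in `[0%R, +oo[) (f s w)%:E)%E.

Definition joint_meas (f : R -> Omega -> R) :=
  measurable_fun ([set: Omega] `*` `[(0 : R), +oo[%classic) (fun z : Omega * R => f z.2 z.1).

Definition time_ge0 (f : R -> Omega -> R) := forall t w, 0 <= t -> 0 <= f t w.

Local Notation DD := ([set: Omega] `*` `[(0 : R), +oo[%classic).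
Local Notation mu := (P \x leb)%E.

Lemma iter_intE f : joint_meas f -> time_ge0 f ->
  iter_int f = (\int[mu]_(z in DD) (f z.2 z.1)%:E)%E.
Proof.
move=> mf f0; have mf' : measurable_fun DD (fun z : Omega * R => (f z.2 z.1)%:E) by exact/measurable_EFinP.
have f0' (z : Omega * R) : `[(0 : R), +oo[%classic z.2 -> (0 <= (f z.2 z.1)%:E)%E.
  by rewrite /= in_itv/= andbT => z0; rewrite lee_fin f0.
by rewrite -(tonelli_left P mo mf' f0').
Qed.

Let DD0 (z : Omega * R) : DD z -> 0 <= z.2.
Proof. by move=> [_ /=]; rewrite in_itv/= andbT. Qed.

Lemma iter_int_ge0 f : time_ge0 f -> (0 <= iter_int f)%E.
Proof.
move=> f0; apply: integral_ge0 => w _; apply: integral_ge0 => s; rewrite /= in_itv/= andbT => s0.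
by rewrite lee_fin f0.
Qed.

Lemma iter_intD f g : joint_meas f -> joint_meas g -> time_ge0 f -> time_ge0 g ->
  iter_int (fun t w => f t w + g t w) = (iter_int f + iter_int g)%E.
Proof.
move=> mf mg f0 g0.
have mfg : joint_meas (fun t w => f t w + g t w) by exact: measurable_funD.
have fg0 : time_ge0 (fun t w => f t w + g t w) by move=> t w t0; rewrite addr_ge0 ?f0 ?g0.
rewrite !iter_intE// -ge0_integralD//.
- by move=> z /DD0 z0; rewrite lee_fin f0.
- exact/measurable_EFinP.
- by move=> z /DD0 z0; rewrite lee_fin g0.
- exact/measurable_EFinP.
Qed.

Lemma iter_intZ c f : 0 <= c -> joint_meas f -> time_ge0 f ->
  iter_int (fun t w => c * f t w) = (c%:E * iter_int f)%E.
Proof.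
move=> c0 mf f0.
have mcf : joint_meas (fun t w => c * f t w) by apply: measurable_funM.
have cf0 : time_ge0 (fun t w => c * f t w) by move=> t w t0; rewrite mulr_ge0 ?f0.
rewrite !iter_intE// -ge0_integralZl//.
- exact/measurable_EFinP.
- by move=> z /DD0 z0; rewrite lee_fin f0.
Qed.

Lemma le_iter_int f g : joint_meas f -> joint_meas g -> time_ge0 f ->
  (forall t w, 0 <= t -> f t w <= g t w) -> (iter_int f <= iter_int g)%E.
Proof.
move=> mf mg f0 fg.
have g0 : time_ge0 g by move=> t w t0; rewrite (le_trans (f0 t w t0))// fg.
rewrite !iter_intE//; apply: ge0_le_integral => //.
- by move=> z /DD0 z0; rewrite lee_fin f0.
- exact/measurable_EFinP.
- exact/measurable_EFinP.
- by move=> z /DD0 z0; rewrite lee_fin fg.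
Qed.

Lemma eq_iter_int f g : (forall t w, 0 <= t -> f t w = g t w) -> iter_int f = iter_int g.
Proof.
move=> fg; apply: eq_integral => w _; apply: eq_integral => s.
by rewrite inE/= in_itv/= andbT => s0; rewrite fg.
Qed.

Let jX : joint_meas X1. Proof. exact: (joint_lc adapted_X1 (@continuous_X1)). Qed.
Let jD : joint_meas Dp. Proof. exact: (joint_lc adapted_Dp (@continuous_Dp)). Qed.
Let jZ : joint_meas Zp. Proof. exact: (joint_lc adapted_Zp (@continuous_Zp)). Qed.
Let jkZ : joint_meas (fun t w => kappa t w * Zp t w).
Proof. by apply: measurable_funM; [exact: joint_kappa|exact: jZ]. Qed.
Let kZ0 t w : 0 <= kappa t w * Zp t w.
Proof. by rewrite mulr_ge0// ltW ?kappa_gt0 ?Zp_gt0. Qed.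
Let jkZL L : adapted_to L -> (forall w, increasing_path (L ^~ w)) ->
  joint_meas (fun t w => kappa t w * Zp t w * L t w).
Proof.
move=> aL IL; apply: measurable_funM; first exact: jkZ.
exact: (adapted_joint_lc Gm aL (fun w => ip_lc (IL w))).
Qed.
Let kZL0 L : (forall w, increasing_path (L ^~ w)) -> time_ge0 (fun t w => kappa t w * Zp t w * L t w).
Proof. by move=> IL t w t0; rewrite mulr_ge0// (ip_ge0 (IL w)). Qed.

Definition rate_int (L : R -> Omega -> R) := iter_int (fun t w => kappa t w * Zp t w * L t w).

Definition running (u : proc_pair) t w :=
  Dp t w * h M (X1 t w * (x + u.1 t w - u.2 t w)) (regY W Y t w).

Lemma iter_Zp_fin : (iter_int (fun t w => kappa t w * Zp t w)%R < +oo)%E.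
Proof.
apply: (@le_lt_trans _ _ (iter_int (fun t w => kappa_hi * Zp t w))).
  apply: le_iter_int => //; first by apply: measurable_funM.
  by move=> t w _; rewrite ler_wpM2r ?(ltW (Zp_gt0 t w))//; case/andP: (kappa_itv t w).
rewrite iter_intZ ?(ltW kappa_hi_gt0)//; last by move=> t w _; exact: ltW (Zp_gt0 t w).
by rewrite lte_mul_pinfty// ?Zp_fin// lee_fin ltW// kappa_hi_gt0.
Qed.

Lemma joint_running u : feasible Gf x u -> joint_meas (running u).
Proof.
move=> fu; apply: measurable_funM; first exact: jD.
apply: (joint_h (U := fun t w => X1 t w * (x + u.1 t w - u.2 t w))).
apply: measurable_funM; first exact: jX.
apply: measurable_funB; last exact: (adapted_joint_lc Gm (fs_adapted2 fu) (fun w => ip_lc (fs_path2 fu w))).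
by apply: measurable_funD => //; exact: (adapted_joint_lc Gm (fs_adapted1 fu) (fun w => ip_lc (fs_path1 fu w))).
Qed.

Lemma running_ge0 u : time_ge0 (running u).
Proof. by move=> t w _; rewrite mulr_ge0// (h_ge0 (hA _)). Qed.

(** Pointwise this is algebra with [Zp = Dp * X1]; all negative terms are moved across so that every
    integral is nonnegative and no indeterminate difference can occur. *)
Lemma Psi_split u : feasible Gf x u ->
  (Psi u + (c2 M * x)%:E * iter_int (fun t w => kappa t w * Zp t w)%R + (c2 M)%:E * rate_int u.1 =
   iter_int (running u) + K%:E * iter_int Dp + (c1 M)%:E * rate_int u.2)%E.
Proof.
move=> fu.
have c20 := ltW c2_gt0; have c10 : 0 <= c1 M by rewrite (le_trans c20)// ltW.
have j1 := jkZL (fs_adapted1 fu) (fs_path1 fu); have j2 := jkZL (fs_adapted2 fu) (fs_path2 fu).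
have g1 := kZL0 (fs_path1 fu); have g2 := kZL0 (fs_path2 fu).
have jp : joint_meas (fun t w => pcost t w (u.1 t w) (u.2 t w)) by exact: measurable_pcost.
have p0 : time_ge0 (fun t w => pcost t w (u.1 t w) (u.2 t w)).
  by move=> t w t0; apply: pcost_ge0; exact: (feasible_domain w fu t0).
have jr := joint_running fu; have r0 := @running_ge0 u.
have D0 : time_ge0 Dp by move=> t w _; exact: Dp0.
have kz0 : time_ge0 (fun t w => kappa t w * Zp t w) by move=> t w _; exact: kZ0.
have cx0 : 0 <= c2 M * x by rewrite mulr_ge0.
have sc c f : 0 <= c -> joint_meas f -> time_ge0 f ->
    joint_meas (fun t w => c * f t w) /\ time_ge0 (fun t w => c * f t w).
  by move=> c0 jf f0; split; [apply: measurable_funM|move=> t w t0; rewrite mulr_ge0// f0].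
have ad f g : joint_meas f -> time_ge0 f -> joint_meas g -> time_ge0 g ->
    joint_meas (fun t w => f t w + g t w) /\ time_ge0 (fun t w => f t w + g t w).
  by move=> jf f0 jg g0; split; [apply: measurable_funD|move=> t w t0; rewrite addr_ge0 ?f0 ?g0].
have [s1 s1'] := sc _ _ cx0 jkZ kz0.
have [s2 s2'] := sc _ _ c20 j1 g1.
have [s3 s3'] := sc _ _ (ltW K0) jD D0.
have [s4 s4'] := sc _ _ c10 j2 g2.
have [a1 a1'] := ad _ _ jp p0 s1 s1'.
have [a2 a2'] := ad _ _ jr r0 s3 s3'.
rewrite /rate_int -(iter_intZ cx0 jkZ kz0) -(iter_intZ c20 j1 g1) -(iter_intZ (ltW K0) jD D0)
  -(iter_intZ c10 j2 g2).
have -> : Psi u = iter_int (fun t w => pcost t w (u.1 t w) (u.2 t w)) by [].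
rewrite -(iter_intD jp s1 p0 s1') -(iter_intD a1 s2 a1' s2') -(iter_intD jr s3 r0 s3').
rewrite -(iter_intD a2 s4 a2' s4'); apply: eq_iter_int => t w _.
rewrite /pcost /running -!DpX1.
move: (Dp t w) (X1 t w) (kappa t w) (u.1 t w) (u.2 t w) (h M _ _) => D X k a b hh.
ring.
Qed.

Lemma Psi_finite : exists2 u, feasible Gf x u & (Psi u < +oo)%E.
Proof.
(* The whole initial state is withdrawn at time 0; afterwards the state is 0, where the running cost
   vanishes. *)
pose L (t : R) (w : Omega) : R := x * (0 < t)%R%:R.
have fu : feasible Gf x ((fun (_ : R) (_ : Omega) => 0 : R), L).
  split => /=.
  - by move=> t t0; exact: measurable_cst.
  - by move=> t t0; exact: measurable_cst.
  - by move=> w; split => // t t0; exact: cvg_cst.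
  - move=> w; split; first by rewrite /L ltxx mulr0.
    + move=> s t; rewrite !in_itv/= !andbT => s0 t0 st; rewrite /L ler_wpM2l// ler_nat.
      by have [s1|//] := ltP 0 s; rewrite (lt_le_trans s1 st).
    + move=> t t0; apply: cvg_near_cst; near=> s; rewrite /L t0.
      by have -> : 0 < s by near: s; exact: nbhs_left_gt.
  - by move=> t w t0; rewrite addr0 /L; case: (0 < t); rewrite ?mulr1 ?mulr0.
exists ((fun (_ : R) (_ : Omega) => 0 : R), L) => //.
pose f t w := K * Dp t w + (c1 M - c2 M) * x * (kappa t w * Zp t w).
have cx0 : 0 <= (c1 M - c2 M) * x by rewrite mulr_ge0// subr_ge0 ltW.
have D0 : time_ge0 Dp by move=> t w _; exact: Dp0.
have kz0 : time_ge0 (fun t w => kappa t w * Zp t w) by move=> t w _; exact: kZ0.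
apply: (@le_lt_trans _ _ (iter_int f)).
  rewrite le_eqVlt; apply/orP; left; apply/eqP; apply: eq_integral => w _ /=.
  have m1 := measurable_section_time w mo (proj2 (measurable_EFinP _ _) (measurable_pcost fu)).
  have mf : measurable_fun `[(0 : R), +oo[%classic (fun s => (f s w)%:E).
    apply: (@measurable_section_time _ _ _ _ (fun z : Omega * R => (f z.2 z.1)%:E) w mo).
    by apply/measurable_EFinP; apply: measurable_funD; apply: measurable_funM.
  (* By left continuity the withdrawal has not yet acted at time 0, so the two integrands are
     compared only at positive times. *)
  have So : `](0 : R), +oo[%classic `<=` `[(0 : R), +oo[%classic.
    by move=> s /=; rewrite !in_itv/= !andbT => /ltW.
  rewrite -integral_itv_obnd_cbnd; last exact: measurable_funS m1.
  rewrite -[RHS]integral_itv_obnd_cbnd; last exact: measurable_funS mf.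
  apply: eq_integral => s; rewrite inE/= in_itv/= andbT => s0; congr EFin.
  rewrite /pcost /f /L s0 mulr1 addr0 subrr mulr0 (h_le0 (hA _) (lexx 0)) -DpX1.
  move: (Dp s w) (X1 s w) (kappa s w) => D X k; ring.
rewrite /f iter_intD; last 4 first.
- by apply: measurable_funM.
- by apply: measurable_funM.
- by move=> t w _; rewrite mulr_ge0// ltW.
- by move=> t w _; rewrite mulr_ge0.
rewrite (iter_intZ (ltW K0) jD D0) (iter_intZ cx0 jkZ kz0).
by rewrite lte_add_pinfty// lte_mul_pinfty// ?lee_fin ?(ltW K0) ?Dp_fin ?iter_Zp_fin.
Unshelve. all: by end_near. Qed.

Let max_aux (a b : R) : Num.max (a - b) 0 + b = a + Num.max (- (a - b)) 0.
Proof.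
have [ab|ab] := leP a b.
  by rewrite max_r ?subr_le0// max_l ?oppr_ge0 ?subr_le0//; ring.
by rewrite max_l ?subr_ge0 ?(ltW ab)// max_r ?oppr_le0 ?subr_ge0 ?(ltW ab)// subrK addr0.
Qed.

(** Only [g] is assumed integrable: the integral of [f] may be infinite, as the running cost may be.
    The difference is handled through its positive and negative parts, the latter being dominated by
    [g]. *)
Lemma integral_subK (f g : Omega -> \bar R) : measurable_fun setT f -> measurable_fun setT g ->
  (forall w, 0 <= f w)%E -> (forall w, 0 <= g w)%E -> (\int[P]_w g w < +oo)%E ->
  (\int[P]_w (f w - g w) + \int[P]_w g w = \int[P]_w f w)%E.
Proof.
move=> mf mg f0 g0 gfin.
have ig : P.-integrable setT g.
  by apply/integrableP; split => //; under eq_integral do rewrite gee0_abs//.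
have mfg : measurable_fun setT (fun w => f w - g w)%E by exact: emeasurable_funB.
pose p := (fun w => f w - g w)^\+%E; pose q := (fun w => f w - g w)^\-%E.
have mp : measurable_fun setT p by exact: measurable_funepos.
have mq : measurable_fun setT q by exact: measurable_funeneg.
have p0 w : (0 <= p w)%E by exact: funepos_ge0.
have q0 w : (0 <= q w)%E by exact: funeneg_ge0.
have H : (\int[P]_w p w + \int[P]_w g w = \int[P]_w f w + \int[P]_w q w)%E.
  rewrite -!ge0_integralD//; apply: ae_eq_integral => //; try exact: emeasurable_funD.
  have := integrable_ae measurableT ig; apply: (@filterS _ _ (ae_filter_ringOfSetsType P)) => w /(_ Logic.I) gw _.
  rewrite /p /q funeposE funenegE; move: gw (g0 w) (f0 w).
  case: (g w) => // b _; case: (f w) => [a| |]// b0 a0; last first.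
    have -> : (+oo - b%:E = +oo :> \bar R)%E by [].
    by rewrite max_l ?leey// max_r// leNye.
  rewrite -EFinB -EFinN -!EFin_max -!EFinD; congr EFin.
  exact: max_aux.
have qg : (\int[P]_w q w <= \int[P]_w g w)%E.
  apply: ge0_le_integral => // w _; rewrite /q funenegE ge_max g0 andbT.
  move: (g0 w) (f0 w); case: (g w) => [b| |]//; case: (f w) => [a| |]//= b0 a0; last by rewrite leNye.
  by rewrite lee_fin; move: a0; rewrite lee_fin; lra.
have qfin : (\int[P]_w q w)%E \is a fin_num.
  by rewrite ge0_fin_numE ?integral_ge0// (le_lt_trans qg).
have gfin' : (\int[P]_w g w)%E \is a fin_num by rewrite ge0_fin_numE ?integral_ge0.
rewrite integralE -/p -/q; move: H qfin gfin'.
case: (\int[P]_w q w)%E => // c; case: (\int[P]_w g w)%E => // b; case: (\int[P]_w p w)%E => [a| |];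
  case: (\int[P]_w f w)%E => [e| |]//= [] H _ _.
by rewrite -EFinB -EFinD; congr EFin; lra.
Qed.

(** Completeness of [P] makes the integrand of the cost measurable, since it agrees almost surely
    with one built from regularised processes. *)
Lemma ae_measurable (f g : Omega -> \bar R) : {ae P, forall w, f w = g w} ->
  measurable_fun setT f -> measurable_fun setT g.
Proof.
move=> fg mf _ B mB; rewrite setTI.
pose N := [set w | f w <> g w].
have mN (A : set Omega) : A `<=` N -> measurable A.
  by move=> AN; apply: Pcomplete; apply: negligibleS fg => w /AN.
have -> : g @^-1` B = ((f @^-1` B) `\` N) `|` ((g @^-1` B) `&` N).
  apply/seteqP; split => w /=.
    by move=> gB; have [e|ne] := pselect (f w = g w); [left; rewrite e; split => // /(_ e)|right].
  by move=> [[fB /contrapT <-]|[]].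
apply: measurableU; last by apply: mN => w [].
by apply: measurableD; [have := mf measurableT B mB; rewrite setTI|exact: mN].
Qed.

Definition weight_total (L : R -> Omega -> R) w : \bar R :=
  (\int[stieltjes (L ^~ w)]_(s in `[0%R, +oo[) (Zp s w)%:E)%E.

Let Zp0 t w : 0 <= Zp t w := ltW (Zp_gt0 t w).

Lemma measurable_weight_total L : adapted_to L -> (forall w, increasing_path (L ^~ w)) ->
  measurable_fun setT (weight_total L).
Proof.
move=> aL IL.
apply: (emeasurable_fun_cvg (fun k w => (sint (Zp ^~ w) (L ^~ w) k%:R)%:E)) => [k|w _].
  apply/measurable_EFinP.
  apply: (adapted_toW (U := fun t w => sint (Zp ^~ w) (L ^~ w) t) Gm) => //.
  exact: (adapted_sint Fmono adapted_Zp aL (@continuous_Zp) Zp0 IL).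
exact: (sint_cvg_pinfty (IL w) (@continuous_Zp w) (fun s => Zp0 s w)).
Qed.

Lemma weight_total_ge0 L w : (0 <= weight_total L w)%E.
Proof. by apply: integral_ge0 => s _; rewrite lee_fin. Qed.

Lemma integral_weight_total L : adapted_to L -> (forall w, increasing_path (L ^~ w)) ->
  (\int[P]_w weight_total L w = rate_int L)%E.
Proof. by move=> aL IL; exact: integral_Zp_total. Qed.

Lemma integral_weight_totalZ c L : 0 <= c -> adapted_to L -> (forall w, increasing_path (L ^~ w)) ->
  (\int[P]_w (c%:E * weight_total L w) = c%:E * rate_int L)%E.
Proof.
move=> c0 aL IL; rewrite -integral_weight_total//.
have mw := measurable_weight_total aL IL.
exact: (@ge0_integralZl _ _ _ P setT measurableT (weight_total L) mw c%:E (fun w _ => weight_total_ge0 L w) c0).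
Qed.

(** What the cost needs to know of the link between a control and a rescaled pair, independent of
    which was built from the other; one cost formula thus serves [admissible_pair] and
    [pair_control]. *)
Definition tracks (phi : control R Omega) (u : proc_pair) := {ae P, forall w,
  [/\ forall t, 0 <= t -> state M W Y x phi t w = X1 t w * (x + u.1 t w - u.2 t w),
      discounted_total M Y (ctl_xi phi) w = weight_total u.1 w,
      discounted_total M Y (ctl_eta phi) w = weight_total u.2 w &
      regular_paths W Y w]}.

Definition running_total (u : proc_pair) w : \bar R :=
  (\int[leb]_(s in `[0%R, +oo[) (running u s w)%:E)%E.

Lemma running_total_ge0 u w : (0 <= running_total u w)%E.
Proof.
by apply: integral_ge0 => s; rewrite /= in_itv/= andbT => s0; rewrite lee_fin running_ge0.
Qed.

Lemma measurable_running_total u : feasible Gf x u -> measurable_fun setT (running_total u).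
Proof.
move=> fu.
apply: (@measurable_tonelli _ _ _ _ (fun z : Omega * R => (running u z.2 z.1)%:E) mo).
  by apply/measurable_EFinP; exact: joint_running.
by move=> z; rewrite /= in_itv/= andbT => z0; rewrite lee_fin running_ge0.
Qed.

Let c1_ge0 : 0 <= c1 M. Proof. by rewrite (le_trans (ltW c2_gt0))// ltW. Qed.

Definition gain_total u w : \bar R := (running_total u w + (c1 M)%:E * weight_total u.2 w)%E.

Lemma gain_total_ge0 u w : (0 <= gain_total u w)%E.
Proof. by rewrite adde_ge0 ?running_total_ge0// mule_ge0 ?lee_fin// weight_total_ge0. Qed.

Lemma measurable_gain_total u : feasible Gf x u -> measurable_fun setT (gain_total u).
Proof.
move=> fu; apply: emeasurable_funD; first exact: measurable_running_total.
apply: measurable_funeM; exact: (measurable_weight_total (fs_adapted2 fu) (fs_path2 fu)).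
Qed.

Lemma integral_gain_total u : feasible Gf x u ->
  (\int[P]_w gain_total u w = iter_int (running u) + (c1 M)%:E * rate_int u.2)%E.
Proof.
move=> fu; have m2 := measurable_weight_total (fs_adapted2 fu) (fs_path2 fu).
rewrite -(integral_weight_totalZ c1_ge0 (fs_adapted2 fu) (fs_path2 fu)).
have h0 w : setT w -> (0 <= (c1 M)%:E * weight_total u.2 w)%E.
  by move=> _; rewrite mule_ge0 ?lee_fin// weight_total_ge0.
exact: (ge0_integralD P measurableT (fun w _ => running_total_ge0 u w) (measurable_running_total fu)
  h0 (measurable_funeM _ m2)).
Qed.

Lemma cost_tracksE phi u : feasible Gf x u -> tracks phi u ->
  (cost P M W Y x phi = \int[P]_w (gain_total u w - (c2 M)%:E * weight_total u.1 w))%E.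
Proof.
move=> fu tr.
have mfg : measurable_fun setT (fun w => gain_total u w - (c2 M)%:E * weight_total u.1 w)%E.
  apply: emeasurable_funB; first exact: measurable_gain_total.
  apply: measurable_funeM; exact: (measurable_weight_total (fs_adapted1 fu) (fs_path1 fu)).
have fgE : {ae P, forall w, (gain_total u w - (c2 M)%:E * weight_total u.1 w)%E =
     (\int[leb]_(t in `[0%R, +oo[) (discount M Y t w * h M (state M W Y x phi t w) (Y t w))%:E
      + (c1 M)%:E * discounted_total M Y (ctl_eta phi) w
      - (c2 M)%:E * discounted_total M Y (ctl_xi phi) w)%E}.
  move: tr; apply: (@filterS _ _ (ae_filter_ringOfSetsType P)) => w [Xw xiw etaw rw].
  rewrite xiw etaw; congr (_ + _ - _)%E; apply: eq_integral => s.
  rewrite inE/= in_itv/= andbT => s0; congr EFin.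
  by rewrite (Xw _ s0) (discountE rw s0) /running (regYE rw s0).
have mc := ae_measurable fgE mfg.
apply/esym; rewrite /cost; apply: (@ae_eq_integral _ _ _ P setT _ _ measurableT mfg mc).
by move: fgE; apply: (@filterS _ _ (ae_filter_ringOfSetsType P)) => w e _; exact: e.
Qed.

Let ereal_cancel (p q s o : \bar R) (a b c : R) : (p + a%:E + c%:E = q + b%:E + s)%E ->
  (o + c%:E = q + s)%E -> (p + a%:E = o + b%:E)%E.
Proof.
move=> e1 e2; have e3 : (p + a%:E + c%:E = o + b%:E + c%:E)%E by rewrite e1 addeAC -e2 addeAC.
by rewrite -[LHS](@addeK _ c%:E)// e3 addeK.
Qed.

Lemma iter_Zp_ge0 : (0 <= iter_int (fun t w => kappa t w * Zp t w)%R)%E.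
Proof. by apply: iter_int_ge0 => t w _; exact: kZ0. Qed.

Lemma iter_Dp_ge0 : (0 <= iter_int Dp)%E.
Proof. by apply: iter_int_ge0 => t w _; exact: Dp0. Qed.

Lemma rate_int_ge0 L : (forall w, increasing_path (L ^~ w)) -> (0 <= rate_int L)%E.
Proof. by move=> IL; apply: iter_int_ge0; exact: kZL0. Qed.

Let fin_num_lty (p : \bar R) : (0 <= p)%E -> (p < +oo)%E -> p \is a fin_num.
Proof. by move=> p0; rewrite ge0_fin_numE. Qed.

Lemma iter_Zp_fin_num : iter_int (fun t w => kappa t w * Zp t w)%R \is a fin_num.
Proof. exact: (fin_num_lty iter_Zp_ge0 iter_Zp_fin). Qed.

Lemma iter_Dp_fin_num : iter_int Dp \is a fin_num.
Proof. exact: (fin_num_lty iter_Dp_ge0 Dp_fin). Qed.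

(** Finiteness of [rate_int u.1] lets the injection term, the only negative one in the cost, be
    cancelled against its counterpart in [Psi_split]; all other terms may be infinite or are finite
    constants. *)
Lemma cost_tracks phi u : feasible Gf x u -> tracks phi u -> (rate_int u.1 < +oo)%E ->
  (Psi u + (c2 M * x)%:E * iter_int (fun t w => kappa t w * Zp t w)%R =
   cost P M W Y x phi + K%:E * iter_int Dp)%E.
Proof.
move=> fu tr r1fin.
have c20 := ltW c2_gt0.
have m1 := measurable_weight_total (fs_adapted1 fu) (fs_path1 fu).
have intg := integral_weight_totalZ c20 (fs_adapted1 fu) (fs_path1 fu).
have gfin : (\int[P]_w ((c2 M)%:E * weight_total u.1 w) < +oo)%E.
  by rewrite intg; apply: lte_mul_pinfty => //; rewrite lee_fin.
have g0 w : (0 <= (c2 M)%:E * weight_total u.1 w)%E.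
  by rewrite mule_ge0 ?lee_fin// weight_total_ge0.
have := integral_subK (measurable_gain_total fu) (measurable_funeM _ m1)
  (gain_total_ge0 u) g0 gfin.
rewrite -(cost_tracksE fu tr) intg (integral_gain_total fu) => e2.
move: (Psi_split fu) e2.
have rfin : rate_int u.1 \is a fin_num by exact: (fin_num_lty (rate_int_ge0 (fs_path1 fu)) r1fin).
by rewrite -(fineK iter_Zp_fin_num) -(fineK iter_Dp_fin_num) -(fineK rfin) -!EFinM; exact: ereal_cancel.
Qed.

(** * Passage between controls and rescaled pairs *)

Local Notation X1V w := (fun s => (X1 s w)^-1).

Let X1V0 w s : 0 <= (X1 s w)^-1.
Proof. by rewrite invr_ge0 ltW// X1_gt0. Qed.

Let X10 w s : 0 <= X1 s w. Proof. exact: ltW (X1_gt0 s w). Qed.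

Lemma state_sint phi w t : regular_paths W Y w -> 0 <= t -> state M W Y x phi t w =
  X1 t w * (x + sint (X1V w) (ctl_xi phi ^~ w) t - sint (X1V w) (ctl_eta phi ^~ w) t).
Proof.
move=> rw t0; rewrite /state (state1E rw t0) /sint; congr (_ * (_ + _ - _));
  apply: eq_Rintegral => s; rewrite inE/= in_itv/= => /andP[s0 _]; by rewrite (state1E rw s0).
Qed.

(** The rescaled path has measure [df / X1], and [Zp / X1 = Dp]. The equality is obtained on finite
    horizons by [sint_chain] and then in the limit. *)
Lemma discounted_total_sint (f : R -> Omega -> R) w : regular_paths W Y w -> increasing_path (f ^~ w) ->
  discounted_total M Y f w =
  (\int[stieltjes (sint (X1V w) (f ^~ w))]_(s in `[0%R, +oo[) (Zp s w)%:E)%E.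
Proof.
move=> rw If.
have -> : discounted_total M Y f w = (\int[stieltjes (f ^~ w)]_(s in `[0%R, +oo[) (Dp s w)%:E)%E.
  by apply: eq_integral => s; rewrite inE/= in_itv/= andbT => s0; rewrite (discountE rw s0).
have c1 := sint_cvg_pinfty If (@continuous_Dp w) (fun s => Dp0 s w).
have IL := increasing_path_sint If (@continuous_X1V w) (X1V0 w).
have c2 := sint_cvg_pinfty IL (@continuous_Zp w) (fun s => Zp0 s w).
have chain (k : nat) : sint (Dp ^~ w) (f ^~ w) k%:R =
    sint (Zp ^~ w) (sint (X1V w) (f ^~ w)) k%:R.
  apply/esym; apply: etrans (sint_chain If (ler0n R k) (@continuous_X1V w) (@continuous_Zp w) (X1V0 w) (fun s => Zp0 s w)) _.
  by apply: eq_sint => s _; rewrite -(DpX1 s w) mulfK// gt_eqF// X1_gt0.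
have e : (fun k : nat => (sint (Dp ^~ w) (f ^~ w) k%:R)%:E) =
    (fun k => (sint (Zp ^~ w) (sint (X1V w) (f ^~ w)) k%:R)%:E).
  by apply/funext => k; rewrite chain.
rewrite e in c1; exact: (cvg_unique (@ereal_hausdorff R) c1 c2).
Qed.

Lemma sint_X1K (f : R -> R) w t : increasing_path f -> 0 <= t ->
  sint (X1 ^~ w) (sint (X1V w) f) t = f t.
Proof.
move=> If t0.
rewrite (sint_chain If t0 (@continuous_X1V w) (@continuous_X1 w) (X1V0 w) (X10 w)).
by rewrite -[RHS](sint1 If t0); apply: eq_sint => s _; rewrite mulfV// gt_eqF// X1_gt0.
Qed.

Lemma sint_X1VK (f : R -> R) w t : increasing_path f -> 0 <= t ->
  sint (X1V w) (sint (X1 ^~ w) f) t = f t.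
Proof.
move=> If t0.
rewrite (sint_chain If t0 (@continuous_X1 w) (@continuous_X1V w) (X10 w) (X1V0 w)).
by rewrite -[RHS](sint1 If t0); apply: eq_sint => s _; rewrite mulVf// gt_eqF// X1_gt0.
Qed.

Lemma adapted_sint_X1V f : adapted_to f -> (forall w, increasing_path (f ^~ w)) ->
  adapted_to (fun t w => sint (X1V w) (f ^~ w) t).
Proof.
move=> af If.
exact: (@adapted_sint _ _ _ Gf Fmono (fun t w => (X1 t w)^-1) f (adapted_inv adapted_X1 X1_gt0) af
  (@continuous_X1V) (fun s w => X1V0 w s) If).
Qed.

Definition good_control phi := [set w | [/\ regular_paths W Y w, increasing_path (ctl_xi phi ^~ w),
  increasing_path (ctl_eta phi ^~ w), forall t, 0 <= t -> 0 <= state M W Y x phi t w &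
  forall t, 0 <= t -> ctl phi t w = ctl_xi phi t w - ctl_eta phi t w]].

(** Admissibility gives a nonnegative state only for almost every time; the state is a
    left-continuous process times a continuous one, so nonnegativity holds at all positive times,
    and at 0 the state is a multiple of [x]. *)
Lemma ae_good_control phi : admissible P M W Y x phi -> {ae P, forall w, good_control phi w}.
Proof.
move=> [_ [_ st nd lc df _] _ pos].
have := @ae_section _ _ _ P (fun z => 0 <= z.2 -> 0 <= state M W Y x phi z.2 z.1) pos.
move: (ae_regular_paths bmW rcY) st nd lc df.
move=> h1 h2 h3 h4 h5 h6.
have h7 := @filterS3 _ _ (ae_filter_ringOfSetsType P) _ _ _ _ (fun w a b c => And3 a b c) h1 h2 h3.
have h8 := @filterS3 _ _ (ae_filter_ringOfSetsType P) _ _ _ _ (fun w a b c => And3 a b c) h4 h5 h6.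
move: h7 h8; apply: (@filterS2 _ _ (ae_filter_ringOfSetsType P)) => w [rw [s1 s2] [n1 n2]] [[l1 l2] dw pw].
have I1 : increasing_path (ctl_xi phi ^~ w) by split.
have I2 : increasing_path (ctl_eta phi ^~ w) by split.
split => // t; rewrite le_eqVlt => /predU1P[<-|t0].
  by rewrite (state_sint phi rw (lexx 0)) !sint0 subr0 addr0 mulr_ge0.
have J1 := increasing_path_sint I1 (@continuous_X1V w) (X1V0 w).
have J2 := increasing_path_sint I2 (@continuous_X1V w) (X1V0 w).
rewrite (state_sint phi rw (ltW t0)).
apply: (@left_continuous_ae_ge0 R (fun t => X1 t w * (x + sint (X1V w) (ctl_xi phi ^~ w) t - sint (X1V w) (ctl_eta phi ^~ w) t)) _ _ t t0).
  move=> s s0; apply: cvgM; first by apply: cvg_at_left_filter; exact: continuous_X1.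
  by apply: cvgB; [apply: cvgD; [exact: cvg_cst|exact: (ip_lc J1)]|exact: (ip_lc J2)].
move: pw; apply: (@filterS _ _ (ae_filter_ringOfSetsType leb)) => s ps s0.
by rewrite -(state_sint phi rw s0); exact: ps.
Qed.

Lemma adapted_cut (f : R -> Omega -> R) (C : set Omega) : adapted (filtration P W Y) f ->
  {ae P, forall w, C w} -> adapted_to (fun t w => \1_C w * f t w).
Proof.
move=> af aeC t t0; apply: (@meas_at_ae _ _ _ P W n Y t (f t)).
  by move: aeC; apply: (@filterS _ _ (ae_filter_ringOfSetsType P)) => w Cw; rewrite indicE mem_set// mul1r.
by move=> _ B mB; rewrite setTI; exact: (af t t0 B mB).
Qed.

Lemma increasing_path_cut (f : R -> Omega -> R) (C : set Omega) w :
  (C w -> increasing_path (f ^~ w)) -> increasing_path (fun t => \1_C w * f t w).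
Proof.
move=> If; have [Cw|nCw] := pselect (C w).
  by apply: increasing_pathZ; [rewrite indicE|exact: If].
rewrite indicE memNset//; under eq_fun do rewrite mul0r.
by split => // t t0; exact: cvg_cst.
Qed.

Lemma admissible_pair phi : admissible P M W Y x phi -> exists u,
  [/\ feasible Gf x u, tracks phi u, (rate_int u.1 < +oo)%E &
    {ae P, forall w, forall t, 0 <= t ->
      ctl phi t w = sint (X1 ^~ w) (u.1 ^~ w) t - sint (X1 ^~ w) (u.2 ^~ w) t}].
Proof.
move=> adm; have aeG := ae_good_control adm; have [_ [[axi aeta] _ _ _ _ _] fin _] := adm.
pose G := good_control phi.
(* Setting both parts to 0 off the almost sure set [G] makes their paths increasing for every [w]
   and keeps them adapted. *)
pose xi t w := \1_G w * ctl_xi phi t w; pose eta t w := \1_G w * ctl_eta phi t w.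
have a1 : adapted_to xi by exact: adapted_cut.
have a2 : adapted_to eta by exact: adapted_cut.
have I1 w : increasing_path (xi ^~ w) by apply: increasing_path_cut => -[].
have I2 w : increasing_path (eta ^~ w) by apply: increasing_path_cut => -[].
have xiE w : G w -> xi ^~ w = ctl_xi phi ^~ w.
  by move=> Gw; apply/funext => t; rewrite /xi indicE mem_set// mul1r.
have etaE w : G w -> eta ^~ w = ctl_eta phi ^~ w.
  by move=> Gw; apply/funext => t; rewrite /eta indicE mem_set// mul1r.
have noG w : ~ G w -> xi ^~ w = cst 0 /\ eta ^~ w = cst 0.
  by move=> nG; split; apply/funext => t; rewrite /xi /eta indicE memNset// mul0r.
clearbody xi eta.
have [u [u1 u2]] : exists u : proc_pair, (forall t w, u.1 t w = sint (X1V w) (xi ^~ w) t) /\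
    (forall t w, u.2 t w = sint (X1V w) (eta ^~ w) t).
  by exists ((fun t w => sint (X1V w) (xi ^~ w) t), (fun t w => sint (X1V w) (eta ^~ w) t)).
have u1E w : G w -> u.1 ^~ w = sint (X1V w) (ctl_xi phi ^~ w).
  by move=> Gw; apply/funext => t; rewrite u1; exact: (congr1 (fun f => sint (X1V w) f t) (xiE w Gw)).
have u2E w : G w -> u.2 ^~ w = sint (X1V w) (ctl_eta phi ^~ w).
  by move=> Gw; apply/funext => t; rewrite u2; exact: (congr1 (fun f => sint (X1V w) f t) (etaE w Gw)).
have u1w w : u.1 ^~ w = sint (X1V w) (xi ^~ w) by apply/funext => t; rewrite u1.
have u2w w : u.2 ^~ w = sint (X1V w) (eta ^~ w) by apply/funext => t; rewrite u2.
have u1t w t : G w -> u.1 t w = sint (X1V w) (ctl_xi phi ^~ w) t.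
  by move=> Gw; exact: (congr1 (fun f => f t) (u1E w Gw)).
have u2t w t : G w -> u.2 t w = sint (X1V w) (ctl_eta phi ^~ w) t.
  by move=> Gw; exact: (congr1 (fun f => f t) (u2E w Gw)).
have fu : feasible Gf x u.
  split.
  - move=> t t0; rewrite (_ : u.1 t = (fun w => sint (X1V w) (xi ^~ w) t)); last exact/funext.
    exact: (adapted_sint_X1V a1 I1).
  - move=> t t0; rewrite (_ : u.2 t = (fun w => sint (X1V w) (eta ^~ w) t)); last exact/funext.
    exact: (adapted_sint_X1V a2 I2).
  - by move=> w; rewrite u1w; exact: (increasing_path_sint (I1 w) (@continuous_X1V w) (X1V0 w)).
  - by move=> w; rewrite u2w; exact: (increasing_path_sint (I2 w) (@continuous_X1V w) (X1V0 w)).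
  - move=> t w t0; have [Gw|nG] := pselect (G w).
      have [rw _ _ pos _] := Gw; have := pos t t0; rewrite (state_sint phi rw t0).
      by rewrite pmulr_rge0 ?X1_gt0// subr_ge0 (u1t w t Gw) (u2t w t Gw).
    have [e1 e2] := noG w nG; rewrite u1 u2.
    have -> : sint (X1V w) (eta ^~ w) t = sint (X1V w) (xi ^~ w) t by rewrite e1 e2.
    by rewrite lerDr.
have tr : tracks phi u.
  move: aeG; apply: (@filterS _ _ (ae_filter_ringOfSetsType P)) => w Gw.
  have [rw J1 J2 _ _] := Gw; split; last exact: rw.
  - by move=> t t0; rewrite (state_sint phi rw t0) (u1t w t Gw) (u2t w t Gw).
  - rewrite (discounted_total_sint rw J1).
    exact: (congr1 (fun f => \int[stieltjes f]_(s in `[0%R, +oo[) (Zp s w)%:E)%E (esym (u1E w Gw))).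
  - rewrite (discounted_total_sint rw J2).
    exact: (congr1 (fun f => \int[stieltjes f]_(s in `[0%R, +oo[) (Zp s w)%:E)%E (esym (u2E w Gw))).
exists u; split; [exact: fu|exact: tr| |].
- rewrite -(integral_weight_total (fs_adapted1 fu) (fs_path1 fu)).
  have m1 := measurable_weight_total (fs_adapted1 fu) (fs_path1 fu).
  have m2 := measurable_weight_total (fs_adapted2 fu) (fs_path2 fu).
  have m12 : measurable_fun setT (fun w => weight_total u.2 w + weight_total u.1 w)%E.
    exact: emeasurable_funD.
  have e : {ae P, forall w, (weight_total u.2 w + weight_total u.1 w =
      discounted_total M Y (ctl_eta phi) w + discounted_total M Y (ctl_xi phi) w)%E}.
    by move: tr; apply: (@filterS _ _ (ae_filter_ringOfSetsType P)) => w [_ -> -> _].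
  apply: le_lt_trans fin.
  have <- : (\int[P]_w (weight_total u.2 w + weight_total u.1 w) = \int[P]_w
    (discounted_total M Y (ctl_eta phi) w + discounted_total M Y (ctl_xi phi) w))%E.
    apply: (@ae_eq_integral _ _ _ P setT _ _ measurableT m12 (ae_measurable e m12)).
    by move: e; apply: (@filterS _ _ (ae_filter_ringOfSetsType P)) => w ew _; exact: ew.
  apply: (ge0_le_integral P measurableT (fun w _ => weight_total_ge0 u.1 w) m1 m12) => w _.
  by rewrite leeDr// weight_total_ge0.
- move: aeG; apply: (@filterS _ _ (ae_filter_ringOfSetsType P)) => w Gw t t0.
  have [rw J1 J2 _ ->//] := Gw.
  rewrite -[in LHS](sint_X1K w J1 t0) -[in LHS](sint_X1K w J2 t0).
  have e1 := congr1 (fun f => sint (X1 ^~ w) f t) (u1E w Gw).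
  have e2 := congr1 (fun f => sint (X1 ^~ w) f t) (u2E w Gw).
  exact: (esym (f_equal2 (fun a b => a - b) e1 e2)).
Qed.

Lemma bounded_variation_increasingB (f g : R -> R) t : increasing_path f -> increasing_path g ->
  0 <= t -> bounded_variation 0 t (fun s => f s - g s).
Proof.
move=> If Ig; rewrite le_eqVlt => /predU1P[<-|t0]; first exact: bounded_variationxx.
have nd (p : R -> R) : increasing_path p -> bounded_variation 0 t p.
  move=> Ip; apply: nondecreasing_bounded_variation => a b; rewrite !in_itv/= => /andP[a0 _] _ ab.
  exact: (ip_le Ip a0 ab).
exact: (bounded_variationD t0 (nd f If) (bounded_variationN (nd g Ig))).
Qed.

Lemma adapted_common f g : adapted_to f -> adapted_to g ->
  (forall w, increasing_path (f ^~ w)) -> (forall w, increasing_path (g ^~ w)) ->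
  adapted_to (fun t w => common (f ^~ w) (g ^~ w) t).
Proof.
move=> af ag If Ig t t0.
apply: (@meas_at_cvg _ _ _ Gf t (fun k w => csum k (f ^~ w) (g ^~ w) t)).
  move=> k; apply: measurable_sum => j.
  have h i : 0 <= grid k i t <= t by rewrite grid_ge0// grid_le.
  have mi (p : R -> Omega -> R) i : adapted_to p -> meas_at Gf t (p (grid k i t)).
    by move=> ap; case/andP: (h i) => h0 h1; exact: (adapted_at Fmono ap h0 h1).
  by apply: measurable_minr; apply: measurable_funB; exact: mi.
by move=> w; exact: cvg_common.
Qed.

Lemma adapted_filtration f : adapted_to f -> adapted (filtration P W Y) f.
Proof. by move=> af t t0 B mB; have := af t t0 measurableT B mB; rewrite setTI. Qed.

Lemma ae_fst (Q : Omega -> Prop) : {ae P, forall w, Q w} -> {ae mu, forall z : Omega * R, Q z.1}.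
Proof.
move=> [N [mN N0 sub]]; exists (N `*` setT); split.
- exact: measurableX.
- transitivity (P N * leb setT)%E; first exact: product_measure1E.
  by rewrite N0 mul0e.
- by move=> [w t] /= nQ; split => //; exact: sub.
Qed.

Let pcost_rate t w a b : domain x a b ->
  kappa t w * Zp t w * b <= kappa_hi / ((c1 M - c2 M) * kappa_lo) * pcost t w a b /\
  kappa t w * Zp t w * a <= (kappa_hi + kappa_hi / ((c1 M - c2 M) * kappa_lo)) * pcost t w a b.
Proof.
move=> dab; have := pcost_ge t w dab; rewrite mulrA DpX1.
set e := (c1 M - c2 M) * kappa_lo => pge.
have e0 : 0 < e by rewrite mulr_gt0 ?subr_gt0// kappa_lo_gt0.
case: (dab) => a0 b0 bxa; have z0 := Zp0 t w.
have Zb : Zp t w * b <= e^-1 * pcost t w a b.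
  rewrite ler_pdivlMl//; apply: le_trans pge.
  by rewrite lerDr mulr_ge0// subr_ge0.
have Za : Zp t w * a <= pcost t w a b + Zp t w * b.
  rewrite -lerBlDr -mulrBr; apply: le_trans pge; apply: ler_wpDr.
    by apply: mulr_ge0; [exact: ltW|exact: mulr_ge0].
  by rewrite ler_wpM2l// lerB// lerDr.
have kk : kappa t w <= kappa_hi by case/andP: (kappa_itv t w).
have k0 := ltW (kappa_gt0 t w).
have up q r : 0 <= q -> q <= r -> kappa t w * q <= kappa_hi * r.
  by move=> q0 qr; apply: ler_pM.
split; rewrite -mulrA.
  by rewrite -[leRHS]mulrA; apply: up => //; exact: mulr_ge0.
rewrite [leRHS](_ : _ = kappa_hi * (pcost t w a b + e^-1 * pcost t w a b)).
  by apply: up; [exact: mulr_ge0|apply: le_trans Za _; rewrite lerD2l].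
by rewrite [LHS]mulrDl [RHS]mulrDr; congr (_ + _); rewrite [RHS]mulrA.
Qed.

(** Supplies the integrability that admissibility demands. [pcost] dominates [Zp * b] by [pcost_ge],
    and also [Zp * a], because [a] exceeds [b] by at most the rescaled state. *)
Lemma rate_int_lty u : feasible Gf x u -> (Psi u < +oo)%E ->
  (rate_int u.1 < +oo)%E /\ (rate_int u.2 < +oo)%E.
Proof.
move=> fu fin.
have jp : joint_meas (fun t w => pcost t w (u.1 t w) (u.2 t w)) by exact: measurable_pcost.
have p0 : time_ge0 (fun t w => pcost t w (u.1 t w) (u.2 t w)).
  by move=> t w t0; apply: pcost_ge0; exact: (feasible_domain w fu t0).
have e0 : 0 < (c1 M - c2 M) * kappa_lo by rewrite mulr_gt0 ?subr_gt0// kappa_lo_gt0.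
have kh := ltW kappa_hi_gt0.
have q0 : 0 <= kappa_hi / ((c1 M - c2 M) * kappa_lo) by rewrite divr_ge0// ltW.
have bound c (f : R -> Omega -> R) : 0 <= c -> joint_meas f -> time_ge0 f ->
    (forall t w, 0 <= t -> f t w <= c * pcost t w (u.1 t w) (u.2 t w)) -> (iter_int f < +oo)%E.
  move=> c0 jf f0 fc.
  have jc : joint_meas (fun t w => c * pcost t w (u.1 t w) (u.2 t w)) by apply: measurable_funM.
  apply: (le_lt_trans (le_iter_int jf jc f0 fc)).
  rewrite (iter_intZ c0 jp p0); apply: lte_mul_pinfty => //.
split.
- apply: (bound (kappa_hi + kappa_hi / ((c1 M - c2 M) * kappa_lo))).
  + exact: addr_ge0.
  + exact: (jkZL (fs_adapted1 fu) (fs_path1 fu)).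
  + exact: (kZL0 (fs_path1 fu)).
  + by move=> t w t0; have [] := pcost_rate t w (feasible_domain w fu t0).
- apply: (bound (kappa_hi / ((c1 M - c2 M) * kappa_lo))).
  + exact: q0.
  + exact: (jkZL (fs_adapted2 fu) (fs_path2 fu)).
  + exact: (kZL0 (fs_path2 fu)).
  + by move=> t w t0; have [] := pcost_rate t w (feasible_domain w fu t0).
Qed.

(** Removing [z] from both components leaves the state unchanged and saves [(c1 - c2) * kappa * z]
    in discounted units of [X1]: simultaneous injection and withdrawal is wasteful. *)
Let pcost_le_shift t w a b z : 0 <= z -> pcost t w (a - z) (b - z) <= pcost t w a b.
Proof.
move=> z0; rewrite /pcost (_ : x + (a - z) - (b - z) = x + a - b); last by ring.
rewrite ler_wpM2l// lerD2l ler_wpM2l ?mulr_ge0 ?subr_ge0 ?(ltW c12) ?(ltW (kappa_gt0 t w))//.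
by rewrite ler_wpM2l// gerBl.
Qed.

Lemma adapted_sint_X1 f : adapted_to f -> (forall w, increasing_path (f ^~ w)) ->
  adapted_to (fun t w => sint (X1 ^~ w) (f ^~ w) t).
Proof.
move=> af If.
exact: (@adapted_sint _ _ _ Gf Fmono X1 f adapted_X1 af (@continuous_X1) (fun s w => X10 w s) If).
Qed.

Let integral_weight_total_lty L : adapted_to L -> (forall w, increasing_path (L ^~ w)) ->
  (rate_int L < +oo)%E -> (\int[P]_w weight_total L w < +oo)%E.
Proof. by move=> aL IL fL; rewrite (integral_weight_total aL IL). Qed.

Lemma integral_discounted_lty phi v : feasible Gf x v -> tracks phi v ->
  (rate_int v.1 < +oo)%E -> (rate_int v.2 < +oo)%E ->
  (\int[P]_w (discounted_total M Y (ctl_eta phi) w + discounted_total M Y (ctl_xi phi) w) < +oo)%E.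
Proof.
move=> fv tr s1 s2.
have m1 := measurable_weight_total (fs_adapted1 fv) (fs_path1 fv).
have m2 := measurable_weight_total (fs_adapted2 fv) (fs_path2 fv).
have m12 : measurable_fun setT (fun w => weight_total v.2 w + weight_total v.1 w)%E.
  exact: emeasurable_funD.
have e : {ae P, forall w, (weight_total v.2 w + weight_total v.1 w =
    discounted_total M Y (ctl_eta phi) w + discounted_total M Y (ctl_xi phi) w)%E}.
  by move: tr; apply: (@filterS _ _ (ae_filter_ringOfSetsType P)) => w [_ -> -> _].
have <- : (\int[P]_w (weight_total v.2 w + weight_total v.1 w) = \int[P]_w
  (discounted_total M Y (ctl_eta phi) w + discounted_total M Y (ctl_xi phi) w))%E.
  apply: (@ae_eq_integral _ _ _ P setT _ _ measurableT m12 (ae_measurable e m12)).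
  by move: e; apply: (@filterS _ _ (ae_filter_ringOfSetsType P)) => w ew _; exact: ew.
have h2 w : setT w -> (0 <= weight_total v.2 w)%E by move=> _; exact: weight_total_ge0.
have h1 w : setT w -> (0 <= weight_total v.1 w)%E by move=> _; exact: weight_total_ge0.
rewrite (ge0_integralD P measurableT h2 m2 h1 m1).
have i2 := integral_weight_total_lty (fs_adapted2 fv) (fs_path2 fv) s2.
have i1 := integral_weight_total_lty (fs_adapted1 fv) (fs_path1 fv) s1.
exact: (lte_add_pinfty i2 i1).
Qed.

(** Minimality concerns the measures of [xi] and [eta], so the common part is removed in the
    original scale; in the rescaled variables this is a common shift, to which [pcost_le_shift]
    applies. *)
Lemma pair_control u : feasible Gf x u -> (Psi u < +oo)%E -> exists phi v,
  [/\ admissible P M W Y x phi, feasible Gf x v, tracks phi v & (Psi v <= Psi u)%E].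
Proof.
move=> fu ufin; have [r1 r2] := rate_int_lty fu ufin.
have [xi0 [axi0 Ixi0 xi0E]] : exists f, [/\ adapted_to f, forall w, increasing_path (f ^~ w) &
    forall w, f ^~ w = sint (X1 ^~ w) (u.1 ^~ w)].
  exists (fun t w => sint (X1 ^~ w) (u.1 ^~ w) t); split.
  - exact: (adapted_sint_X1 (fs_adapted1 fu) (fs_path1 fu)).
  - by move=> w; exact: (increasing_path_sint (fs_path1 fu w) (@continuous_X1 w) (X10 w)).
  - by move=> w; exact: erefl.
have [eta0 [aeta0 Ieta0 eta0E]] : exists f, [/\ adapted_to f, forall w, increasing_path (f ^~ w) &
    forall w, f ^~ w = sint (X1 ^~ w) (u.2 ^~ w)].
  exists (fun t w => sint (X1 ^~ w) (u.2 ^~ w) t); split.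
  - exact: (adapted_sint_X1 (fs_adapted2 fu) (fs_path2 fu)).
  - by move=> w; exact: (increasing_path_sint (fs_path2 fu w) (@continuous_X1 w) (X10 w)).
  - by move=> w; exact: erefl.
have azeta := adapted_common axi0 aeta0 Ixi0 Ieta0.
pose zeta t w := common (xi0 ^~ w) (eta0 ^~ w) t.
have Izeta w : increasing_path (zeta ^~ w) by exact: increasing_path_common.
pose xi t w := xi0 t w - zeta t w; pose eta t w := eta0 t w - zeta t w.
have axi : adapted_to xi by move=> t t0; apply: measurable_funB; [exact: axi0|exact: azeta].
have aeta : adapted_to eta by move=> t t0; apply: measurable_funB; [exact: aeta0|exact: azeta].
have Ixi w : increasing_path (xi ^~ w) by exact: (increasing_pathB_common (Ixi0 w) (Ieta0 w)).
have Ieta w : increasing_path (eta ^~ w).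
  by rewrite /eta /zeta commonC; exact: (increasing_pathB_common (Ieta0 w) (Ixi0 w)).
have djs w : disjoint_supports (stieltjes (xi ^~ w)) (stieltjes (eta ^~ w)).
  apply: (disjoint_supports_csum (Ixi w) (Ieta w)) => t t0.
  exact: (csum_common_cvg0 (Ixi0 w) (Ieta0 w) t0).
have xiD w : xi0 ^~ w = (fun t => xi t w + zeta t w) by apply/funext => t; rewrite /xi subrK.
have etaD w : eta0 ^~ w = (fun t => eta t w + zeta t w) by apply/funext => t; rewrite /eta subrK.
clearbody xi eta zeta.
(* The rescaled image of the common part [zeta]: by additivity of the integral, both components lose
   exactly [z]. *)
pose z t w := sint (X1V w) (zeta ^~ w) t.
have z0 t w : 0 <= t -> 0 <= z t w.
  by move=> t0; exact: (ip_ge0 (increasing_path_sint (Izeta w) (@continuous_X1V w) (X1V0 w)) t0).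
have decomp (f0 f : R -> Omega -> R) (L : R -> R) w t : increasing_path L -> increasing_path (f ^~ w) ->
    f0 ^~ w = sint (X1 ^~ w) L -> f0 ^~ w = (fun t => f t w + zeta t w) -> 0 <= t ->
    sint (X1V w) (f ^~ w) t = L t - z t w.
  move=> IL If e1 e2 t0; rewrite -(sint_X1VK w IL t0) -e1 e2.
  by rewrite (sintD (If) (Izeta w) t0 (@continuous_X1V w) (X1V0 w)) addrK.
have [v [v1 v2]] : exists v : proc_pair, (forall w, v.1 ^~ w = sint (X1V w) (xi ^~ w)) /\
    (forall w, v.2 ^~ w = sint (X1V w) (eta ^~ w)).
  exists ((fun t w => sint (X1V w) (xi ^~ w) t), (fun t w => sint (X1V w) (eta ^~ w) t)).
  by split=> w; exact: erefl.
have v1t w t : v.1 t w = sint (X1V w) (xi ^~ w) t by rewrite -(v1 w).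
have v2t w t : v.2 t w = sint (X1V w) (eta ^~ w) t by rewrite -(v2 w).
have v1z w t : 0 <= t -> v.1 t w = u.1 t w - z t w.
  by move=> t0; rewrite v1t; exact: (decomp xi0 xi _ w t (fs_path1 fu w) (Ixi w) (xi0E w) (xiD w) t0).
have v2z w t : 0 <= t -> v.2 t w = u.2 t w - z t w.
  by move=> t0; rewrite v2t; exact: (decomp eta0 eta _ w t (fs_path2 fu w) (Ieta w) (eta0E w) (etaD w) t0).
have fv : feasible Gf x v.
  split.
  - move=> t t0; rewrite (_ : v.1 t = (fun w => sint (X1V w) (xi ^~ w) t)); last exact/funext.
    exact: (adapted_sint_X1V axi Ixi).
  - move=> t t0; rewrite (_ : v.2 t = (fun w => sint (X1V w) (eta ^~ w) t)); last exact/funext.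
    exact: (adapted_sint_X1V aeta Ieta).
  - by move=> w; rewrite v1; exact: (increasing_path_sint (Ixi w) (@continuous_X1V w) (X1V0 w)).
  - by move=> w; rewrite v2; exact: (increasing_path_sint (Ieta w) (@continuous_X1V w) (X1V0 w)).
  - by move=> t w t0; rewrite (v1z w t t0) (v2z w t t0) addrA lerD2r; exact: (fs_bound fu).
pose phi := Control (fun t w => xi t w - eta t w) xi eta.
have ph1 : ctl_xi phi = xi by [].
have ph2 : ctl_eta phi = eta by [].
have ph0 t w : ctl phi t w = xi t w - eta t w by [].
clearbody phi.
have tr : tracks phi v.
  move: (ae_regular_paths bmW rcY); apply: (@filterS _ _ (ae_filter_ringOfSetsType P)) => w rw.
  split; last exact: rw.
  - by move=> t t0; rewrite (state_sint phi rw t0) ph1 ph2 v1t v2t.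
  - rewrite ph1 (discounted_total_sint rw (Ixi w)).
    exact: (congr1 (fun f => \int[stieltjes f]_(s in `[0%R, +oo[) (Zp s w)%:E)%E (esym (v1 w))).
  - rewrite ph2 (discounted_total_sint rw (Ieta w)).
    exact: (congr1 (fun f => \int[stieltjes f]_(s in `[0%R, +oo[) (Zp s w)%:E)%E (esym (v2 w))).
have jp u' : feasible Gf x u' -> joint_meas (fun t w => pcost t w (u'.1 t w) (u'.2 t w)).
  by move=> fu'; exact: measurable_pcost.
have vu : (Psi v <= Psi u)%E.
  apply: (le_iter_int (jp v fv) (jp u fu)) => t w t0.
    by apply: pcost_ge0; exact: (feasible_domain w fv t0).
  by rewrite (v1z w t t0) (v2z w t t0); exact: (pcost_le_shift _ _ _ _ (z0 t w t0)).
have [s1 s2] := rate_int_lty fv (le_lt_trans vu ufin).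
exists phi, v; split; [|exact: fv|exact: tr|exact: vu].
have aphi : adapted_to (ctl phi).
  move=> t t0; rewrite (_ : ctl phi t = (fun w => xi t w - eta t w)); last exact/funext.
  by apply: measurable_funB; [exact: axi|exact: aeta].
split.
- split.
  + exact: adapted_filtration.
  + by apply: aeW => w; rewrite ph0 (ip0 (Ixi w)) (ip0 (Ieta w)) subrr.
  + apply: aeW => w t t0; rewrite (_ : ctl phi ^~ w = (fun t => xi t w - eta t w)); last exact/funext.
    by rewrite ph0; apply: cvgB; [exact: (ip_lc (Ixi w))|exact: (ip_lc (Ieta w))].
  + apply: aeW => w t t0; rewrite (_ : ctl phi ^~ w = (fun t => xi t w - eta t w)); last exact/funext.
    exact: (bounded_variation_increasingB (Ixi w) (Ieta w) t0).
- split; rewrite ?ph1 ?ph2.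
  + by split; exact: adapted_filtration.
  + by apply: aeW => w; rewrite (ip0 (Ixi w)) (ip0 (Ieta w)).
  + by apply: aeW => w; split; [exact: (ip_nd (Ixi w))|exact: (ip_nd (Ieta w))].
  + by apply: aeW => w; split; [exact: (ip_lc (Ixi w))|exact: (ip_lc (Ieta w))].
  + by apply: aeW => w t t0; rewrite ph0.
  + by apply: aeW => w; exact: djs.
- exact: (integral_discounted_lty fv tr s1 s2).
- have tr0 : {ae P, forall w, forall t : R, 0 <= t -> 0 <= state M W Y x phi t w}.
    move: tr; apply: (@filterS _ _ (ae_filter_ringOfSetsType P)) => w [st _ _ _] t t0.
    rewrite (st t t0); apply: (mulr_ge0 (X10 w t)).
    by rewrite subr_ge0; exact: (fs_bound fv w t0).
  apply: (@filterS _ _ (ae_filter_ringOfSetsType mu) _ _ _ (ae_fst tr0)) => zz h.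
  exact: h.
Qed.

(** The integral is available only for increasing paths, so the equality of differences is first
    rewritten as an equality of the increasing paths [f + g'] and [f' + g]. *)
Lemma eq_sintB (G f g f' g' : R -> R) t : continuous G -> (forall s, 0 <= G s) ->
  increasing_path f -> increasing_path g -> increasing_path f' -> increasing_path g' ->
  0 <= t -> (forall s, 0 <= s -> f s - g s = f' s - g' s) ->
  sint G f t - sint G g t = sint G f' t - sint G g' t.
Proof.
move=> cG G0 If Ig If' Ig' t0 e.
have := @eq_sint_path _ t t0 G (fun s => f s + g' s) (fun s => f' s + g s)
  (increasing_pathD If Ig') (increasing_pathD If' Ig) cG G0.
rewrite (sintD If Ig' t0 cG G0) (sintD If' Ig t0 cG G0) => H.
have {}H : sint G f t + sint G g' t = sint G f' t + sint G g t.
  apply: H => s /andP[s0 _]; have := e s s0.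
  by move: (f s) (g s) (f' s) (g' s) => a b a' b'; lra.
by move: H; move: (sint G f t) (sint G g t) (sint G f' t) (sint G g' t) => a b a' b'; lra.
Qed.

Let shift_cost (p q Z D : \bar R) (a k : R) : Z \is a fin_num -> D \is a fin_num ->
  (p + a%:E * Z = q + k%:E * D)%E -> q = (p + (a * fine Z - k * fine D)%:E)%E.
Proof.
move=> /fineK <- /fineK <-; rewrite -!EFinM; move: (a * _) (k * _) => b b' e /=.
by rewrite EFinB addeA e addeK.
Qed.

Let leeD2r_fin (p q : \bar R) c : (p <= q)%E -> (p + c%:E <= q + c%:E)%E.
Proof. exact: leeD2r. Qed.

Let addeI_fin (p q : \bar R) c : (p + c%:E = q + c%:E)%E -> p = q.
Proof. by move=> e; rewrite -[p](@addeK _ c%:E)// e addeK. Qed.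

Lemma cost_shift : exists c : R, forall psi v, feasible Gf x v -> tracks psi v ->
  (rate_int v.1 < +oo)%E -> cost P M W Y x psi = (Psi v + c%:E)%E.
Proof.
(* The constant is [c2 * x] times the integral of [kappa * Zp] minus [K] times that of [Dp]; both
   integrals are finite, and neither depends on the control. *)
eexists => psi v fv tr r.
exact: (shift_cost iter_Zp_fin_num iter_Dp_fin_num (cost_tracks fv tr r)).
Qed.

Theorem optimal_control : exists phi, optimal P M W Y x phi /\
  forall psi, optimal P M W Y x psi -> indistinguishable P (ctl psi) (ctl phi).
Proof.
have [u fu umin] := Psi_minimiser Psi_finite.
have ufin : (Psi u < +oo)%E.
  by have [u0 fu0 fin0] := Psi_finite; exact: le_lt_trans (umin u0 fu0) fin0.
have [phi [v [adm fv tr vu]]] := pair_control fu ufin.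
have vfin := le_lt_trans vu ufin; have [rv _] := rate_int_lty fv vfin.
have vmin v' : feasible Gf x v' -> (Psi v <= Psi v')%E.
  by move=> fv'; exact: le_trans vu (umin v' fv').
have [c costP] := cost_shift.
have cphi := costP phi v fv tr rv.
have best psi : admissible P M W Y x psi -> (cost P M W Y x phi <= cost P M W Y x psi)%E.
  move=> /admissible_pair[u' [fu' tr' r' _]].
  rewrite cphi (costP psi u' fu' tr' r'); exact: (leeD2r_fin c (vmin u' fu')).
have opt : optimal P M W Y x phi.
  split; first exact: adm.
  apply/eqP; rewrite eq_le; apply/andP; split.
    by apply: le_ereal_inf_tmp => _ [psi apsi <-]; exact: best.
  by apply: ereal_inf_lbound; exists phi; [exact: adm|exact: erefl].
exists phi; split => // psi [apsi cpsi].
(* [phi] itself is read back as a pair, because [admissible_pair] also recovers the control from its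
   pair. Equal costs give equal [Psi], so [u1] and [u2] are both minimisers. *)
have [u1 [fu1 tr1 r1 e1]] := admissible_pair adm.
have [u2 [fu2 tr2 r2 e2]] := admissible_pair apsi.
have E1 : Psi u1 = Psi v.
  exact: (@addeI_fin _ _ c (etrans (esym (costP phi u1 fu1 tr1 r1)) cphi)).
have E2 : Psi u2 = Psi u1.
  apply: (@addeI_fin _ _ c (etrans (esym (costP psi u2 fu2 tr2 r2)) _)).
  exact: (etrans (etrans cpsi (esym opt.2)) (costP phi u1 fu1 tr1 r1)).
have same : {ae P, forall w, forall t, 0 <= t -> u1.1 t w - u1.2 t w = u2.1 t w - u2.2 t w}.
  apply: (@minimiser_unique R d Omega P Gf x pcost measurable_pcost _ _ _ u1 u2 fu1 fu2 _ _ E2).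
  - by move=> t w a b _; exact: pcost_ge0.
  - by move=> t w a b a' b' _; exact: pcost_mid.
  - by move=> t w a b a' b' _; exact: pcost_strict.
  - by rewrite E1.
  - by move=> v' fv'; rewrite E1; exact: vmin.
move: same e1 e2; apply: (@filterS3 _ _ (ae_filter_ringOfSetsType P)) => w sw h1 h2 t t0.
rewrite (h1 t t0) (h2 t t0); apply/esym.
exact: (eq_sintB (@continuous_X1 w) (X10 w) (fs_path1 fu1 w) (fs_path2 fu1 w)
  (fs_path1 fu2 w) (fs_path2 fu2 w) t0 sw).
Qed.

End model_processes.

Theorem theorem3p4 (R : realType) (n : nat)
  (d : measure_display) (Omega : measurableType d) (P : probability Omega R)
  (W : R -> Omega -> R) (Q : 'M[R]_n.+2)
  (Y : 'I_n.+2 -> R -> Omega -> 'I_n.+2)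
  (M : model R n) (rho_lo rho_hi m : R) :
  measure_is_complete P ->
  brownian_motion P W ->
  irreducible_generator Q ->
  (forall i, markov_chain P Q i (Y i)) ->
  (forall i, independent P <<s real_events W `[0, +oo[%classic >>
                           <<s chain_events (Y i) `[0, +oo[%classic >>) ->
  0 < rr M ->
  0 < sigma M ->
  {homo lambda M : i j / (i <= j)%N >-> j <= i} ->
  0 < rho_lo ->
  rho_lo <= rho_hi ->
  (forall i, rho_lo <= rho M i <= rho_hi) ->
  0 < c1 M ->
  0 < c2 M ->
  1 < m ->
  (forall i, running_cost_assumptions M m i) ->
  c2 M * (rho_hi - rr M + gg M - lambda M ord_max) <
    c1 M * (rho_lo - rr M + gg M - lambda M ord0) ->
  Num.max (Num.max (rr M - gg M + lambda M ord0)
             (m * (rr M - gg M + lambda M ord0)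
              + sigma M ^+ 2 / 2 * m * (m - 1))) 0 < rho_lo ->
  forall (x : R) (i : 'I_n.+2), 0 <= x ->
  exists phi : control R Omega,
    optimal P M W (Y i) x phi /\
    forall psi : control R Omega, optimal P M W (Y i) x psi ->
      indistinguishable P (ctl psi) (ctl phi).
Proof.
move=> cP bm _ mc ind _ _ lam rho0 rlh rhoi c1p c2p _ hA par1 par2 x i x0.
have rho_gt : rr M - gg M + lambda M ord0 < rho_lo.
  by move: par2; rewrite !gt_max => /andP[/andP[]].
(* The bracket multiplying [c2] in the parameter assumption is at least the one multiplying [c1],
   and the latter is positive by the lower bound on [rho_lo]; so the assumption survives replacing
   the first by the second and can be divided by it. *)
have c12 : c2 M < c1 M.
  have l0 : lambda M ord_max <= lambda M ord0 by exact: lam.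
  have B0 : 0 < rho_lo - rr M + gg M - lambda M ord0 by lra.
  rewrite -(ltr_pM2r B0); apply: le_lt_trans par1.
  by rewrite ler_pM2l//; lra.
have mY (t : R) : 0 <= t -> forall j, measurable (Y i t @^-1` [set j]).
  exact: (@mc_measurable _ _ _ _ _ _ _ _ (mc i) t).
have rcY : {ae P, forall w, forall t : R, 0 <= t -> \forall s \near t^'+, Y i s w = Y i t w}.
  by move: (mc_cadlag (mc i)); apply: (@filterS _ _ (ae_filter_ringOfSetsType P)) => w [].
have [K K0 hK] := h_bound lam rhoi rho_gt c2p hA.
exact: (optimal_control cP bm mY rcY (ind i) lam rho0 rhoi rho_gt c2p c12 hA x0 K0 hK).
Qed.
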